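(* For $n\ge 1$ define $E_n:L^1(\Omega)\to[0,\infty]$ by $$E_n(u)=\begin{cases}\displaystyle\int_\Omega\frac{\Phi_n(x,|\nabla u|)}{\varphi_n(x,1)}\,dx,& u\in W^{1,\Phi_n(\cdot)}(\Omega),\\ \infty,&\text{otherwise,}\end{cases}$$ and define $E_\infty:L^1(\Omega)\to[0,\infty]$ by $$E_\infty(u)=\begin{cases}0,& u\in W^{1,\infty}(\Omega)\text{ and }\|\nabla u\|_{L^\infty}\le 1,\\ \infty,&\text{otherwise.}\end{cases}$$ Assume $\lim_{n\to\infty}p_n^-=\infty$ and that there is a constant $\mu>1$ with $p_n^+\le\mu p_n^-$ for all $n$. Then $E_n$ $\Gamma$-converges to $E_\infty$ in $L^1(\Omega)$ as $n\to\infty$.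
   Context: $\Omega\subset\mathbb{R}^d$ is a bounded smooth domain. For each $n\ge1$, $\varphi_n\in C(\overline\Omega\times[0,\infty))\cap C^1(\Omega\times(0,\infty))$, $\varphi_n(x,s)>0$ for $x\in\Omega$, $s>0$, and there are constants $p_n^-,p_n^+>0$ with $0<p_n^--1\le \frac{s\,\partial_s\varphi_n(x,s)}{\varphi_n(x,s)}\le p_n^+-1$ for all $x\in\Omega$, $s>0$. Put $\Phi_n(x,s)=\int_0^s\varphi_n(x,t)\,dt$. For $\Phi=\Phi_n$ let $\varrho_{\Phi(\cdot)}(u)=\int_\Omega\Phi(x,|u(x)|)\,dx$; $L^{\Phi(\cdot)}(\Omega)=\{u\in L^1(\Omega):\lim_{\lambda\to0}\varrho_{\Phi(\cdot)}(\lambda u)=0\}$ with norm $\|u\|_{L^{\Phi(\cdot)}}=\inf\{\lambda>0:\varrho_{\Phi(\cdot)}(u/\lambda)\le1\}$; $W^{1,\Phi(\cdot)}(\Omega)$ is the set of $u\in L^{\Phi(\cdot)}(\Omega)$ whose weak partial derivatives belong to $L^{\Phi(\cdot)}(\Omega)$. $\Gamma$-convergence: for a metric space $X$, functionals $J_n:X\to\mathbb{R}\cup\{\infty\}$ $\Gamma$-converge to $J$ if for every $u\in X$: (i) $J(u)\le\liminf_{n\to\infty}J_n(v_n)$ for every sequence $v_n\to u$ in $X$; (ii) there is a sequence $v_n\to u$ in $X$ with $J(u)\ge\limsup_{n\to\infty}J_n(v_n)$. *)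

(* Defs.v *)
From HB Require Import structures.
From mathcomp Require Import all_boot all_order all_algebra.
From mathcomp Require Import all_classical all_reals all_analysis.
From mathcomp Require Import measurable_realfun ess_sup_inf.

Set Implicit Arguments.
Unset Strict Implicit.
Unset Printing Implicit Defensive.

Import Order.TTheory GRing.Theory Num.Theory.
Import numFieldNormedType.Exports.

Local Open Scope classical_set_scope.
Local Open Scope ring_scope.

Definition borel_mx_display : measure_display.
Proof. exact: default_measure_display. Qed.

Section borel_matrix.
Context (R : realType) (m n : nat).
Let G := @open 'M[R]_(m, n).

HB.instance Definition _ := @isMeasurable.Build borel_mx_display 'M[R]_(m, n)
  <<s G >> (@sigma_algebra0 _ setT G) (@sigma_algebraC _ G)
  (@sigma_algebra_bigcup _ setT G).

Lemma open_measurable_mx (U : set 'M[R]_(m, n)) : open U -> measurable U.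
Proof. exact: sub_sigma_algebra. Qed.
End borel_matrix.

Section lebesgue_rV.
Context (R : realType).

(* R^(n+1) is identified with R * R^n, so that Lebesgue measure on 'rV[R]_n can
   be built by iterated products; lebesgue_rV_box below computes it on boxes. *)
Definition cons_rV n (z : measurableTypeR R * 'rV[R]_n) : 'rV[R]_n.+1 :=
  row_mx (const_mx z.1 : 'rV[R]_1) z.2.

Lemma cons_rVE n z : (@cons_rV n z ord0 ord0 = z.1) *
  (forall i, cons_rV z ord0 (lift ord0 i) = z.2 ord0 i).
Proof.
rewrite /cons_rV; split=> [|i]; rewrite mxE; case: splitP => // j.
- by rewrite mxE.
- by rewrite (ord1 j) lift0.
- by rewrite lift0 /= add1n => -[] /ord_inj ->.
Qed.

Lemma cons_rV_ball n (x : 'rV[R]_n.+1) (e : R) : 0 < e ->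
  @cons_rV n @^-1` ball x e =
  (ball (x ord0 ord0) e : set R) `*` ball (\row_i x ord0 (lift ord0 i)) e.
Proof.
move=> e0; apply/seteqP; split=> -[a v] /=.
- move=> [_ xv]; split; first by have := xv ord0 ord0; rewrite cons_rVE.
  split=> // i j; rewrite (ord1 i) mxE.
  by have := xv ord0 (lift ord0 j); rewrite cons_rVE.
- move=> [xa [_ xv]]; split=> // i j; rewrite (ord1 i).
  case: (unliftP ord0 j) => [k|] ->; rewrite cons_rVE //=.
  by have := xv ord0 k; rewrite mxE.
Qed.

Lemma open_rV_rat_ball n (U : set 'rV[R]_n) : open U ->
  U = \bigcup_(p in [set p : 'rV[rat]_n * nat |
        ball (map_mx ratr p.1 : 'rV[R]_n) p.2.+1%:R^-1 `<=` U])
      ball (map_mx ratr p.1 : 'rV[R]_n) p.2.+1%:R^-1.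
Proof.
move=> oU; apply/seteqP; split=> [x Ux|x [p /= pU]]; last exact: pU.
have /nbhs_ballP[e /= e0 xeU] : nbhs x U by exact: open_nbhs_nbhs.
have [k _ /(_ k (leqnn k)) /= ke] :=
  near_infty_natSinv_lt (PosNum (divr_gt0 e0 (ltr0n R 2))).
set r : R := k.+1%:R^-1; have r0 : 0 < r by rewrite invr_gt0.
have q_ (i : 'I_n) : {q : rat | ball (x ord0 i) r (ratr q : R)}.
  apply: cid; have /rat_in_itvoo[q] : x ord0 i - r < x ord0 i + r.
    by rewrite ltrBlDr -addrA ltrDl addr_gt0.
  rewrite in_itv /= => /andP[q1 q2]; exists q.
  by rewrite /ball /= ltr_distlC q1 q2.
have xq : ball x r (map_mx ratr (\row_i sval (q_ i)) : 'rV[R]_n).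
  by split=> // i j; rewrite (ord1 i) !mxE; exact: (svalP (q_ j)).
exists (\row_i sval (q_ i), k) => /=; last exact: ball_sym.
move=> y qy; apply: xeU; rewrite -(addrNK r e).
apply: (@ball_triangle _ _ (map_mx ratr (\row_i sval (q_ i)) : 'rV[R]_n)) => //.
apply: le_ball xq; rewrite lerBrDr; apply/ltW.
by rewrite (splitr e) ltrD.
Qed.

Lemma measurable_coord_rV n (i : 'I_n) :
  measurable_fun setT (fun x : 'rV[R]_n => x ord0 i : measurableTypeR R).
Proof.
apply: (measurability _ (RGenOpens.measurableE R)) => // _ [_ [a [b ->]] <-].
rewrite setTI; apply: open_measurable_mx.
by apply: open_comp; [move=> ? _; exact: coord_continuous|exact: interval_open].
Qed.

Lemma measurable_cons_rV n : measurable_fun setT (@cons_rV n).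
Proof.
apply: (measurability (@open 'rV[R]_n.+1)) => // _ [U oU <-].
rewrite setTI (open_rV_rat_ball oU) bigcup_mkcond preimage_bigcup.
apply: countable_bigcupT_measurable => [|p]; first exact: countableP.
case: ifPn => _; last by rewrite preimage_set0.
rewrite cons_rV_ball ?invr_gt0//; apply: measurableX.
- by apply: open_measurable; exact: ball_open.
- by apply: open_measurable_mx; exact: ball_open.
Qed.

Definition behead_rV n (x : 'rV[R]_n.+1) : 'rV[R]_n :=
  \row_i x ord0 (lift ord0 i).

Lemma measurable_behead_rV n : measurable_fun setT (@behead_rV n).
Proof.
apply: (measurability (@open 'rV[R]_n)) => // _ [U oU <-].
rewrite setTI; apply: open_measurable_mx.
rewrite openE => x /= Ux; apply/nbhs_ballP.
have /nbhs_ballP[e /= e0 eU] : nbhs (behead_rV x) U by exact: open_nbhs_nbhs.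
exists e => //= y [_ xy]; apply: eU; split=> // i j.
by rewrite !mxE; exact: xy.
Qed.

Section lebesgue_cons.
Context n (m : {sigma_finite_measure set 'rV[R]_n -> \bar R}).

Definition lebesgue_cons : set 'rV[R]_n.+1 -> \bar R :=
  pushforward (@lebesgue_measure R \x m)%E (@cons_rV n).


Let mc := @measurable_cons_rV n.

Let lebesgue_cons0 : lebesgue_cons set0 = 0%E.
Proof.
exact: (@measure0 _ _ _ (pushforward (lebesgue_measure \x m)%E (@cons_rV n))).
Qed.

Let lebesgue_cons_ge0 A : (0 <= lebesgue_cons A)%E.
Proof. exact: measure_ge0. Qed.

Let lebesgue_cons_sigma_additive : semi_sigma_additive lebesgue_cons.
Proof. exact: measure_semi_sigma_additive. Qed.

HB.instance Definition _ := isMeasure.Build _ _ _ lebesgue_cons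
  lebesgue_cons0 lebesgue_cons_ge0 lebesgue_cons_sigma_additive.

Let lebesgue_cons_sigma_finite : sigma_finite setT lebesgue_cons.
Proof.
have /sigma_finiteP[F [TF ndF Foo]] := sigma_finiteT (@lebesgue_measure R).
have /sigma_finiteP[G [TG ndG Goo]] := sigma_finiteT m.
pose g (x : 'rV[R]_n.+1) : measurableTypeR R * 'rV[R]_n :=
  (x ord0 ord0, behead_rV x).
have mg : measurable_fun setT g.
  apply/measurable_fun_pairP; split; last exact: measurable_behead_rV.
  exact: measurable_coord_rV.
exists (fun k => g @^-1` (F k `*` G k)).
  rewrite -preimage_bigcup -(preimage_setT g); congr (_ @^-1` _).
  apply/seteqP; split=> // -[x y] _.
  have [k _ Fkx] : (\bigcup_i F i) x by rewrite -TF.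
  have [l _ Gly] : (\bigcup_i G i) y by rewrite -TG.
  exists (maxn k l) => //; split => /=.
  - by move: x Fkx; exact/subsetPset/ndF/leq_maxl.
  - by move: y Gly; exact/subsetPset/ndG/leq_maxr.
move=> k; have [mFk Fkoo] := Foo k; have [mGk Gkoo] := Goo k; split.
  by rewrite -[X in measurable X]setTI; apply: mg => //; exact: measurableX.
rewrite /lebesgue_cons /pushforward -comp_preimage (_ : g \o _ = id).
  by rewrite product_measure1E// lte_mul_pinfty// ge0_fin_numE.
apply/funext => -[a v]; rewrite /g /= /behead_rV cons_rVE; congr pair.
by apply/rowP => i; rewrite mxE cons_rVE.
Qed.

HB.instance Definition _ := Measure_isSigmaFinite.Build _ _ _ lebesgue_cons
  lebesgue_cons_sigma_finite.
End lebesgue_cons.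

Fixpoint lebesgue_rV n : {sigma_finite_measure set 'rV[R]_n -> \bar R} :=
  if n is k.+1 then lebesgue_cons (lebesgue_rV k) else \d_(0 : 'rV[R]_0).

Lemma measurable_rV_box n (A : 'I_n -> set R) :
  (forall i, measurable (A i)) ->
  measurable [set x : 'rV[R]_n | forall i, A i (x ord0 i)].
Proof.
move=> mA; rewrite (_ : [set x | _] =
    \bigcap_(i in [set: 'I_n]) ((fun x : 'rV[R]_n => x ord0 i) @^-1` A i)).
  apply: fin_bigcap_measurable => // i _.
  by have /(_ measurableT _ (mA i)) := @measurable_coord_rV n i; rewrite setTI.
by apply/seteqP; split=> x /= Ax i; [move=> _|]; exact: Ax.
Qed.

Lemma lebesgue_rV_box n (A : 'I_n -> set R) :
  (forall i, measurable (A i)) ->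
  lebesgue_rV n [set x | forall i, A i (x ord0 i)] =
  (\prod_(i < n) lebesgue_measure (A i))%E.
Proof.
elim: n A => [|n IH] A mA.
  by rewrite big_ord0 /= diracE mem_set// => -[].
have mA' i : measurable (A (lift ord0 i)) by exact: mA.
rewrite big_ord_recl -(IH _ mA') /= /lebesgue_cons /pushforward.
apply: etrans (product_measure1E (@lebesgue_measure R) (lebesgue_rV n)
  (mA ord0) (measurable_rV_box mA')).
congr (_ _); apply/seteqP; split=> -[a v] /=.
- by move=> Ax; split=> [|i]; [have := Ax ord0|have := Ax (lift ord0 i)];
    rewrite cons_rVE.
- by move=> [A0 A1] i; case: (unliftP ord0 i) => [k|] ->; rewrite cons_rVE.
Qed.

End lebesgue_rV.

Section L1_metric.
Context d (T : measurableType d) (R : realType) (mu : {measure set T -> \bar R}).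

(* Classes modulo mu-almost everywhere equality; as a function, a class is one
   of its representatives. *)
Definition L1 : Type := LspaceType1 mu.

Definition L1_fun (f : L1) : T -> R :=
  (f : LspaceType1 mu) : {mfun_ mu, T >-> measurableTypeR R}.
Coercion L1_fun : L1 >-> Funclass.

Lemma L1_Lfun (f : L1) : (f : T -> R) \in Lfun mu 1%E.
Proof.
apply/andP; split; rewrite inE /=; last exact: (@Lebesgue_finite _ _ _ _ _ _ f).
exact: (measurable_funPT (repr (f : {mfun_ mu, T >-> measurableTypeR R}))).
Qed.

HB.instance Definition _ := gen_eqMixin L1.
HB.instance Definition _ := gen_choiceMixin L1.

Definition L1_dist (f g : L1) : R :=
  fine ('N[mu]_1 [EFin \o (fun x => f x - g x)%R])%E.

Let L1_distxx f : L1_dist f f = 0.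
Proof.
rewrite /L1_dist (_ : EFin \o _ = cst 0%E) ?Lnorm0//.
by apply/funext => x /=; rewrite subrr.
Qed.

Let L1B_Lfun (f g : L1) : (fun x => f x - g x) \in Lfun mu 1%E.
Proof. exact: (rpredB (L1_Lfun f) (L1_Lfun g)). Qed.

Let L1B (f g : L1) : LfunType mu (@lexx _ _ 1%E) :=
  Lfun_Sub (@lexx _ _ 1%E) (L1B_Lfun f g).

Let L1_dist_eq0 f g : L1_dist f g = 0 -> f = g.
Proof.
move=> /(@fine_Lnormr_eq0 _ _ _ mu _ _ (L1B f g)) fg0.
have fg : (f : {mfun_ mu, T >-> measurableTypeR R}) = g.
  apply/eqP; rewrite -[eqbLHS]reprK -[eqbRHS]reprK; apply/ae_eqP.
  apply: filterS fg0 => x /= h _.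
  by apply/eqP; rewrite -subr_eq0; apply/eqP; exact: h.
case: f g fg {fg0} => [f [[pf]]] [g [[pg]]] /= fg.
by subst g; rewrite (Prop_irrelevance pf pg).
Qed.

Let L1_dist_sym f g : L1_dist f g = L1_dist g f.
Proof.
rewrite /L1_dist -(LnormrN (L1B g f)) /=; congr (fine (Lnorm _ _ _)).
by apply/funext => x /=; rewrite opprB.
Qed.

Let L1_dist_triangle g f h : L1_dist f h <= L1_dist f g + L1_dist g h.
Proof.
have := ler_LnormD (L1B f g) (L1B g h); apply: le_trans.
rewrite le_eqVlt; apply/orP; left; apply/eqP; congr (fine (Lnorm _ _ _)).
by apply/funext => x /=; rewrite addrA subrK.
Qed.

HB.instance Definition _ := @isMetric.Build R L1
  L1_dist L1_distxx L1_dist_eq0 L1_dist_sym L1_dist_triangle.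

End L1_metric.

(* For V finite-dimensional and U open, asking this of all fixed directions v is
   the same as asking it of the partial derivatives. *)
Fixpoint Ck (R : realType) (V : normedModType R) (k : nat) (U : set V)
    (f : V -> R) : Prop :=
  (forall x, U x -> {for x, continuous f}) /\
  if k is j.+1 then
    (forall x v, U x -> derivable f x v) /\ (forall v, Ck j U ('D_v f))
  else True.

Definition smooth (R : realType) (V : normedModType R) (U : set V) (f : V -> R) :=
  forall k, Ck k U f.

(* Near each boundary point, up to relabelling and reorienting the coordinate
   axes, Omega is the region above the graph of a smooth function gamma of the
   other coordinates. Balls of 'rV[R]_d are taken in the sup norm. *)
Definition smooth_boundary (R : realType) (d : nat) (Omega : set 'rV[R]_d) :=
  forall x0, (closure Omega `\` Omega°) x0 ->
  exists (r : R) (i : 'I_d) (b : bool) (gamma : 'rV[R]_d.-1 -> R),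
    [/\ 0 < r, smooth setT gamma &
        forall x, ball x0 r x ->
          (Omega x <-> 0 < (-1) ^+ b * (x ord0 i - gamma (col' i x)))].

Definition bounded_smooth_domain (R : realType) (d : nat) (Omega : set 'rV[R]_d) :=
  [/\ open Omega, connected Omega, Omega !=set0,
      bounded_set Omega & smooth_boundary Omega].

Definition lebesgue_on (R : realType) (d : nat) (Omega : set 'rV[R]_d)
    (oOmega : open Omega) : {measure set 'rV[R]_d -> \bar R} :=
  mrestr (lebesgue_rV R d) (open_measurable_mx oOmega).

Definition test_function (R : realType) (d : nat) (Omega : set 'rV[R]_d)
    (psi : 'rV[R]_d -> R) :=
  let supp := closure [set x | psi x != 0] in
  [/\ smooth setT psi, compact supp & supp `<=` Omega].

Definition locally_integrable_on (R : realType) (d : nat) (Omega : set 'rV[R]_d)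
    (g : 'rV[R]_d -> R) :=
  forall K, compact K -> K `<=` Omega ->
    (lebesgue_rV R d).-integrable K (EFin \o g).

Definition is_weak_gradient (R : realType) (d : nat) (Omega : set 'rV[R]_d)
    (u : 'rV[R]_d -> R) (G : 'rV[R]_d -> 'rV[R]_d) :=
  forall i : 'I_d,
    locally_integrable_on Omega (fun x => G x ord0 i) /\
    forall psi, test_function Omega psi ->
      (\int[lebesgue_rV R d]_(x in Omega) (u x * 'D_(delta_mx ord0 i) psi x) =
       - \int[lebesgue_rV R d]_(x in Omega) (G x ord0 i * psi x))%R.

(* A representative of the weak gradient when there is one, and 0 otherwise. *)
Definition weak_gradient (R : realType) (d : nat) (Omega : set 'rV[R]_d)
    (u : 'rV[R]_d -> R) : 'rV[R]_d -> 'rV[R]_d :=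
  xget (fun=> 0) [set G | is_weak_gradient Omega u G].

Definition euclidean_norm (R : realType) (d : nat) (v : 'rV[R]_d) : R :=
  Num.sqrt (\sum_(i < d) v ord0 i ^+ 2).

Definition first_order_space (R : realType) (d : nat) (Omega : set 'rV[R]_d)
    (S : set ('rV[R]_d -> R)) : set ('rV[R]_d -> R) :=
  [set u | S u /\ exists2 G, is_weak_gradient Omega u G &
                    forall i, S (fun x => G x ord0 i)].

Definition primitive_in_s (R : realType) (d : nat) (phi : 'rV[R]_d -> R -> R)
    (x : 'rV[R]_d) (s : R) : R :=
  (\int[lebesgue_measure]_(t in `[0, s]) phi x t)%R.

Section Orlicz.
Context (R : realType) (d : nat) (Omega : set 'rV[R]_d) (oOmega : open Omega).
Context (Phi : 'rV[R]_d -> R -> R).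

Definition modular (u : 'rV[R]_d -> R) : \bar R :=
  (\int[lebesgue_rV R d]_(x in Omega) (Phi x `|u x|)%:E)%E.

Definition LPhi : set ('rV[R]_d -> R) :=
  [set u | u \in Lfun (lebesgue_on oOmega) 1%E /\
           modular (fun x => lambda * u x) @[lambda --> 0^'] --> 0%E].

Definition W1Phi : set ('rV[R]_d -> R) := first_order_space Omega LPhi.

End Orlicz.

Definition W1oo (R : realType) (d : nat) (Omega : set 'rV[R]_d)
    (oOmega : open Omega) : set ('rV[R]_d -> R) :=
  first_order_space Omega [set u | u \in Lfun (lebesgue_on oOmega) +oo%E].

Section energies.
Context (R : realType) (d : nat) (Omega : set 'rV[R]_d) (oOmega : open Omega).

Definition energy (phi : 'rV[R]_d -> R -> R) (u : L1 (lebesgue_on oOmega)) :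
    \bar R :=
  if `[< W1Phi oOmega (primitive_in_s phi) u >] then
    (\int[lebesgue_rV R d]_(x in Omega)
      (primitive_in_s phi x (euclidean_norm (weak_gradient Omega u x))
       / phi x 1)%:E)%E
  else +oo%E.

Definition energy_oo (u : L1 (lebesgue_on oOmega)) : \bar R :=
  if `[< W1oo oOmega u /\
         ('N[lebesgue_on oOmega]_+oo
           [EFin \o (fun x => euclidean_norm (weak_gradient Omega u x))] <= 1)%E >]
  then 0%E else +oo%E.

End energies.
Arguments energy {R d Omega} oOmega phi u.
Arguments energy_oo {R d Omega} oOmega u.

Definition Gamma_converges (R : realType) (X : metricType R)
    (J : nat -> X -> \bar R) (Jlim : X -> \bar R) :=
  forall u : X,
    (forall v : nat -> X, v n @[n --> \oo] --> u ->
       (Jlim u <= limn_einf (fun n => J n (v n)))%E) /\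
    (exists v : nat -> X, v n @[n --> \oo] --> u /\
       (limn_esup (fun n => J n (v n)) <= Jlim u)%E).

(* Main.v *)
Require Import Defs.
From HB Require Import structures.
From mathcomp Require Import all_boot all_order all_algebra.
From mathcomp Require Import all_classical all_reals all_analysis.
From mathcomp Require Import measurable_realfun ess_sup_inf ring lra.
From mathcomp Require finmap.

(** Write [p] for the lower exponent of [phi n]. The growth condition says that
    [phi n x s / s^(p - 1)] is nondecreasing in [s]. So the energy density, the
    primitive of [phi n x] divided by [phi n x 1], is at most [1 / p] on
    gradients of norm at most 1, and is exponentially large in [p] on gradients
    of norm at least [1 + delta].

    For the upper bound the constant sequence will do: if the gradient of [u]
    has norm at most 1, its energy is at most the volume divided by [p]
    ([energy_le]).

    For the lower bound, let [v n] tend to [u] in mean, with energies bounded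
    along a subsequence. Then [excess_le_Phi] makes the squared norm of the
    gradient of [v n] exceed 1 by little in mean, so that this gradient is an
    [almost_gradient] of [u] for any prescribed precision. The almost gradients
    of a given precision form a convex set, and by the parallelogram identity
    those of nearly least square integral form a Cauchy sequence as the
    precision improves ([almost_gradients_converge]). The limit is a weak
    gradient of [u] of norm at most 1 ([almost_gradient_limit]).

    It remains to see that [u] is essentially bounded, and that the gradient
    selected by [weak_gradient] coincides with this limit almost everywhere.
    For both it is enough to test with products of one-dimensional bumps: they
    approximate the indicators of boxes, and a sign condition on the integrals
    over dyadic boxes holds almost everywhere by the monotone class theorem
    ([box_integral_ge0_ae], [tensor_ge0_ae]). Uniqueness follows at once
    ([weak_gradient_unique]). For the bound, shifting the mass of one factor of
    a product of bumps changes the integral against [u] by at most the bound on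
    the gradient times the distance and the mass ([replace_factor]). Within a
    box all mass can so be shifted to a fixed place ([box_tensor_bound]); near
    the boundary, which is a smooth graph, it can first be shifted along one
    axis into a box inside the domain ([escape_to_box]). Compactness of the
    closure concludes ([bounded_weak_gradient_bounded]). *)

Set Implicit Arguments.
Unset Strict Implicit.
Unset Printing Implicit Defensive.

Import Order.TTheory GRing.Theory Num.Theory.
Import numFieldNormedType.Exports.

Local Open Scope classical_set_scope.
Local Open Scope ring_scope.

(** * Smooth functions and bumps on the line *)

Section Ck_calculus.
Context {R : realType} {V : normedModType R}.
Implicit Types (f g : V -> R) (k : nat).

Lemma CkSP k f : Ck k.+1 setT f <->
  [/\ continuous f, forall x v, derivable f x v &
      forall v, Ck k setT ('D_v f)].
Proof.
split=> /= [[cf [df Df]]|[cf df Df]].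
  by split=> // [x|x v]; [exact: cf|exact: df].
by split=> [x _|]; [exact: cf|split=> // x v _; exact: df].
Qed.

Lemma Ck_continuous k f : Ck k setT f -> continuous f.
Proof. by case: k => [|k] [cf _] x; exact: cf. Qed.

Lemma CkW k f : Ck k.+1 setT f -> Ck k setT f.
Proof.
elim: k f => [|k IH] f; first by move=> /CkSP[cf _ _]; split=> // x _; exact: cf.
move=> /CkSP[cf df Df]; apply/CkSP; split=> // v.
exact: IH.
Qed.

Lemma Ck_cst k (c : R) : Ck k setT (cst c : V -> R).
Proof.
elim: k c => [|k IH] c; first by split=> // x _; exact: cst_continuous.
apply/CkSP; split=> [x|x v|v]; [exact: cst_continuous|exact: derivable_cst|].
by rewrite (_ : 'D_v _ = cst 0)//; apply/funext => x; rewrite derive_cst.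
Qed.

Lemma CkD k f g : Ck k setT f -> Ck k setT g -> Ck k setT (f \+ g).
Proof.
elim: k f g => [|k IH] f g.
  by move=> [cf _] [cg _]; split=> // x _; apply: continuousD; [exact: cf|exact: cg].
move=> /CkSP[cf df Df] /CkSP[cg dg Dg]; apply/CkSP; split=> [x|x v|v].
- by apply: continuousD; [exact: cf|exact: cg].
- exact: derivableD.
- rewrite (_ : 'D_v _ = 'D_v f \+ 'D_v g); first exact: IH.
  by apply/funext => x; rewrite deriveD.
Qed.

Lemma CkM k f g : Ck k setT f -> Ck k setT g -> Ck k setT (f \* g).
Proof.
elim: k f g => [|k IH] f g.
  by move=> [cf _] [cg _]; split=> // x _; apply: continuousM; [exact: cf|exact: cg].
move=> Cf Cg; have := Cf => /CkSP[cf df Df]; have := Cg => /CkSP[cg dg Dg].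
apply/CkSP; split=> [x|x v|v].
- by apply: continuousM; [exact: cf|exact: cg].
- exact: derivableM.
- rewrite (_ : 'D_v _ = (f \* 'D_v g) \+ (g \* 'D_v f)).
    by apply: CkD; apply: IH => //; exact: CkW.
  by apply/funext => x; rewrite deriveM.
Qed.

Lemma Ck_prod k (I : eqType) (s : seq I) (F : I -> V -> R) :
  (forall i, Ck k setT (F i)) -> Ck k setT (fun x => \prod_(i <- s) F i x).
Proof.
move=> CF; elim: s => [|i s IH].
  rewrite (_ : (fun _ => _) = cst 1); first exact: Ck_cst.
  by apply/funext => x; rewrite big_nil.
rewrite (_ : (fun _ => _) = F i \* (fun x => \prod_(i <- s) F i x)).
  exact: CkM.
by apply/funext => x; rewrite big_cons.
Qed.

End Ck_calculus.

Section Ck_affine.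
Context {R : realType} {V : normedModType R}.

(** Precomposition with an affine form [l] of linear part [c]: the difference
    quotients of [b \o l] along [v] literally are those of [b] along [c v]. *)
Lemma affine_quotient (b : R -> R) (l c : V -> R) x v :
  (forall x v t, l (t *: v + x) = t * c v + l x) ->
  (fun h => h^-1 *: ((b \o l \o shift x) (h *: v) - (b \o l) x)) =
  (fun h => h^-1 *: ((b \o shift (l x)) (h *: c v) - b (l x))).
Proof. by move=> lE; apply/funext => h /=; rewrite lE. Qed.

Lemma derive_affine (b : R -> R) (l c : V -> R) x v :
  (forall x v t, l (t *: v + x) = t * c v + l x) ->
  'D_v (b \o l) x = 'D_(c v) b (l x).
Proof. by move=> lE; rewrite /derive (affine_quotient b x v lE). Qed.

Lemma Ck_affine k (b : R -> R) (l c : V -> R) :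
  (forall x v t, l (t *: v + x) = t * c v + l x) -> continuous l ->
  Ck k setT b -> Ck k setT (b \o l).
Proof.
move=> lE cl; elim: k b => [|k IH] b.
  by move=> [cb _]; split=> // x _; apply: continuous_comp; [exact: cl|exact: cb].
move=> /CkSP[cb db Db]; apply/CkSP; split=> [x|x v|v].
- by apply: continuous_comp; [exact: cl|exact: cb].
- by rewrite /derivable (affine_quotient b x v lE); exact: db.
- rewrite (_ : 'D_v _ = 'D_(c v) b \o l); first exact: IH.
  by apply/funext => x /=; rewrite (derive_affine _ _ _ lE).
Qed.

End Ck_affine.

Section smooth_real.
Context {R : realType}.
Implicit Types (f F : R -> R).

Lemma is_derive_scaled F (x v d : R) : is_derive x (1 : R) F d -> is_derive x v F (v * d).
Proof.
move=> [/derivable1_diffP dF <-]; apply: DeriveDef; first exact: diff_derivable.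
rewrite !deriveE// -[in LHS](mulr1 v) -[v * 1]/(v *: (1:R)).
by rewrite linearZ.
Qed.

(** A coinduction principle, which spares formulas for higher derivatives. *)
Lemma smooth_class (S : set (R -> R)) :
  (forall f, S f -> exists2 g, S g & forall x, is_derive x (1 : R) f (g x)) ->
  forall f, S f -> smooth setT f.
Proof.
move=> SD f Sf k.
elim: k f Sf => [|k IH] f Sf; have [g Sg fg] := SD _ Sf.
  split=> // x _; apply: differentiable_continuous; apply/derivable1_diffP.
  by have [] := fg x.
apply/CkSP; split=> [x|x v|v].
- apply: differentiable_continuous; apply/derivable1_diffP.
  by have [] := fg x.
- by have [] := is_derive_scaled v (fg x).
- rewrite (_ : 'D_v f = cst v \* g); first by apply: CkM (IH _ Sg); exact: Ck_cst.
  by apply/funext => x; have [_ ->] := is_derive_scaled v (fg x).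
Qed.

Lemma smooth_primitive f F : (forall x, is_derive x (1 : R) F (f x)) ->
  smooth setT f -> smooth setT F.
Proof.
move=> Ff sf [|k].
  split=> // x _; apply: differentiable_continuous; apply/derivable1_diffP.
  by have [] := Ff x.
apply/CkSP; split=> [x|x v|v].
- by apply: differentiable_continuous; apply/derivable1_diffP; have [] := Ff x.
- by have [] := is_derive_scaled v (Ff x).
- rewrite (_ : 'D_v F = cst v \* f); first by apply: CkM (sf _); exact: Ck_cst.
  by apply/funext => x; have [_ ->] := is_derive_scaled v (Ff x).
Qed.

Lemma smooth_continuous f : smooth setT f -> continuous f.
Proof. by move=> sf; exact: (Ck_continuous (sf 0%N)). Qed.

(** Each monomial is bounded by a term of the exponential series. *)
Lemma horner_expRN_bounded (p : {poly R}) :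
  exists C, forall y, 0 <= y -> `|p.[y]| * expR (- y) <= C.
Proof.
exists (\sum_(i < size p) `|p`_i| * i`!%:R) => y y0.
rewrite expRN ler_pdivrMr ?expR_gt0// horner_coef.
apply: (le_trans (ler_norm_sum _ _ _)); rewrite mulr_suml ler_sum// => i _.
rewrite normrM -mulrA ler_wpM2l// ger0_norm ?exprn_ge0//.
have fi0 : (0 : R) < i`!%:R by rewrite ltr0n fact_gt0.
rewrite -ler_pdivrMl// mulrC.
case: {+}i => -[|n] /= _; first by rewrite expr0 fact0 invr1 mulr1 -expR0 ler_expR.
by apply: le_trans (expR_ge1Dxn n y0); rewrite lerDr.
Qed.

(** The derivatives of [exp (-1/x)] on the right half line, extended by zero,
    all have this form; [p] is a polynomial in [1/x]. *)
Definition flat (p : {poly R}) (x : R) : R :=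
  if 0 < x then p.[x^-1] * expR (- x^-1) else 0.

(** Vanishing to second order yields the derivative 0 at 0. *)
Lemma flat_le_sqr p : exists2 C, 0 <= C & forall x, `|flat p x| <= C * x ^+ 2.
Proof.
have [C HC] := horner_expRN_bounded ('X^2 * p).
have C0 : 0 <= C.
  by apply: le_trans (HC 0 _) => //; rewrite mulr_ge0// expR_ge0.
exists C => // x; rewrite /flat; case: ifPn => x0; last first.
  by rewrite normr0 mulr_ge0// sqr_ge0.
have := HC x^-1; rewrite invr_ge0 => /(_ (ltW x0)).
rewrite hornerM hornerXn exprVn normrM [X in _ -> X <= _]normrM.
rewrite (ger0_norm (expR_ge0 _)) (@ger0_norm _ (x ^- 2)) ?invr_ge0 ?sqr_ge0//.
by rewrite -mulrA ler_pdivrMl ?exprn_gt0// [C * _]mulrC.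
Qed.

Lemma is_derive_flat p x :
  is_derive x (1 : R) (flat p) (flat ('X^2 * (p - p^`())) x).
Proof.
have [x0|x0|x0] := ltgtP x 0.
- apply: (@near_eq_is_derive _ _ _ (cst 0)).
    near=> y; rewrite /flat ifF//; apply/negbTE; rewrite -leNgt ltW//.
    near: y; exact: lt_nbhsl.
  rewrite /flat ltNge (ltW x0)/=; exact: is_derive_cst.
- apply: (@near_eq_is_derive R R R (fun y : R => p.[y^-1] * expR (- y^-1))).
    near=> y; rewrite /flat ifT//.
    near: y; exact: lt_nbhsr.
  have xn0 : x != 0 by rewrite gt_eqF.
  have dV : is_derive x (1 : R) (fun y => y^-1) (- x ^- 2).
    have := @is_deriveV R id x 1 1 xn0 (is_derive_id _ _).
    by rewrite /GRing.scale /= mulr1.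
  have d1 : is_derive x (1 : R) (fun y => p.[y^-1]) (- x ^- 2 * p^`().[x^-1]).
    by rewrite mulrC; exact: (is_derive1_comp (is_derive_poly p x^-1) dV).
  have d2 : is_derive x (1 : R) (fun y => expR (- y^-1)) (x ^- 2 * expR (- x^-1)).
    have dNV : is_derive x (1 : R) (fun y => - y^-1) (x ^- 2).
      by have := @is_deriveN R R R (fun y => y^-1) x 1 _ dV; rewrite opprK.
    by rewrite mulrC; exact: (is_derive1_comp (is_derive_expR _) dNV).
  have := @is_deriveM R R _ _ x 1 _ _ d1 d2.
  rewrite /flat x0 => /is_derive_eq; apply.
  rewrite !hornerE /= !exprVn /GRing.scale /=; ring.
- subst x; have -> : flat ('X^2 * (p - p^`())) 0 = 0 by rewrite /flat ltxx.
  have [C C0 HC] := flat_le_sqr p.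
  have f0 : flat p 0 = 0 by rewrite /flat ltxx.
  have lim0 : (fun h : R => h^-1 *: ((flat p \o shift 0) (h *: (1 : R)) - flat p 0))
      @ 0^' --> (0 : R).
    apply/cvgr0Pnorm_lt => e e0; near=> h.
    have h0 : h != 0 by near: h; exact: nbhs_dnbhs_neq.
    rewrite /= f0 subr0 addr0 /GRing.scale /= mulr1 normrM normfV.
    rewrite ltr_pdivrMl ?normr_gt0//.
    apply: le_lt_trans (HC h) _; rewrite -real_normK ?num_real// expr2 mulrCA.
    rewrite ltr_pM2l ?normr_gt0//.
    apply: (@le_lt_trans _ _ ((C + 1) * `|h|)); first by rewrite ler_wpM2r// lerDl.
    rewrite -ltr_pdivlMl ?ltr_wpDl//.
    near: h; apply: dnbhs0_lt; rewrite mulr_gt0// invr_gt0 ltr_wpDl//.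
  by apply: DeriveDef; [apply/cvg_ex; exists 0|exact: cvg_lim lim0].
Unshelve. all: end_near. Qed.

Lemma smooth_flat p : smooth setT (flat p).
Proof.
apply: (smooth_class (S := range flat)); last by exists p.
by move=> _ [q _ <-]; exists (flat ('X^2 * (q - q^`()))) => //; exact: is_derive_flat.
Qed.

End smooth_real.

Section compactly_supported.
Context {R : realType}.
Implicit Types (b f : R -> R) (lo hi : R).
Local Notation leb := (@lebesgue_measure R).

Definition smooth_within lo hi f :=
  smooth setT f /\ forall x, ~~ (lo <= x <= hi) -> f x = 0.

Definition bump lo hi b := smooth_within lo hi b /\ forall x, 0 <= b x.

Definition mass f : R := \int[leb]_x f x.

Definition primitive f (x : R) : R := \int[leb]_(t in `]-oo, x]) f t.

Lemma smooth_within_patch lo hi f : smooth_within lo hi f -> f = f \_ `[lo, hi].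
Proof.
move=> [_ f0]; apply/funext => x; rewrite patchE; case: ifPn => //.
by rewrite notin_setE /= in_itv /= => /negP /f0.
Qed.

Lemma smooth_within_integrable lo hi f : smooth_within lo hi f ->
  leb.-integrable setT (EFin \o f).
Proof.
move=> fs; rewrite (smooth_within_patch fs).
rewrite (_ : EFin \o _ = (EFin \o f) \_ `[lo, hi]); last first.
  by apply/funext => x; rewrite /= !patchE; case: ifP.
apply: (integrable_mkcond _ _).1 => //; apply: continuous_compact_integrable.
  exact: segment_compact.
by apply: continuous_subspaceT; apply: smooth_continuous; case: fs.
Qed.

Lemma primitive_derive lo hi f : smooth_within lo hi f ->
  forall x, is_derive x (1 : R) (primitive f) (f x).
Proof.
move=> fs x; have xx1 : x < x + 1 by rewrite ltrDl.
have fi : leb.-integrable `]-oo, x + 1] (EFin \o f).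
  exact: integrableS (smooth_within_integrable fs).
have [] := @continuous_FTC1 R f -oo%O x _ xx1 fi (ltNyr _).
  by apply: smooth_continuous; case: fs.
by move=> dF <-; apply: DeriveDef; [exact: dF|rewrite derive1E].
Qed.

Lemma primitive_left lo hi f x : smooth_within lo hi f -> x < lo ->
  primitive f x = 0.
Proof.
move=> [_ f0] xlo; rewrite /primitive (@eq_Rintegral _ _ _ _ _ (cst 0)).
  by rewrite /Rintegral integral0_eq.
by move=> t; rewrite inE /= in_itv /= => tx; rewrite f0// leNgt (le_lt_trans tx).
Qed.

Lemma primitive_right lo hi f x : smooth_within lo hi f -> hi <= x ->
  primitive f x = mass f.
Proof.
move=> [_ f0] hix; rewrite /primitive /mass Rintegral_mkcond.
congr (Rintegral _ _ _); apply/funext => t; rewrite patchE; case: ifPn => //.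
rewrite notin_setE /= in_itv /= => /negP; rewrite -ltNge => xt.
by rewrite f0// [_ <= hi]leNgt (le_lt_trans hix xt) andbF.
Qed.

Lemma primitive_norm_le lo hi f x : smooth_within lo hi f ->
  `|primitive f x| <= \int[leb]_t `|f t|.
Proof.
move=> fs; have fi := smooth_within_integrable fs.
apply: (le_trans (le_normr_Rintegral _ _)) => //.
  exact: integrableS fi.
rewrite Rintegral_mkcond; apply: le_Rintegral => //.
- rewrite (_ : EFin \o _ = (EFin \o (fun t => `|f t|)) \_ `]-oo, x]); last first.
    by apply/funext => t; rewrite /= !patchE; case: ifP.
  apply: (integrable_mkcond _ _).1 => //; apply: (integrableS measurableT) => //.
  exact: integrable_norm.
- exact: integrable_norm.
- by move=> t _; rewrite patchE; case: ifP => //= _; exact: normr_ge0.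
Qed.

Lemma smooth_primitive_within lo hi f : smooth_within lo hi f ->
  smooth setT (primitive f).
Proof. by move=> fs; apply: smooth_primitive (primitive_derive fs) _; case: fs. Qed.

Lemma mass_ge0 lo hi b : bump lo hi b -> 0 <= mass b.
Proof. by move=> [_ b0]; apply: Rintegral_ge0. Qed.

Lemma smooth_affine f (m q : R) : smooth setT f -> smooth setT (fun x => f (m * x + q)).
Proof.
move=> sf k; apply: (@Ck_affine R R k f (fun x => m * x + q) (fun x => m * x)) => //.
- by move=> x v t; rewrite /GRing.scale /=; ring.
- move=> x; apply: cvgD; last exact: cvg_cst.
  by apply: cvgM; [exact: cvg_cst|exact: cvg_id].
Qed.

Lemma exists_bump lo hi : lo < hi -> exists2 b, bump lo hi b & mass b = 1.
Proof.
move=> lohi.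
(* exp (-1/(x - lo)) exp (-1/(hi - x)) between lo and hi *)
pose e x : R := flat 1 (1 * x + - lo) * flat 1 (-1 * x + hi).
have e0 x : 0 <= e x.
  rewrite /e /flat; do 2 case: ifP => _; rewrite ?mul0r ?mulr0// !hornerC !mul1r.
  by rewrite mulr_ge0// expR_ge0.
have eb : bump lo hi e.
  split=> //; split=> [k|x].
    by apply: CkM; apply: smooth_affine; exact: smooth_flat.
  rewrite negb_and -!ltNge /e /flat => /orP[xlo|hix].
    by rewrite ifF ?mul0r//; apply/negbTE; rewrite -leNgt; lra.
  by rewrite [X in _ * X]ifF ?mulr0//; apply/negbTE; rewrite -leNgt; lra.
have m0 : 0 < mass e.
  pose mid := (lo + hi) / 2.
  have midhi : mid < hi by rewrite /mid; lra.
  have [|c] := @MVT R (primitive e) e mid hi midhi (fun x _ => primitive_derive eb.1 x).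
    by apply: continuous_subspaceT; apply: smooth_continuous; exact: smooth_primitive_within eb.1.
  rewrite (primitive_right eb.1 (lexx _)) in_itv /= => /andP[mc chi] mE.
  have Fmid : 0 <= primitive e mid by exact: Rintegral_ge0.
  rewrite -(subrK (primitive e mid) (mass e)) mE ltr_wpDr// mulr_gt0 ?subr_gt0//.
  have loc : lo < c by move: mc; rewrite /mid; lra.
  by rewrite /e /flat !ifT ?hornerC ?mul1r ?mulr_gt0 ?expR_gt0//; lra.
exists (fun x => (mass e)^-1 * e x).
  split; last by move=> x; rewrite mulr_ge0// invr_ge0 ltW.
  split=> [k|x xlohi]; last by rewrite eb.1.2// mulr0.
  by apply: CkM; [exact: Ck_cst|exact: eb.1.1].
rewrite /mass RintegralZl ?mulVf ?gt_eqF//.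
exact: smooth_within_integrable eb.1.
Qed.

(** A smooth step of width [1 / (k + 1)] ending at [lo], minus the same step
    ending at [hi]: the limit is the indicator of the interval closed at [lo]
    and open at [hi], endpoints included. *)
Lemma bump_approx lo hi : lo < hi -> exists B : nat -> R -> R,
  [/\ forall k, bump (lo - k.+1%:R^-1) hi (B k),
      forall k x, B k x <= 1 &
      forall x, B k x @[k --> \oo] --> (\1_(`[lo, hi[) x : R)].
Proof.
move=> lohi.
have [e eb me] := @exists_bump 0 1 ltr01.
pose th := primitive e.
have th0 x : x < 0 -> th x = 0 by exact: primitive_left eb.1.
have th1 x : 1 <= x -> th x = 1 by move=> ?; rewrite /th (primitive_right eb.1).
have thd x := primitive_derive eb.1 x.
have thnd x y : x <= y -> th x <= th y.
  rewrite le_eqVlt => /predU1P[->//|xy].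
  have [|c _] := @MVT R th e x y xy (fun x _ => thd x).
    by apply: continuous_subspaceT; apply: smooth_continuous; exact: smooth_primitive_within eb.1.
  by move=> thE; rewrite -subr_ge0 thE mulr_ge0 ?subr_ge0 ?(ltW xy)//; exact: eb.2.
have thge0 x : 0 <= th x by apply: Rintegral_ge0 => t _; exact: eb.2.
have thle1 x : th x <= 1.
  have [x1|/ltW x1] := leP 1 x; first by rewrite th1.
  by rewrite -(th1 1)// thnd.
have sth : smooth setT th by exact: smooth_primitive_within eb.1.
pose B k x := th (k.+1%:R * x + (1 - k.+1%:R * lo)) - th (k.+1%:R * x + (1 - k.+1%:R * hi)).
exists B; split=> [k|k x|x].
- have k0 : 0 < k.+1%:R :> R by [].
  split; last first.
    by move=> x; rewrite subr_ge0 thnd// lerD2l lerD2l lerN2 ler_pM2l// ltW.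
  split=> [j|x].
    rewrite (_ : B k = (fun x => th (k.+1%:R * x + (1 - k.+1%:R * lo))) \+
      (cst (-1) \* (fun x => th (k.+1%:R * x + (1 - k.+1%:R * hi))))); last first.
      by apply/funext => x; rewrite /B /= mulN1r.
    by apply: CkD; [|apply: CkM; first exact: Ck_cst]; apply: smooth_affine.
  rewrite negb_and -!ltNge ltrBrDr => /orP[xlo|hix].
    rewrite /B !th0 ?subrr//.
      have : k.+1%:R * (x + k.+1%:R^-1) < k.+1%:R * hi by rewrite ltr_pM2l// (lt_trans xlo).
      by rewrite mulrDr mulfV ?gt_eqF//; lra.
    have : k.+1%:R * (x + k.+1%:R^-1) < k.+1%:R * lo by rewrite ltr_pM2l.
    by rewrite mulrDr mulfV ?gt_eqF//; lra.
  have h1 : k.+1%:R * hi < k.+1%:R * x by rewrite ltr_pM2l.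
  have h2 : k.+1%:R * lo < k.+1%:R * hi by rewrite ltr_pM2l.
  by rewrite /B !th1 ?subrr//; lra.
- by rewrite lerBlDr (le_trans (thle1 _))// lerDl.
- have step (c : R) : th (k.+1%:R * x + (1 - k.+1%:R * c)) @[k --> \oo] --> ((c <= x)%R%:R : R).
    have [cx|xc] := leP c x.
      rewrite (_ : (fun k => _) = cst 1); first exact: cvg_cst.
      apply/funext => k; rewrite th1//.
      have : k.+1%:R * c <= k.+1%:R * x by rewrite ler_pM2l.
      lra.
    apply: cvg_near_cst; near=> k; rewrite th0//.
    have xc0 : 0 < c - x by rewrite subr_gt0.
    have : (c - x)^-1 < k.+1%:R.
      by apply: (@lt_trans _ _ k%:R); [near: k; exact: nbhs_infty_gtr|rewrite ltr_nat].
    rewrite -(@ltr_pM2l _ (c - x))// mulfV ?gt_eqF//; lra.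
  have -> : \1_(`[lo, hi[) x = (lo <= x)%R%:R - (hi <= x)%R%:R :> R.
    rewrite indicE mem_setE in_itv /= ltNge.
    have [lox|xlo] := leP lo x; have [hix|xhi] := leP hi x => //=; rewrite ?subrr ?subr0//.
    lra.
  by apply: cvgB; exact: step.
Unshelve. all: end_near. Qed.

End compactly_supported.

(** * Integrals of product functions *)

Section product_integrals.
Context {R : realType}.
Local Notation leb := (@lebesgue_measure R).
Local Notation lebd := (lebesgue_rV R).

Definition tensor n (f : 'I_n -> R -> R) (x : 'rV[R]_n) : R :=
  \prod_(i < n) f i (x ord0 i).

Lemma measurable_tensor n (f : 'I_n -> R -> R) :
  (forall i, measurable_fun setT (f i)) -> measurable_fun setT (tensor f).
Proof.
move=> mf; rewrite /tensor.
elim: (index_enum _) => [|i s IH].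
  by rewrite (_ : (fun _ => _) = cst 1)//; apply/funext => x; rewrite big_nil.
rewrite (_ : (fun _ => _) = (fun x : 'rV[R]_n => f i (x ord0 i)) \*
    (fun x : 'rV[R]_n => \prod_(i <- s) f i (x ord0 i))).
  apply: measurable_funM => //.
  exact: (measurableT_comp (mf i) (@measurable_coord_rV R n i)).
by apply/funext => x; rewrite big_cons.
Qed.

Lemma integral_tensor n (f : 'I_n -> R -> R) :
  (forall i, measurable_fun setT (f i)) -> (forall i x, 0 <= f i x) ->
  (\int[lebd n]_x (tensor f x)%:E = \prod_(i < n) \int[leb]_t (f i t)%:E)%E.
Proof.
move=> mf f0; elim: n f mf f0 => [|n IH] f mf f0.
  rewrite big_ord0 /= integral_dirac//; last first.
    by apply/measurable_EFinP; exact: measurable_tensor.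
  by rewrite diracT mul1e /tensor big_ord0.
have t0 k (g : 'I_k -> R -> R) x : (forall i x, 0 <= g i x) -> 0 <= tensor g x.
  by move=> g0; exact: prodr_ge0.
pose g i := f (lift ord0 i).
have mg i : measurable_fun setT (g i) by exact: mf.
have g0 i x : 0 <= g i x by exact: f0.
rewrite big_ord_recl -(IH g)// /=.
rewrite /lebesgue_cons ge0_integral_pushforward//; last 3 first.
- exact: measurable_cons_rV.
- by apply/measurable_EFinP; exact: measurable_tensor.
- by move=> x _; rewrite lee_fin; exact: t0.
rewrite preimage_setT.
have tE z : tensor f (cons_rV z) = f ord0 z.1 * tensor g z.2.
  rewrite /tensor big_ord_recl cons_rVE; congr (_ * _).
  by apply: eq_bigr => i _; rewrite cons_rVE.
rewrite (@fubini_tonelli1 _ _ _ _ _ leb (lebd n)); last 2 first.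
- apply/measurable_EFinP; apply: measurableT_comp; first exact: measurable_tensor.
  exact: measurable_cons_rV.
- by move=> z; rewrite lee_fin; exact: t0.
rewrite /fubini_F /=.
under eq_integral => x _.
  under eq_integral => y _ do rewrite tE EFinM /=.
  rewrite ge0_integralZl//; last 3 first.
  - by apply/measurable_EFinP; exact: measurable_tensor.
  - by move=> y _; rewrite lee_fin; exact: t0.
  - by rewrite lee_fin.
  over.
rewrite ge0_integralZr//.
- by apply/measurable_EFinP; exact: mf.
- by move=> y _; rewrite lee_fin.
- by apply: integral_ge0 => y _; rewrite lee_fin; exact: t0.
Qed.

Lemma tensor_norm n (f : 'I_n -> R -> R) x :
  `|tensor f x| = tensor (fun i t => `|f i t|) x.
Proof. exact: normr_prod. Qed.

Lemma Rintegral_EFin dp (T : measurableType dp) (m : {measure set T -> \bar R})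
    (D : set T) (f : T -> R) : measurable D -> m.-integrable D (EFin \o f) ->
  ((\int[m]_(x in D) f x)%R%:E = \int[m]_(x in D) (f x)%:E)%E.
Proof.
by move=> mD fi; rewrite /Rintegral fineK//; exact: integrable_fin_num.
Qed.

Lemma tensor_integrable n (f : 'I_n -> R -> R) :
  (forall i, leb.-integrable setT (EFin \o f i)) ->
  (lebd n).-integrable setT (EFin \o tensor f) /\
  \int[lebd n]_x `|tensor f x| = \prod_(i < n) \int[leb]_t `|f i t|.
Proof.
move=> fi.
have mf i : measurable_fun setT (f i).
  by apply/measurable_EFinP; exact: measurable_int (fi i).
have mnf i : measurable_fun setT (fun t => `|f i t|) by exact: measurableT_comp.
have E : (\int[lebd n]_x (`|tensor f x|)%:E = (\prod_(i < n) \int[leb]_t `|f i t|)%:E)%E.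
  under eq_integral => x _ do rewrite tensor_norm.
  rewrite integral_tensor// -prodEFin; apply: eq_bigr => i _.
  rewrite /Rintegral fineK//; apply: integrable_fin_num => //.
  exact: integrable_norm.
split; last by rewrite /Rintegral E.
apply/integrableP; split; first by apply/measurable_EFinP; exact: measurable_tensor.
by rewrite E ltry.
Qed.

End product_integrals.

(** * A sign condition on boxes *)

Section boxes.
Context {R : realType} {d : nat}.
Local Notation leb := (@lebesgue_measure R).
Local Notation lebd := (lebesgue_rV R d).
Implicit Types (lo hi a : 'I_d -> R) (h : 'rV[R]_d -> R).

Definition hobox lo hi : set 'rV[R]_d := [set x | forall j, lo j <= x ord0 j < hi j].

Lemma hoboxE lo hi :
  hobox lo hi = [set x | forall j, (`[lo j, hi j[%classic : set R) (x ord0 j)].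
Proof. by apply/seteqP; split=> x xQ j; have := xQ j; rewrite /= in_itv. Qed.

Lemma measurable_hobox lo hi : measurable (hobox lo hi).
Proof. by rewrite hoboxE; apply: (@measurable_rV_box R d (fun j => `[lo j, hi j[%classic)) => j. Qed.

(** The dyadic subdivision of [hobox a (a + r)] into [2 ^ (k * d)] cells. *)
Definition dyadic_lo a (r : R) (k : nat) (z : {ffun 'I_d -> 'I_(2 ^ k)}) j : R :=
  a j + r * (z j)%:R / 2 ^+ k.

Definition dyadic_hi a (r : R) (k : nat) (z : {ffun 'I_d -> 'I_(2 ^ k)}) j : R :=
  a j + r * (z j).+1%:R / 2 ^+ k.

Definition dyadic_cell a r k z := hobox (@dyadic_lo a r k z) (dyadic_hi a r z).

Lemma dyadic_cell_sub a r k (z : {ffun 'I_d -> 'I_(2 ^ k)}) j : 0 < r ->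
  a j <= dyadic_lo a r z j < dyadic_hi a r z j /\ dyadic_hi a r z j <= a j + r.
Proof.
move=> r0; rewrite /dyadic_lo /dyadic_hi.
have k0 : (0 : R) < 2 ^+ k by rewrite exprn_gt0.
rewrite lerDl ltrD2l lerD2l ltr_pM2r ?invr_gt0// ltr_pM2l// ltr_nat ltnSn andbT.
split; first by rewrite divr_ge0 ?mulr_ge0 ?(ltW r0) ?(ltW k0).
rewrite ler_pdivrMr// ler_pM2l// -natrX ler_nat; exact: ltn_ord.
Qed.

Lemma dyadic_cover a r k x : 0 < r -> hobox a (fun j => a j + r) x ->
  exists z : {ffun 'I_d -> 'I_(2 ^ k)}, dyadic_cell a r z x.
Proof.
move=> r0 xQ.
have k0 : (0 : R) < 2 ^+ k by rewrite exprn_gt0.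
pose t j := (x ord0 j - a j) / r * 2 ^+ k.
have t0 j : 0 <= t j.
  by have /andP[aj _] := xQ j; rewrite mulr_ge0 ?divr_ge0 ?subr_ge0 ?(ltW r0) ?(ltW k0).
have tk j : (Num.truncn (t j) < 2 ^ k)%N.
  rewrite -(ltr_nat R) natrX; apply: (@le_lt_trans _ _ (t j)).
    by rewrite truncn_le.
  have /andP[_ xj] := xQ j.
  by rewrite -[X in _ < X]mul1r ltr_pM2r// ltr_pdivrMr// mul1r ltrBlDl.
have tE j : x ord0 j = a j + r * t j / 2 ^+ k.
  by rewrite /t mulrA mulfK ?gt_eqF// mulrCA mulfV ?gt_eqF// mulr1 subrKC.
exists [ffun j => Ordinal (tk j)] => j; rewrite /dyadic_lo /dyadic_hi !ffunE /=.
rewrite (tE j) lerD2l ltrD2l ler_pM2r ?invr_gt0// ltr_pM2r ?invr_gt0//.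
by rewrite ler_pM2l// ltr_pM2l// truncn_le t0 truncnS_gt.
Qed.

Lemma dyadic_inj a r k (z z' : {ffun 'I_d -> 'I_(2 ^ k)}) x : 0 < r ->
  dyadic_cell a r z x -> dyadic_cell a r z' x -> z = z'.
Proof.
move=> r0 zx z'x; apply/ffunP => j; apply/val_inj => /=.
have k0 : (0 : R) < 2 ^+ k by rewrite exprn_gt0.
have le2 (y y' : {ffun 'I_d -> 'I_(2 ^ k)}) : dyadic_cell a r y x ->
    dyadic_cell a r y' x -> (y j <= y' j)%N.
  move=> /(_ j)/andP[yx _] /(_ j)/andP[_]; move/(le_lt_trans yx).
  rewrite /dyadic_lo /dyadic_hi ltrD2l ltr_pM2r ?invr_gt0// ltr_pM2l// ltr_nat.
  by [].
by apply/eqP; rewrite eqn_leq !le2.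
Qed.

Lemma dyadic_refine a r k (z : {ffun 'I_d -> 'I_(2 ^ k.+1)}) : 0 < r ->
  exists z' : {ffun 'I_d -> 'I_(2 ^ k)}, dyadic_cell a r z `<=` dyadic_cell a r z'.
Proof.
move=> r0.
have k0 : (0 : R) < 2 ^+ k by rewrite exprn_gt0.
have hz j : ((z j)./2 < 2 ^ k)%N.
  by rewrite -divn2 ltn_divLR// -expnSr ltn_ord.
exists [ffun j => Ordinal (hz j)] => x zx j; have /andP[lox xhi] := zx j.
have zE := odd_double_half (z j).
apply/andP; split; [apply: le_trans lox|apply: (lt_le_trans xhi)];
  rewrite /dyadic_lo /dyadic_hi ffunE /= lerD2l exprS invfM mulrA ler_pM2r ?invr_gt0//.
  rewrite ler_pdivlMr// -mulrA ler_pM2l// -natrM ler_nat muln2 -{2}zE; exact: leq_addl.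
rewrite ler_pdivrMr// -mulrA ler_pM2l// -natrM ler_nat muln2 doubleS -[X in (X < _)%N]zE.
by case: (odd _); rewrite ?add1n ?add0n.
Qed.

Lemma dyadic_small a r (U : set 'rV[R]_d) x : 0 < r -> open U -> U x ->
  \forall k \near \oo, forall z : {ffun 'I_d -> 'I_(2 ^ k)},
    dyadic_cell a r z x -> dyadic_cell a r z `<=` U.
Proof.
move=> r0 oU Ux.
have /nbhs_ballP[e /= e0 xeU] : nbhs x U by exact: open_nbhs_nbhs.
near=> k => z zx y zy; apply: xeU; split=> // i j; rewrite (ord1 i).
have k0 : (0 : R) < 2 ^+ k by rewrite exprn_gt0.
have rk : r / 2 ^+ k < e.
  rewrite ltr_pdivrMr// mulrC -ltr_pdivrMr//.
  apply: (@lt_le_trans _ _ k%:R); first by near: k; exact: nbhs_infty_gtr.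
  by rewrite -natrX ler_nat ltnW// ltn_expl.
have /andP[lox xhi] := zx j; have /andP[loy yhi] := zy j.
have hilo : dyadic_hi a r z j = dyadic_lo a r z j + r / 2 ^+ k.
  by rewrite /dyadic_hi /dyadic_lo -natr1; ring.
rewrite /ball /= ltr_distlC; move: xhi yhi; rewrite hilo => xhi yhi.
by apply/andP; split; lra.
Unshelve. all: end_near. Qed.

Lemma patch_ndseq_cvg (h : 'rV[R]_d -> R) (F : (set 'rV[R]_d)^nat) x :
  nondecreasing_seq F ->
  ((EFin \o h) \_ (F n)) x @[n --> \oo] --> ((EFin \o h) \_ (\bigcup_n F n)) x.
Proof.
move=> ndF; rewrite [((_ \_ (\bigcup_n F n)) x)]patchE; apply: cvg_near_cst.
case: ifPn => [|xF]; rewrite ?inE.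
  move=> [m _ Fmx]; near=> n; rewrite patchE mem_set//.
  by move: x Fmx; apply/subsetPset/ndF; near: n; exact: nbhs_infty_ge.
near=> n; rewrite patchE memNset// => Fnx; move: xF; rewrite notin_setE; apply.
by exists n.
Unshelve. all: end_near. Qed.

Lemma patch_niseq_cvg (h : 'rV[R]_d -> R) (F : (set 'rV[R]_d)^nat) x :
  nonincreasing_seq F ->
  ((EFin \o h) \_ (F n)) x @[n --> \oo] --> ((EFin \o h) \_ (\bigcap_n F n)) x.
Proof.
move=> niF; rewrite [((_ \_ (\bigcap_n F n)) x)]patchE; apply: cvg_near_cst.
case: ifPn => [|xF]; rewrite ?inE.
  by move=> Fx; near=> n; rewrite patchE mem_set//; exact: Fx.
move: xF; rewrite notin_setE => /existsNP[m /not_implyP[_ Fmx]].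
near=> n; rewrite patchE memNset// => Fnx; apply: Fmx.
by move: x Fnx; apply/subsetPset/niF; near: n; exact: nbhs_infty_ge.
Unshelve. all: end_near. Qed.

(** The sets that a dyadic subdivision of the box resolves form a ring that
    generates the Borel sets, so that a sign condition on all subboxes spreads
    to all Borel subsets by the monotone class theorem. *)
Section box_positivity.
Variables (a : 'I_d -> R) (r : R) (h : 'rV[R]_d -> R).
Hypothesis r0 : 0 < r.
Let Q0 := hobox a (fun j => a j + r).
Hypothesis hi : lebd.-integrable Q0 (EFin \o h).
Hypothesis h0 : forall lo hi, (forall j, a j <= lo j < hi j /\ hi j <= a j + r) ->
  (0 <= \int[lebd]_(x in hobox lo hi) (h x)%:E)%E.

Let cell k (z : {ffun 'I_d -> 'I_(2 ^ k)}) := dyadic_cell a r z.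

Let resolved k (A : set 'rV[R]_d) := forall z : {ffun 'I_d -> 'I_(2 ^ k)}, cell z `<=` A \/ cell z `<=` ~` A.

Let resolvedS k A : resolved k A -> resolved k.+1 A.
Proof.
move=> sA z; have [z' zz'] := dyadic_refine a z r0.
by case: (sA z') => H; [left|right]; apply: subset_trans H.
Qed.

Let resolved_le k l A : (k <= l)%N -> resolved k A -> resolved l A.
Proof.
by move=> /subnK <-; elim: (l - k)%N => // n IH /IH; rewrite addSn; exact: resolvedS.
Qed.

Let ring : set (set 'rV[R]_d) := [set A | measurable A /\ exists k, resolved k A].

Let ring_setring : setring ring.
Proof.
split.
- by split=> //; exists 0%N => z; right => x _.
- move=> A B [mA [k sA]] [mB [l sB]]; split; first exact: measurableU.
  exists (maxn k l) => z.
  have [zA|zA] := resolved_le (leq_maxl k l) sA z.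
    by left=> x /zA; left.
  have [zB|zB] := resolved_le (leq_maxr k l) sB z.
    by left=> x /zB; right.
  by right=> x zx [Ax|Bx]; [exact: zA zx Ax|exact: zB zx Bx].
- move=> A B [mA [k sA]] [mB [l sB]]; split; first exact: measurableD.
  exists (maxn k l) => z.
  have [zA|zA] := resolved_le (leq_maxl k l) sA z; last by right=> x /zA ? [].
  have [zB|zB] := resolved_le (leq_maxr k l) sB z; first by right=> x /zB ? [].
  by left=> x zx; split; [exact: zA|exact: zB].
Qed.

Let cell_sub k (z : {ffun 'I_d -> 'I_(2 ^ k)}) : cell z `<=` Q0.
Proof.
move=> x zx j; have /andP[lox xhi] := zx j.
have [/andP[alo _] hia] := dyadic_cell_sub a z j r0.
by rewrite (le_trans alo lox)/= (lt_le_trans xhi).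
Qed.

Let positive : set (set 'rV[R]_d) :=
  [set A | measurable A /\ (0 <= \int[lebd]_(x in Q0 `&` A) (h x)%:E)%E].

Let mQ0 : measurable Q0. Proof. exact: measurable_hobox. Qed.

Let positive_lim (F : (set 'rV[R]_d)^nat) (A : set 'rV[R]_d) :
  (forall n, positive (F n)) -> measurable A ->
  (forall x, ((EFin \o h) \_ (F n)) x @[n --> \oo] --> ((EFin \o h) \_ A) x) ->
  positive A.
Proof.
move=> pF mA FA; split=> //.
have mh : measurable_fun Q0 (EFin \o h) by exact: measurable_int hi.
have mp B : measurable B -> measurable_fun Q0 ((EFin \o h) \_ B).
  move=> mB; apply/measurable_restrict => //.
  by apply: measurable_funS mh => // x [].
rewrite integral_mkcondr.
have le_h x n : Q0 x -> (`|((EFin \o h) \_ (F n)) x| <= (abse \o (EFin \o h)) x)%E.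
  by move=> _; rewrite patchE; case: ifP => //= _; rewrite normr0 lee_fin.
have [||||_ _ cvgF] := @dominated_convergence _ _ _ lebd _ mQ0
  (fun n => (EFin \o h) \_ (F n)) ((EFin \o h) \_ A) (abse \o (EFin \o h))
  (fun n => mp _ (pF n).1).
- exact: mp.
- by apply: aeW => x _; exact: FA.
- exact: integrable_abse.
- by apply: aeW => x Qx n; exact: le_h.
have <- := cvg_lim _ cvgF => //.
apply: lime_ge; first by apply/cvg_ex; eexists; exact: cvgF.
by apply: nearW => n /=; rewrite -integral_mkcondr; exact: (pF n).2.
Qed.

Let positive_monotone : monotone positive.
Proof.
split=> F mF pF.
  apply: (positive_lim pF); first by apply: bigcupT_measurable => n; exact: (pF n).1.
  by move=> x; exact: patch_ndseq_cvg.
apply: (positive_lim pF); first by apply: bigcapT_measurable => n; exact: (pF n).1.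
by move=> x; exact: patch_niseq_cvg.
Qed.

Let ring_positive : ring `<=` positive.
Proof.
move=> A [mA [k sA]]; split=> //.
pose s := [seq z <- enum {ffun 'I_d -> 'I_(2 ^ k)} | `[< cell z `<=` A >]].
have E : Q0 `&` A = \big[setU/set0]_(z <- s) cell z.
  apply/seteqP; split=> x.
    move=> [Q0x Ax]; have [z zx] := dyadic_cover k r0 Q0x.
    rewrite -bigcup_seq; exists z => //=.
    rewrite mem_filter mem_enum andbT; apply/asboolP.
    by case: (sA z) => // /(_ _ zx).
  rewrite -bigcup_seq => -[z /=]; rewrite mem_filter => /andP[/asboolP zA _] zx.
  by split; [exact: cell_sub zx|exact: zA].
rewrite E integral_bigsetU_EFin//.
- apply: sume_ge0 => z _; apply: h0 => j; exact: dyadic_cell_sub.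
- by move=> z; exact: measurable_hobox.
- by rewrite filter_uniq// enum_uniq.
- by move=> z z' _ _ [x [zx z'x]]; exact: dyadic_inj zx z'x.
- rewrite -E; apply: (measurable_funS mQ0); first by move=> x [].
  exact: measurable_int hi.
Qed.

Let ring_generates : @measurable _ 'rV[R]_d `<=` <<sr ring>>.
Proof.
have [sr0 srD srU] := smallest_sigma_ring ring.
have srT : <<sr ring>> setT.
  by apply: sub_g_sigma_ring; split=> //; exists 0%N => z; left.
apply: smallest_sub.
  by split=> // A rA; exact: srD.
move=> U oU.
pose Uk k := \bigcup_(z in [set z : {ffun 'I_d -> 'I_(2 ^ k)} | cell z `<=` U]) cell z.
have UE : U = \bigcup_k (Uk k `|` (U `\` Q0)).
  apply/seteqP; split=> x.
    move=> Ux; have [Q0x|nQ0x] := pselect (Q0 x); last by exists 0%N => //; right.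
    have [k _ /(_ k (leqnn k)) kU] := dyadic_small a r0 oU Ux.
    exists k => //; left; have [z zx] := dyadic_cover k r0 Q0x.
    by exists z => //; exact: kU.
  by move=> [k _ [[z zU /zU//]|[]]].
rewrite UE; apply: srU => k; apply: sub_g_sigma_ring; split.
  apply: measurableU; last by apply: measurableD => //; exact: open_measurable_mx.
  by apply: fin_bigcup_measurable => // z _; exact: measurable_hobox.
exists k => z; have [zU|zU] := pselect (cell z `<=` U).
  by left=> x zx; left; exists z.
right=> x zx [[z' z'U z'x]|[_]]; last by apply; exact: cell_sub zx.
by apply: zU; rewrite (dyadic_inj r0 zx z'x).
Qed.

Lemma box_integral_ge0_ae : {ae lebd, forall x, Q0 x -> 0 <= h x}.
Proof.
pose A := Q0 `&` [set x | (EFin \o h) x < 0]%E.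
have mh : measurable_fun Q0 (EFin \o h) by exact: measurable_int hi.
have mA : measurable A.
  by rewrite /A; apply: emeasurable_fun_infty_o.
have [_ A0] : positive A.
  apply: (monotone_setring_sub_g_sigma_ring positive_monotone ring_setring).
    exact: ring_positive.
  exact: ring_generates.
have QA : Q0 `&` A = A by rewrite /A setIA setIid.
rewrite QA in A0.
have mhA : measurable_fun A (EFin \o h) by apply: measurable_funS mh => // x [].
have absA : (\int[lebd]_(x in A) `|(EFin \o h) x| = 0)%E.
  apply/eqP; rewrite eq_le integral_ge0// andbT.
  rewrite (@eq_integral _ _ _ _ _ (fun x => - (EFin \o h) x)%E); last first.
    by move=> x; rewrite inE => -[_ /=]; rewrite lte_fin => hx; rewrite ltr0_norm.
  rewrite integralN /=; last first.
    apply/fin_num_adde_defr/integrable_pos_fin_num => //.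
    by apply: integrableS hi => // x [].
  by rewrite leeNl oppe0.
have := (ae_eq_integral_abs lebd mA mhA).1 absA.
apply: filterS => x /= hx Q0x; rewrite leNgt; apply/negP => hx0.
have Ax : A x by split=> //=; rewrite lte_fin.
by have [hE] := hx Ax; rewrite hE ltxx in hx0.
Qed.

End box_positivity.

End boxes.

(** * A sign condition against products of bumps *)

Section tensor_positivity.
Context {R : realType} {d : nat}.
Local Notation lebd := (lebesgue_rV R d).

Lemma measurable_ball_rV (y : 'rV[R]_d) (e : R) : 0 < e -> measurable (ball y e : set 'rV[R]_d).
Proof. by move=> e0; apply: open_measurable_mx; exact: ball_open. Qed.

Lemma cvg_tensor (b : nat -> 'I_d -> R -> R) (c : 'I_d -> R -> R) (x : 'rV[R]_d) :
  (forall j, b k j (x ord0 j) @[k --> \oo] --> c j (x ord0 j)) ->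
  tensor (b k) x @[k --> \oo] --> tensor c x.
Proof.
move=> bc; rewrite /tensor; elim: (index_enum _) => [|j s IH].
  by under eq_fun do rewrite big_nil; rewrite big_nil; exact: cvg_cst.
by under eq_fun do rewrite big_cons; rewrite big_cons; exact: cvgM.
Qed.

Lemma tensor_bump_norm_le1 (b : 'I_d -> R -> R) (x : 'rV[R]_d) :
  (forall j t, 0 <= b j t) -> (forall j t, b j t <= 1) -> `|tensor b x| <= 1.
Proof.
move=> b0 b1; rewrite tensor_norm /tensor.
elim: (index_enum _) => [|j s IH]; first by rewrite big_nil.
by rewrite big_cons -[leRHS]mulr1 ler_pM ?prodr_ge0// ger0_norm.
Qed.

(** Products of bumps approximate the indicators of boxes boundedly, so a sign
    seen by all products of bumps is seen by all boxes. *)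
Lemma tensor_ge0_ae (y : 'rV[R]_d) (e : R) (h : 'rV[R]_d -> R) : 0 < e ->
  lebd.-integrable (ball y e) (EFin \o h) ->
  (forall lo hi b,
     (forall j, [/\ y ord0 j - e < lo j, hi j < y ord0 j + e & bump (lo j) (hi j) (b j)]) ->
     0 <= \int[lebd]_(x in ball y e) (h x * tensor b x)) ->
  {ae lebd, forall x, ball y (e / 2) x -> 0 <= h x}.
Proof.
move=> e0 ih h0; pose a j := y ord0 j - e / 2.
have mB := measurable_ball_rV y e0.
have sub lo hi : (forall j, a j <= lo j /\ hi j <= a j + e) -> hobox lo hi `<=` ball y e.
  move=> alohi x xQ; split=> // i j; rewrite (ord1 i) /ball /= ltr_distlC.
  have /andP[lox xhi] := xQ j; have [alo hia] := alohi j.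
  by move: alo hia; rewrite /a => alo hia; apply/andP; split; lra.
have mh : measurable_fun (ball y e : set 'rV[R]_d) h.
  by apply/measurable_EFinP; exact: measurable_int ih.
have : {ae lebd, forall x, hobox a (fun j => a j + e) x -> 0 <= h x}.
  apply: box_integral_ge0_ae => //.
    by apply: integrableS ih => //; [exact: measurable_hobox|exact: sub].
  move=> lo hi lohi.
  have /choice[b Hb] : forall j, exists B : nat -> R -> R,
     [/\ forall k, bump (lo j - k.+1%:R^-1) (hi j) (B k),
      forall k x, B k x <= 1 &
      forall x, B k x @[k --> \oo] --> (\1_(`[lo j, hi j[) x : R)].
    by move=> j; apply: bump_approx; have [/andP[]] := lohi j.
  pose F k x := (h x * tensor (b^~ k) x)%:E.
  have mt k : measurable_fun setT (tensor (b^~ k) : 'rV[R]_d -> R).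
    apply: measurable_tensor => j; have [bb _ _] := Hb j.
    by apply: continuous_measurable_fun; apply: smooth_continuous; case: (bb k) => -[].
  have Fh k x : (`|F k x| <= `|(h x)%:E|)%E.
    rewrite /F lee_fin normrM -[leRHS]mulr1 ler_wpM2l//.
    apply: tensor_bump_norm_le1 => j t; first by have [bb _ _] := Hb j; case: (bb k).
    by have [_ b1 _] := Hb j.
  have Fcvg x : F k x @[k --> \oo] --> ((EFin \o h) \_ (hobox lo hi)) x.
    have -> : ((EFin \o h) \_ (hobox lo hi)) x =
        (h x * tensor (fun j => \1_(`[lo j, hi j[)) x)%:E.
      rewrite patchE; case: ifPn => [|xQ]; rewrite ?inE.
        move=> xQ; rewrite /tensor big1 ?mulr1// => j _.
        by rewrite indicE mem_set//= in_itv /=; exact: xQ.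
      have [j xj] : exists j, ~ (lo j <= x ord0 j < hi j).
        by apply/existsNP => H; move: xQ; rewrite notin_setE; apply.
      by rewrite /tensor (bigD1 j)//= indicE memNset ?mul0r ?mulr0//= in_itv.
    apply: cvg_EFin; first by apply: nearW.
    apply: cvgM; first exact: cvg_cst.
    by apply: (@cvg_tensor (fun k j => b j k)) => j; have [_ _] := Hb j.
  have [|||||_ _ cvgF] := @dominated_convergence _ _ _ lebd _ mB F
    ((EFin \o h) \_ (hobox lo hi)) (abse \o (EFin \o h)).
  - by move=> k; apply/measurable_EFinP; apply: measurable_funM => //; exact: measurable_funS (mt k).
  - have mQ := measurable_hobox lo hi.
    apply: (measurable_restrict _ mQ mB).1.
    by apply: (measurable_funS mB); [move=> x []|exact: measurable_int ih].
  - by apply: aeW => x _; exact: Fcvg.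
  - exact: integrable_abse.
  - by apply: aeW => x n _; exact: Fh.
  have <- : (\int[lebd]_(x in ball y e) ((EFin \o h) \_ (hobox lo hi)) x =
      \int[lebd]_(x in hobox lo hi) (h x)%:E)%E.
    rewrite -integral_mkcondr setIidr//.
    by apply: sub => j; have [/andP[alo _] hia] := lohi j.
  have <- := cvg_lim _ cvgF => //.
  apply: lime_ge; first by apply/cvg_ex; eexists; exact: cvgF.
  near=> k; rewrite /= /F.
  have iF : lebd.-integrable (ball y e : set 'rV[R]_d) (EFin \o (fun x => h x * tensor (b^~ k) x)).
    apply: le_integrable (integrable_abse ih) => //.
      by apply/measurable_EFinP; apply: measurable_funM => //; exact: measurable_funS (mt k).
    by move=> x _; rewrite (le_trans (Fh k x))//= normr_id.
  rewrite -Rintegral_EFin// lee_fin; apply: (h0 (fun j => lo j - k.+1%:R^-1) hi).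
  move=> j; have [/andP[alo _] hia] := lohi j; have [bb _ _] := Hb j.
  split=> //; move: alo hia; rewrite /a => alo hia; last by lra.
  have : k.+1%:R^-1 < e / 2.
    by near: k; exact: (near_infty_natSinv_lt (PosNum (divr_gt0 e0 (ltr0n R 2)))).
  by move: (k.+1%:R^-1) => q; lra.
apply: filterS => x Hx xy; apply: Hx => j.
have [_ /(_ ord0 j)] := xy; rewrite /ball /= ltr_distlC /a => /andP[? ?].
by apply/andP; split; lra.
Unshelve. all: end_near. Qed.

End tensor_positivity.

(** * Moving mass in a product test function *)

Lemma integrable_mul_bounded dp (T : measurableType dp) (R : realType)
    (m : {measure set T -> \bar R}) (D : set T) (f h : T -> R) (M : R) :
  measurable D -> m.-integrable D (EFin \o f) -> measurable_fun D h ->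
  (forall x, D x -> `|h x| <= M) -> m.-integrable D (EFin \o (fun x => f x * h x)).
Proof.
move=> mD fi mh hM; apply: (@integrableMl _ _ _ m D mD (EFin \o f) h) => //.
exists M; split; first exact: num_real.
by move=> y My x Dx /=; rewrite (le_trans (hM _ Dx))// ltW.
Qed.

Lemma Rintegral_norm_le dp (T : measurableType dp) (R : realType)
    (m : {measure set T -> \bar R}) (D : set T) (f g : T -> R) :
  measurable D -> m.-integrable D (EFin \o f) -> m.-integrable D (EFin \o g) ->
  (forall x, D x -> `|f x| <= g x) ->
  `|\int[m]_(x in D) f x| <= \int[m]_(x in D) g x.
Proof.
move=> mD fi gi fg; apply: (le_trans (le_normr_Rintegral _ _)) => //.
by apply: le_Rintegral => //; exact: integrable_norm.
Qed.

Lemma compact_support_bounded (R : realType) (V : topologicalType) (K : set V)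
    (f : V -> R) : compact K -> continuous f ->
  (forall x, ~ K x -> f x = 0) -> exists M, forall x, `|f x| <= M.
Proof.
move=> cK cf f0.
have : bounded_set (f @` K).
  apply: compact_bounded; apply: continuous_compact => //; exact: continuous_subspaceT.
move=> [M [_ HM]]; exists (`|M| + 1) => x.
have [Kx|/f0 ->] := pselect (K x); last by rewrite normr0 addr_ge0.
apply: HM; first by rewrite (le_lt_trans (ler_norm M))// ltrDl.
by exists x.
Qed.

Section tensor_tests.
Context {R : realType} {d : nat}.
Local Notation leb := (@lebesgue_measure R).
Local Notation lebd := (lebesgue_rV R d).
Implicit Types (lo hi : 'I_d -> R) (f b : 'I_d -> R -> R) (i : 'I_d).

Definition cbox lo hi : set 'rV[R]_d := [set x | forall j, lo j <= x ord0 j <= hi j].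

Lemma compact_cbox lo hi : compact (cbox lo hi).
Proof.
have -> : cbox lo hi = [set x | forall j, (`[lo j, hi j]%classic : set R) (x ord0 j)].
  by apply/seteqP; split=> x xQ j; have := xQ j; rewrite /= in_itv.
by apply: (@rV_compact R d (fun j => `[lo j, hi j]%classic)) => j; exact: segment_compact.
Qed.

Lemma smooth_tensor f : (forall j, smooth setT (f j)) -> smooth setT (tensor f).
Proof.
move=> sf k; apply: Ck_prod => j.
apply: (@Ck_affine R 'rV[R]_d k (f j) (fun x => x ord0 j) (fun x => x ord0 j)).
- by move=> x v t; rewrite !mxE.
- by move=> x; exact: coord_continuous.
- exact: sf.
Qed.

Lemma tensor_eq0 lo hi f x : (forall j, smooth_within (lo j) (hi j) (f j)) ->
  ~ cbox lo hi x -> tensor f x = 0.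
Proof.
move=> sf /existsNP[j /negP xj].
by rewrite /tensor (bigD1 j)//= (sf j).2// mul0r.
Qed.

Lemma tensor_test (Omega : set 'rV[R]_d) lo hi f :
  (forall j, smooth_within (lo j) (hi j) (f j)) -> cbox lo hi `<=` Omega ->
  test_function Omega (tensor f).
Proof.
move=> sf QO.
have suppQ : closure [set x | tensor f x != 0] `<=` cbox lo hi.
  have cQ : closed (cbox lo hi) by apply: compact_closed => //; exact: compact_cbox.
  rewrite [X in _ `<=` X](closure_id _).1//; apply: closure_subset => x /= /eqP fx.
  by apply: contrapT => /(tensor_eq0 sf).
split; first by apply: smooth_tensor => j; case: (sf j).
- by apply: subclosed_compact suppQ; [exact: closed_closure|exact: compact_cbox].
- exact: subset_trans QO.
Qed.

Definition upd f i (g : R -> R) : 'I_d -> R -> R := fun j => if j == i then g else f j.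

Lemma upd_id f i g : upd f i g i = g. Proof. by rewrite /upd eqxx. Qed.

Lemma tensor_upd f i g x :
  tensor (upd f i g) x = g (x ord0 i) * \prod_(j < d | j != i) f j (x ord0 j).
Proof.
rewrite /tensor (bigD1 i)//= upd_id; congr (_ * _).
by apply: eq_bigr => j /negPf ji; rewrite /upd ji.
Qed.

Lemma derive_tensor_upd f i (F g : R -> R) (x : 'rV[R]_d) : is_derive (x ord0 i) (1 : R) F (g (x ord0 i)) ->
  'D_(delta_mx ord0 i) (tensor (upd f i F)) x = tensor (upd f i g) x.
Proof.
move=> dF; pose c := \prod_(j < d | j != i) f j (x ord0 j).
have dFc : is_derive (x ord0 i) (1 : R) (fun t => c * F t) (c * g (x ord0 i)).
  by have := @is_deriveZ R R R F c (x ord0 i) 1 _ dF.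
rewrite [RHS]tensor_upd mulrC -/c -[RHS](derive_val (is_derive := dFc)) /derive.
congr (lim (_ @ 0^')); apply/funext => h /=.
rewrite [tensor _ x]tensor_upd [tensor _ (_ + _)]tensor_upd !mxE !eqxx !mulr1 -/c.
congr (_ *: (_ - _)); last by rewrite mulrC.
rewrite [RHS]mulrC [h%:A]mulr1; congr (_ * _); apply: eq_bigr => j ji.
by rewrite !mxE (negPf ji) andbF mulr0 add0r.
Qed.

Lemma smooth_bounded (l h : R) (g : R -> R) : smooth_within l h g ->
  exists M, forall x, `|g x| <= M.
Proof.
move=> [sg g0]; apply: (compact_support_bounded (@segment_compact R l h)).
  exact: smooth_continuous.
by move=> x xlh; apply: g0; apply/negP; move: xlh; rewrite /= in_itv.
Qed.

Lemma tensor_measurable_within lo hi f : (forall j, smooth_within (lo j) (hi j) (f j)) ->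
  measurable_fun setT (tensor f).
Proof.
move=> sf; apply: measurable_tensor => j; apply: continuous_measurable_fun.
by apply: smooth_continuous; case: (sf j).
Qed.

Lemma tensor_bounded lo hi f : (forall j, smooth_within (lo j) (hi j) (f j)) ->
  exists M, forall x, `|tensor f x| <= M.
Proof.
move=> sf; have /choice[M HM] : forall j, exists M, forall x, `|f j x| <= M.
  by move=> j; exact: smooth_bounded (sf j).
exists (\prod_(j < d) M j) => x; rewrite tensor_norm /tensor.
by apply: ler_prod => j _; rewrite normr_ge0/=.
Qed.

Lemma integrable_mul_tensor (D : set 'rV[R]_d) (u : 'rV[R]_d -> R) lo hi f :
  measurable D -> lebd.-integrable D (EFin \o u) ->
  (forall j, smooth_within (lo j) (hi j) (f j)) ->
  lebd.-integrable D (EFin \o (fun x => u x * tensor f x)).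
Proof.
move=> mD ui sf; have [M HM] := tensor_bounded sf.
apply: (@integrable_mul_bounded _ _ _ _ _ _ _ M) => //.
by apply: measurable_funS (tensor_measurable_within sf).
Qed.

End tensor_tests.

Section replacement.
Context {R : realType} {d : nat}.
Local Notation leb := (@lebesgue_measure R).
Local Notation lebd := (lebesgue_rV R d).
Implicit Types (lo hi : 'I_d -> R) (b : 'I_d -> R -> R) (i : 'I_d).
Variables (Omega : set 'rV[R]_d) (u : 'rV[R]_d -> R) (G : 'rV[R]_d -> 'rV[R]_d) (M : R).
Hypotheses (oOmega : open Omega) (ui : lebd.-integrable Omega (EFin \o u)).
Hypotheses (uG : is_weak_gradient Omega u G).
Hypotheses (GM : forall x i, Omega x -> `|G x ord0 i| <= M).
Hypotheses (mG : forall i, measurable_fun Omega (fun x => G x ord0 i)).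
Hypothesis M0 : 0 <= M.

Let mO : measurable Omega. Proof. exact: open_measurable_mx. Qed.

Lemma mass_norm_le (lo hi : R) (b : R -> R) : smooth_within lo hi b ->
  forall N, (forall x, `|b x| <= N) -> lo <= hi ->
  \int[leb]_x `|b x| <= N * (hi - lo).
Proof.
move=> sb N bN lohi.
have -> : \int[leb]_x `|b x| = \int[leb]_(x in `[lo, hi]) `|b x|.
  rewrite [RHS]Rintegral_mkcond; congr (Rintegral _ _ _); apply/funext => x.
  rewrite patchE; case: ifPn => //; rewrite notin_setE /= in_itv /= => /negP xb.
  by rewrite sb.2// normr0.
have -> : N * (hi - lo) = \int[leb]_(x in `[lo, hi]) (cst N) x.
  by rewrite Rintegral_cst//= lebesgue_measure_itv /= lte_fin; case: ltgtP lohi => //= ->; rewrite subrr.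
apply: le_Rintegral => //.
- apply: (integrableS measurableT) => //; apply: integrable_norm => //.
  exact: smooth_within_integrable sb.
- apply: continuous_compact_integrable; first exact: segment_compact.
  by apply: continuous_subspaceT => x; exact: cst_continuous.
Qed.

(** Replacing in a tensor test function the factor [b_i] by a multiple of
    another bump of the same mass is a derivative in direction [e_i]; the
    weak gradient controls the effect on [u] by the distance the mass moves. *)
Lemma replace_factor lo hi b i (L H tlo thi : R) (beta : R -> R) :
  (forall j, bump (lo j) (hi j) (b j)) -> bump tlo thi beta -> mass beta = 1 ->
  L <= lo i -> hi i <= H -> L <= tlo -> thi <= H -> L <= H ->
  (forall x : 'rV[R]_d, (forall j, j != i -> lo j <= x ord0 j <= hi j) ->
     L <= x ord0 i <= H -> Omega x) ->
  `|\int[lebd]_(x in Omega) (u x * tensor b x) -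
    \int[lebd]_(x in Omega) (u x * tensor (upd b i (fun t => mass (b i) * beta t)) x)|
  <= M * (2 * (H - L)) * \prod_(j < d) mass (b j).
Proof.
move=> bb bbeta mbeta Llo hiH Ltlo thiH LH QO.
pose m := mass (b i).
(* g has mass 0, so its primitive is compactly supported *)
pose g t := b i t - m * beta t.
have widen (f : R -> R) l h : smooth_within l h f -> L <= l -> h <= H -> smooth_within L H f.
  move=> [sf f0] Ll hH; split=> // x xLH; apply: f0; apply: contra xLH.
  by move=> /andP[lx xh]; rewrite (le_trans Ll)// (le_trans xh).
have sbi := widen _ _ _ (bb i).1 Llo hiH.
have sbeta := widen _ _ _ bbeta.1 Ltlo thiH.
have sg : smooth_within L H g.
  split=> [k|x xLH]; last by rewrite /g sbi.2// sbeta.2// mulr0 subrr.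
  rewrite (_ : g = b i \+ (cst (- m) \* beta)); last first.
    by apply/funext => t; rewrite /g /= mulNr.
  apply: CkD; first exact: sbi.1.
  by apply: CkM; [exact: Ck_cst|exact: sbeta.1].
have m0 : 0 <= m by exact: mass_ge0 (bb i).
have ibi := smooth_within_integrable sbi.
have ibeta := smooth_within_integrable sbeta.
have imbeta : leb.-integrable setT (EFin \o (fun t => m * beta t)).
  rewrite (_ : _ \o _ = (fun t => m%:E * (EFin \o beta) t)%E); last exact/funext.
  exact: integrableZl.
have mg0 : mass g = 0.
  rewrite /mass /g RintegralB// RintegralZl// -[\int[leb]_x beta x]/(mass beta) mbeta.
  by rewrite mulr1 subrr.
have sB : smooth_within L H (primitive g).
  split; first exact: smooth_primitive_within sg.
  move=> x; rewrite negb_and -!ltNge => /orP[xL|Hx]; first exact: primitive_left sg xL.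
  by rewrite (primitive_right sg (ltW Hx)).
have gm : \int[leb]_t `|g t| <= 2 * m.
  have ig := smooth_within_integrable sg.
  have -> : 2 * m = \int[leb]_t (b i t + m * beta t).
    rewrite RintegralD// RintegralZl// -[\int[leb]_x beta x]/(mass beta) mbeta.
    by rewrite mulr1 mulr_natl.
  apply: le_Rintegral => //; first exact: integrable_norm.
    by rewrite (_ : EFin \o _ = (EFin \o b i) \+ (EFin \o (fun t => m * beta t)))//; exact: integrableD.
  move=> t _; apply: (le_trans (ler_normB _ _)).
  by rewrite !ger0_norm ?mulr_ge0// ?(bb i).2 ?bbeta.2.
pose f := upd b i (primitive g).
pose qlo j := if j == i then L else lo j.
pose qhi j := if j == i then H else hi j.
have sf j : smooth_within (qlo j) (qhi j) (f j).
  rewrite /f /upd /qlo /qhi; case: eqP => // _; exact: (bb j).1.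
have QQ : cbox qlo qhi `<=` Omega.
  move=> x xQ; apply: QO => [j ji|].
    by have := xQ j; rewrite /qlo /qhi (negPf ji).
  by have := xQ i; rewrite /qlo /qhi eqxx.
have [_ /(_ _ (tensor_test sf QQ)) HD] := uG i.
have Df x : 'D_(delta_mx ord0 i) (tensor f) x =
    tensor b x - tensor (upd b i (fun t => m * beta t)) x.
  rewrite /f (derive_tensor_upd b (primitive_derive sg (x ord0 i))).
  by rewrite !tensor_upd /g mulrBl; congr (_ - _); rewrite /tensor [RHS](bigD1 i).
have sb' j : smooth_within (if j == i then L else lo j) (if j == i then H else hi j)
    (upd b i (fun t => m * beta t) j).
  rewrite /upd; case: eqP => [_|_]; last exact: (bb j).1.
  split=> [k|x xLH]; last by rewrite sbeta.2// mulr0.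
  by apply: CkM; [exact: Ck_cst|exact: sbeta.1].
have iub := integrable_mul_tensor mO ui (fun j => (bb j).1).
have iub' := integrable_mul_tensor mO ui sb'.
rewrite -RintegralB//.
have -> : \int[lebd]_(x in Omega) (u x * tensor b x - u x * tensor (upd b i (fun t => m * beta t)) x) =
    \int[lebd]_(x in Omega) (u x * 'D_(delta_mx ord0 i) (tensor f) x).
  by apply: eq_Rintegral => x _; rewrite Df mulrBr.
rewrite HD normrN.
have fi j : leb.-integrable setT (EFin \o f j) by exact: smooth_within_integrable (sf j).
have [tf Etf] := tensor_integrable fi.
have itO : lebd.-integrable Omega (EFin \o tensor f) by apply: integrableS tf.
have intO : lebd.-integrable Omega (EFin \o (fun x => `|tensor f x|)) by exact: integrable_norm.
apply: (@le_trans _ _ (\int[lebd]_(x in Omega) (M * `|tensor f x|))).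
  apply: Rintegral_norm_le => //.
  - rewrite (_ : (fun x => _) = (fun x => tensor f x * G x ord0 i)); last first.
      by apply/funext => x; rewrite mulrC.
    by apply: (@integrable_mul_bounded _ _ _ _ _ _ _ M) => // x; exact: GM.
  - exact: (integrableZl mO M intO).
  - by move=> x Ox; rewrite normrM ler_wpM2r// GM.
rewrite RintegralZl// -mulrA ler_wpM2l//.
apply: (@le_trans _ _ (\int[lebd]_x `|tensor f x|)).
  rewrite /Rintegral fine_le//; last 1 first.
  - apply: ge0_subset_integral => //; apply/measurable_EFinP.
    by apply: measurableT_comp => //; exact: tensor_measurable_within sf.
  - exact: integrable_fin_num.
  - by apply: integrable_fin_num => //; exact: integrable_norm.
rewrite Etf (bigD1 i)//= [in leRHS](bigD1 i)//= mulrA.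
apply: ler_pM.
- exact: Rintegral_ge0.
- by apply: prodr_ge0 => j _; exact: Rintegral_ge0.
- rewrite /f upd_id mulrAC.
  apply: (mass_norm_le sB) => // x.
  by rewrite (le_trans (primitive_norm_le x sg)).
- apply: ler_prod => j ji; rewrite Rintegral_ge0//=.
  rewrite /f /upd (negPf ji) /mass le_eqVlt; apply/orP; left; apply/eqP.
  by apply: eq_Rintegral => x _; rewrite ger0_norm// (bb j).2.
Qed.

Lemma bumpZ (lo hi : R) (beta : R -> R) (m : R) : 0 <= m -> bump lo hi beta ->
  bump lo hi (fun t => m * beta t) /\ mass (fun t => m * beta t) = m * mass beta.
Proof.
move=> m0 bbeta; split.
  split; last by move=> x; rewrite mulr_ge0// bbeta.2.
  split=> [k|x xlh]; last by rewrite bbeta.1.2// mulr0.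
  by apply: CkM; [exact: Ck_cst|exact: bbeta.1.1].
by rewrite /mass RintegralZl//; exact: smooth_within_integrable bbeta.1.
Qed.

(** Inside a box all factors can be replaced, one direction at a time, by fixed
    bumps; what remains is a fixed multiple of the total mass. *)
Lemma box_tensor_bound lo hi : (forall j, lo j < hi j) -> cbox lo hi `<=` Omega ->
  exists C, forall b, (forall j, bump (lo j) (hi j) (b j)) ->
    `|\int[lebd]_(x in Omega) (u x * tensor b x)| <= C * \prod_(j < d) mass (b j).
Proof.
move=> lohi QO.
have /choice[beta Hbeta] : forall j, exists e : R -> R, bump (lo j) (hi j) e /\ mass e = 1.
  by move=> j; have [b bb mb] := exists_bump (lohi j); exists b.
pose bs (s : seq 'I_d) b j := if j \in s then fun t => mass (b j) * beta j t else b j.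
have bsP s b j : (forall j, bump (lo j) (hi j) (b j)) ->
    bump (lo j) (hi j) (bs s b j) /\ mass (bs s b j) = mass (b j).
  move=> bb; rewrite /bs; case: ifP => // _.
  have [bbeta mbeta] := bumpZ (mass_ge0 (bb j)) (Hbeta j).1.
  by split=> //; rewrite [LHS]mbeta (Hbeta j).2 mulr1.
have [C HC] : exists C, forall b, (forall j, bump (lo j) (hi j) (b j)) ->
    `|\int[lebd]_(x in Omega) (u x * tensor b x) -
      \int[lebd]_(x in Omega) (u x * tensor (bs (enum 'I_d) b) x)|
    <= C * \prod_(j < d) mass (b j).
  elim: (enum 'I_d) => [|i s [C HC]].
    by exists 0 => b bb; rewrite (_ : bs [::] b = b)// subrr normr0 mul0r.
  exists (C + M * (2 * (hi i - lo i))) => b bb.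
  rewrite mulrDl; apply: le_trans (ler_distD _ _ _) _; apply: lerD (HC b bb) _.
  have -> : \prod_(j < d) mass (b j) = \prod_(j < d) mass (bs s b j).
    by apply: eq_bigr => j _; rewrite (bsP s b j bb).2.
  have -> : bs (i :: s) b = upd (bs s b) i (fun t => mass (bs s b i) * beta i t).
    apply/funext => j; rewrite /upd {1}/bs inE.
    by case: eqP => [->|_] //=; rewrite (bsP s b i bb).2.
  apply: (replace_factor (fun j => (bsP s b j bb).1) (Hbeta i).1 (Hbeta i).2) => //.
    exact: ltW.
  move=> x xQ xi; apply: QO => j.
  by have [->|ji] := eqVneq j i; [|exact: xQ].
exists (C + `|\int[lebd]_(x in Omega) (u x * tensor beta x)|) => b bb.
rewrite -[X in `|X|](subrK (\int[lebd]_(x in Omega) (u x * tensor (bs (enum 'I_d) b) x))).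
rewrite mulrDl; apply: le_trans (ler_normD _ _) (lerD (HC b bb) _).
have pm0 : 0 <= \prod_(j < d) mass (b j).
  by apply: prodr_ge0 => j _; exact: mass_ge0 (bb j).
have -> : \int[lebd]_(x in Omega) (u x * tensor (bs (enum 'I_d) b) x) =
    \prod_(j < d) mass (b j) * \int[lebd]_(x in Omega) (u x * tensor beta x).
  rewrite -RintegralZl//; last first.
    exact: integrable_mul_tensor mO ui (fun j => (Hbeta j).1.1).
  apply: eq_Rintegral => x _; rewrite mulrCA; congr (_ * _).
  rewrite /tensor -big_split /=; apply: eq_bigr => j _.
  by rewrite /bs mem_enum.
by rewrite normrM ger0_norm// mulrC.
Qed.

End replacement.

(** * Rational balls, and the boundary as a graph *)

Section rV_topology.
Context {R : realType} {d : nat}.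
Local Notation lebd := (lebesgue_rV R d).
Implicit Types (x y : 'rV[R]_d).

Lemma ball_rVP x y (e : R) : 0 < e ->
  ball x e y <-> forall j, x ord0 j - e < y ord0 j < x ord0 j + e.
Proof.
move=> e0; split=> [[_ xy] j|xy]; first by have := xy ord0 j; rewrite /ball /= ltr_distlC.
by split=> // i j; rewrite (ord1 i) /ball /= ltr_distlC; exact: xy.
Qed.

Lemma open_closed_cube (V : set 'rV[R]_d) y : open V -> V y -> exists2 e, 0 < e &
  forall x, (forall j, y ord0 j - e <= x ord0 j <= y ord0 j + e) -> V x.
Proof.
move=> oV Vy; have /nbhs_ballP[e /= e0 yeV] : nbhs y V by exact: open_nbhs_nbhs.
exists (e / 2); first by rewrite divr_gt0.
move=> x xy; apply: yeV; apply/ball_rVP => // j.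
by have /andP[? ?] := xy j; apply/andP; split; lra.
Qed.

(** Countably many balls, with rational centers and radii, suffice to cover. *)
Lemma ae_local (U P : set 'rV[R]_d) :
  (forall y, U y -> exists2 e, 0 < e & {ae lebd, forall x, ball y e x -> P x}) ->
  {ae lebd, forall x, U x -> P x}.
Proof.
move=> loc.
pose B (p : 'rV[rat]_d * nat) : set 'rV[R]_d := ball (map_mx ratr p.1 : 'rV[R]_d) p.2.+1%:R^-1.
pose good n (x : 'rV[R]_d) := forall p, unpickle n = Some p ->
  {ae lebd, forall x, B p x -> P x} -> B p x -> P x.
have : {ae lebd, forall x, forall n, good n x}.
  apply/ae_foralln => n; rewrite /good; case: (unpickle n) => [p|]; last exact: aeW.
  have [aeP|naeP] := pselect {ae lebd, forall x, B p x -> P x}.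
    by apply: filterS aeP => x Px q [<-] _.
  by apply: aeW => x q [<-].
apply: filterS => x Hx Ux.
have [e e0 aeP] := loc x Ux.
have oB : open (ball x e : set 'rV[R]_d) by exact: ball_open.
have : ball x e x by exact: ballxx.
rewrite {1}(open_rV_rat_ball oB) => -[p pB px].
apply: (Hx (pickle p) p) => //; first exact: pickleK.
by apply: filterS aeP => z Pz /pB /Pz.
Qed.

End rV_topology.

Section boundary_geometry.
Context {R : realType} {d : nat}.
Implicit Types (x y : 'rV[R]_d) (i j : 'I_d).

Definition set_coord x i (t : R) : 'rV[R]_d := \row_j (if j == i then t else x ord0 j).

Lemma col'_set_coord x i t : col' i (set_coord x i t) = col' i x.
Proof.
apply/rowP => j; rewrite !mxE ifF//; apply/negbTE.
by rewrite eq_sym neq_lift.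
Qed.

Lemma continuous_col' i (g : 'rV[R]_d.-1 -> R) : continuous g ->
  continuous (fun x : 'rV[R]_d => g (col' i x)).
Proof.
move=> cg x; apply: (@continuous_comp _ _ _ (col' i) g); last exact: cg.
move=> A /nbhs_ballP[e /= e0 eA]; apply/nbhs_ballP; exists e => //= y [_ xy].
by apply: eA; split=> // i' j; rewrite (ord1 i') !mxE; exact: xy.
Qed.

(** At a boundary point the domain is an epigraph along some axis [i]; moving
    along this axis away from the graph, every nearby point [y] of the domain
    reaches a fixed box [cbox tlo thi] without leaving the domain. The interval
    from [L] to [H] covers the way, and [eta] leaves room for a small cube
    around [y] to move along. *)
Lemma escape_to_box (Omega : set 'rV[R]_d) x0 : (0 < d)%N ->
  open Omega -> smooth_boundary Omega -> closure Omega x0 ->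
  exists i (tlo thi : 'I_d -> R) (rho W : R),
    [/\ cbox tlo thi `<=` Omega, forall j, tlo j < thi j, 0 < rho &
     forall y, Omega y -> ball x0 rho y -> exists eta L H,
     [/\ 0 < eta, forall j, j != i -> tlo j <= y ord0 j - eta /\ y ord0 j + eta <= thi j,
         [/\ L <= y ord0 i - eta, L <= tlo i, y ord0 i + eta <= H, thi i <= H & H - L <= W] &
         forall x, (forall j, j != i -> y ord0 j - eta <= x ord0 j <= y ord0 j + eta) ->
           L <= x ord0 i <= H -> Omega x]].
Proof.
move=> d0 oO bO clx0.
have [Ox0|nOx0] := pselect (Omega x0).
  have [rho rho0 rhoO] := open_closed_cube oO Ox0.
  pose i : 'I_d := Ordinal d0.
  exists i, (fun j => x0 ord0 j - rho), (fun j => x0 ord0 j + rho), rho, (2 * rho).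
  split=> // [j|y Oy xy]; first by lra.
  have oB : open (ball x0 rho : set 'rV[R]_d) by exact: ball_open.
  have [eta eta0 HB] := open_closed_cube oB xy.
  have near_y j : x0 ord0 j - rho <= y ord0 j - eta /\ y ord0 j + eta <= x0 ord0 j + rho.
    split; apply/ltW.
      have /(ball_rVP _ _ rho0)/(_ j) : ball x0 rho (\row_j (y ord0 j - eta)).
        by apply: HB => k; rewrite mxE; apply/andP; split; lra.
      by rewrite mxE => /andP[].
    have /(ball_rVP _ _ rho0)/(_ j) : ball x0 rho (\row_j (y ord0 j + eta)).
      by apply: HB => k; rewrite mxE; apply/andP; split; lra.
    by rewrite mxE => /andP[].
  exists eta, (x0 ord0 i - rho), (x0 ord0 i + rho); split=> //.
    by have [? ?] := near_y i; split=> //; lra.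
  move=> x xy' xi; apply: rhoO => j; have [->//|ji] := eqVneq j i.
  have [? ?] := near_y j; have /andP[? ?] := xy' _ ji.
  by apply/andP; split; lra.
have bx0 : (closure Omega `\` Omega°) x0.
  by split=> // /interior_subset.
have [r [i [b [gamma [r0 sg HO]]]]] := bO x0 bx0.
pose g x := gamma (col' i x).
pose s : R := (-1) ^+ b.
have cg : continuous g by apply: continuous_col'; exact: (Ck_continuous (sg 0%N)).
have gset x t : g (set_coord x i t) = g x by rewrite /g col'_set_coord.
have above : s * (g x0 - x0 ord0 i) <= 0.
  rewrite leNgt; apply/negP => neg.
  have cv : s * (g y - y ord0 i) @[y --> x0] --> s * (g x0 - x0 ord0 i).
    apply: (@cvgM _ _ (nbhs x0) _ (cst s) (fun y => g y - y ord0 i)); first exact: cvg_cst.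
    by apply: (@cvgB _ _ _ (nbhs x0) _ g (fun y => y ord0 i)); [exact: cg|exact: coord_continuous].
  have nb : \forall y \near x0, ball x0 r y by exact: nbhsx_ballx.
  have [y [Oy [yneg yB]]] := clx0 _ (filterI (cvgr_gt _ cv _ neg) nb).
  have := (HO _ yB).1 Oy; rewrite -/s -/(g y) => ypos.
  by have := addr_gt0 ypos yneg; rewrite -mulrDr addrA subrK subrr mulr0 ltxx.
have [rho1 rho10 Hrho1] : exists2 rho, 0 < rho &
    forall y, (forall j, x0 ord0 j - rho <= y ord0 j <= x0 ord0 j + rho) ->
      s * (g y - x0 ord0 i) < r / 4.
  have cv : s * (g y - x0 ord0 i) @[y --> x0] --> s * (g x0 - x0 ord0 i).
    apply: (@cvgM _ _ (nbhs x0) _ (cst s) (fun y => g y - x0 ord0 i)); first exact: cvg_cst.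
    by apply: (@cvgB _ _ _ (nbhs x0) _ g (cst (x0 ord0 i))); [exact: cg|exact: cvg_cst].
  have near_g : \forall y \near x0, s * (g y - x0 ord0 i) < r / 4.
    exact: cvgr_lt _ cv _ (le_lt_trans above (divr_gt0 r0 (ltr0n R 4))).
  move/nbhs_ballP : near_g => [e /= e0 He]; exists (e / 2); first by rewrite divr_gt0.
  move=> y xy; apply: He; apply/ball_rVP => // j.
  by have /andP[? ?] := xy j; apply/andP; split; lra.
(* over the cube of half side rho around x0 the graph stays below height r/4
   above x0; the box will lie between the heights r/2 and 3r/4 *)
pose rho := Num.min rho1 (r / 8).
have rho0 : 0 < rho by rewrite lt_min rho10 divr_gt0.
have rho_r : rho <= r / 8 by rewrite ge_min lexx orbT.
have rho_rho1 : rho <= rho1 by rewrite ge_min lexx.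
have HT x : (forall j, j != i -> x0 ord0 j - rho <= x ord0 j <= x0 ord0 j + rho) ->
    x0 ord0 i - r < x ord0 i < x0 ord0 i + r -> 0 < s * (x ord0 i - g x) -> Omega x.
  move=> xh xi; apply: (HO x _).2; apply/ball_rVP => // j.
  have [->//|ji] := eqVneq j i; have /andP[? ?] := xh _ ji.
  by apply/andP; split; lra.
pose tlo j := if j == i then (if b then x0 ord0 i - 3 / 4 * r else x0 ord0 i + r / 2)
  else x0 ord0 j - rho.
pose thi j := if j == i then (if b then x0 ord0 i - r / 2 else x0 ord0 i + 3 / 4 * r)
  else x0 ord0 j + rho.
exists i, tlo, thi, rho, (2 * r); split=> //.
- move=> x xT.
  have xh j : j != i -> x0 ord0 j - rho <= x ord0 j <= x0 ord0 j + rho.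
    by move=> ji; have := xT j; rewrite /tlo /thi (negPf ji).
  have gx : s * (g x - x0 ord0 i) < r / 4.
    rewrite -(gset x (x0 ord0 i)); apply: Hrho1 => j; rewrite mxE.
    case: (eqVneq j i) => [->|/xh /andP[h1 h2]]; [clear - rho10|clear - h1 h2 rho_rho1];
      apply/andP; split; lra.
  have := xT i; rewrite /tlo /thi eqxx => xi; apply: HT => //.
    by move: xi; clear - r0; case: {+}b => /andP[? ?]; apply/andP; split; lra.
  move: gx xi; rewrite /s; clear - r0; case: {+}b => + /andP[? ?];
    rewrite ?expr1 ?expr0 ?mulN1r ?mul1r; lra.
- by move=> j; rewrite /tlo /thi; clear - r0 rho0; case: eqP => // _; last lra; case: {+}b; lra.
move=> y Oy xy.
have oOB : open (Omega `&` ball x0 rho) by apply: openI => //; exact: ball_open.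
have [eta eta0 Heta] := open_closed_cube oOB (conj Oy xy).
have yh j : x0 ord0 j - rho < y ord0 j - eta /\ y ord0 j + eta < x0 ord0 j + rho.
  split.
    have /(ball_rVP _ _ rho0)/(_ j) : ball x0 rho (\row_j (y ord0 j - eta)).
      by apply: (Heta _ _).2 => k; rewrite mxE; apply/andP; split; lra.
    by rewrite mxE => /andP[].
  have /(ball_rVP _ _ rho0)/(_ j) : ball x0 rho (\row_j (y ord0 j + eta)).
    by apply: (Heta _ _).2 => k; rewrite mxE; apply/andP; split; lra.
  by rewrite mxE => /andP[].
have [yi1 yi2] := yh i.
pose L := if b then x0 ord0 i - 3 / 4 * r else y ord0 i - eta.
pose H := if b then y ord0 i + eta else x0 ord0 i + 3 / 4 * r.
exists eta, L, H; split=> //.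
- by move=> j ji; rewrite /tlo /thi (negPf ji); have [/ltW ? /ltW ?] := yh j.
- rewrite /L /H /tlo /thi eqxx; clear - yi1 yi2 rho_r r0 eta0.
  by case: {+}b; split; lra.
move=> x xy' xi.
have xh j : j != i -> x0 ord0 j - rho <= x ord0 j <= x0 ord0 j + rho.
  move=> ji; have /andP[h1 h2] := xy' _ ji; have [h3 h4] := yh j.
  by clear - h1 h2 h3 h4; apply/andP; split; lra.
pose z := set_coord x i (if b then y ord0 i + eta else y ord0 i - eta).
have [Oz zB] : (Omega `&` ball x0 rho) z.
  apply: Heta => j; rewrite mxE; case: (eqVneq j i) => [->|/xy' //].
  by clear - eta0; case: {+}b; apply/andP; split; lra.
have zBr : ball x0 r z by apply: le_ball zB; lra.
have := (HO z zBr).1 Oz; rewrite -/(g z) gset mxE eqxx => zpos.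
apply: HT => //.
  move: xi; rewrite /L /H; clear - yi1 yi2 rho_r r0 eta0.
  by case: {+}b => /andP[? ?]; apply/andP; split; lra.
move: xi zpos; rewrite /L /H /s; clear - yi1 yi2 rho_r r0 eta0; case: {+}b => /andP[? ?];
  rewrite ?expr1 ?expr0 ?mulN1r ?mul1r; lra.
Qed.

End boundary_geometry.

(** * Uniqueness of weak gradients *)

Section weak_gradients.
Context {R : realType} {d : nat}.
Local Notation leb := (@lebesgue_measure R).
Local Notation lebd := (lebesgue_rV R d).
Implicit Types (Omega : set 'rV[R]_d) (g u : 'rV[R]_d -> R).

Lemma cbox_measure (lo hi : 'I_d -> R) :
  measurable (cbox lo hi) /\ (lebd (cbox lo hi) < +oo)%E.
Proof.
have -> : cbox lo hi = [set x | forall j, (`[lo j, hi j]%classic : set R) (x ord0 j)].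
  by apply/seteqP; split=> x xQ j; have := xQ j; rewrite /= in_itv.
have m j : measurable (`[lo j, hi j]%classic : set R) by [].
split; first exact: (@measurable_rV_box R d (fun j => `[lo j, hi j]%classic)).
rewrite (lebesgue_rV_box m) ltey_eq; apply/orP; left.
elim/big_ind: _ => // [x y|j _]; first exact: fin_numM.
by rewrite lebesgue_measure_itv; case: ifP.
Qed.

Lemma Rintegral_support (A B : set 'rV[R]_d) g : A `<=` B ->
  (forall x, B x -> ~ A x -> g x = 0) ->
  \int[lebd]_(x in A) g x = \int[lebd]_(x in B) g x.
Proof.
move=> AB g0; rewrite Rintegral_mkcond [RHS]Rintegral_mkcond.
congr (Rintegral _ _ _); apply/funext => x; rewrite !patchE.
case: ifPn; rewrite ?notin_setE ?inE => Ax; first by rewrite mem_set//; exact: AB.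
by case: ifPn; rewrite ?inE => // Bx; rewrite g0.
Qed.

Lemma locally_integrable_measurable Omega g : open Omega ->
  locally_integrable_on Omega g -> measurable_fun Omega g.
Proof.
move=> oO lg.
pose Q (p : 'rV[rat]_d * 'rV[rat]_d) : set 'rV[R]_d :=
  cbox (fun j => ratr (p.1 ord0 j)) (fun j => ratr (p.2 ord0 j)).
pose F n : set 'rV[R]_d := if unpickle n is Some p then
  if `[< Q p `<=` Omega >] then Q p else set0 else set0.
have FO : Omega = \bigcup_n F n.
  apply/seteqP; split=> [x Ox|x [n _]]; last first.
    by rewrite /F; case: unpickle => // p; case: ifPn => // /asboolP; apply.
  have [e e0 HO] := open_closed_cube oO Ox.
  have /choice[q Hq] : forall j, exists q : rat * rat,
      x ord0 j - e < ratr q.1 < x ord0 j /\ x ord0 j < ratr q.2 < x ord0 j + e.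
    move=> j; have /rat_in_itvoo[q1] : x ord0 j - e < x ord0 j by rewrite ltrBlDr ltrDl.
    have /rat_in_itvoo[q2] : x ord0 j < x ord0 j + e by rewrite ltrDl.
    by rewrite !in_itv /= => Hq2 Hq1; exists (q1, q2).
  pose p : 'rV[rat]_d * 'rV[rat]_d := (\row_j (q j).1, \row_j (q j).2).
  have QO : Q p `<=` Omega.
    move=> z zQ; apply: HO => j; have := zQ j; rewrite !mxE.
    have [/andP[a1 a2] /andP[b1 b2]] := Hq j.
    by move=> /andP[z1 z2]; rewrite (le_trans (ltW a1))//= (le_trans z2)// ltW.
  exists (pickle p) => //; rewrite /F pickleK asboolT// => j; rewrite !mxE.
  by have [/andP[_ /ltW ->] /andP[/ltW -> _]] := Hq j.
have mF n : measurable (F n).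
  rewrite /F; case: unpickle => // p; case: ifP => // _; exact: (cbox_measure _ _).1.
rewrite FO; apply/measurable_fun_bigcup => // n.
rewrite /F; case: unpickle => [p|]; last exact: measurable_fun_set0.
case: ifPn => [/asboolP QO|_]; last exact: measurable_fun_set0.
by have /measurable_int/measurable_EFinP := lg _ (@compact_cbox R d _ _) QO.
Qed.

Lemma bump_cbox_sub_ball (y : 'rV[R]_d) (e : R) (lo hi : 'I_d -> R) (b : 'I_d -> R -> R) : 0 < e ->
  (forall j, [/\ y ord0 j - e < lo j, hi j < y ord0 j + e & bump (lo j) (hi j) (b j)]) ->
  cbox lo hi `<=` ball y e.
Proof.
move=> e0 Hb x xQ; apply/ball_rVP => // j; have [ylo hiy _] := Hb j.
by have /andP[xl xh] := xQ j; rewrite (lt_le_trans ylo xl) (le_lt_trans xh hiy).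
Qed.

Lemma tensor_out (D : set 'rV[R]_d) (lo hi : 'I_d -> R) (b : 'I_d -> R -> R) (x : 'rV[R]_d) :
  (forall j, bump (lo j) (hi j) (b j)) -> cbox lo hi `<=` D -> ~ D x -> tensor b x = 0.
Proof. by move=> bb QD nDx; apply: (tensor_eq0 (fun j => (bb j).1)) => /QD. Qed.

Lemma Rintegral_tensor (D : set 'rV[R]_d) (lo hi : 'I_d -> R) (b : 'I_d -> R -> R) :
  (forall j, bump (lo j) (hi j) (b j)) -> cbox lo hi `<=` D ->
  \int[lebd]_(x in D) tensor b x = \prod_(j < d) mass (b j).
Proof.
move=> bb QD; rewrite (@Rintegral_support D setT)//; last first.
  by move=> x _; exact: tensor_out bb QD.
have [_ E] := tensor_integrable (fun j => smooth_within_integrable (bb j).1).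
transitivity (\int[lebd]_x `|tensor b x|).
  apply: eq_Rintegral => x _; rewrite ger0_norm//.
  by apply: prodr_ge0 => j _; exact: (bb j).2.
rewrite E; apply: eq_bigr => j _; apply: eq_Rintegral => t _.
by rewrite ger0_norm// (bb j).2.
Qed.

(** The duality of mean and supremum, with products of bumps as the only test
    functions: apply [tensor_ge0_ae] to [C + u] and [C - u]. *)
Lemma ae_norm_le_ball Omega u (y : 'rV[R]_d) (e C : R) : 0 < e ->
  open Omega -> ball y e `<=` Omega -> lebd.-integrable Omega (EFin \o u) ->
  (forall lo hi b,
     (forall j, [/\ y ord0 j - e < lo j, hi j < y ord0 j + e & bump (lo j) (hi j) (b j)]) ->
     `|\int[lebd]_(x in Omega) (u x * tensor b x)| <= C * \prod_(j < d) mass (b j)) ->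
  {ae lebd, forall x, ball y (e / 2) x -> `|u x| <= C}.
Proof.
move=> e0 oO BO ui HC.
have mO : measurable Omega by exact: open_measurable_mx.
have mB := measurable_ball_rV y e0.
have uB : lebd.-integrable (ball y e) (EFin \o u) by exact: integrableS ui.
have CB : lebd.-integrable (ball y e) (EFin \o (cst C : 'rV[R]_d -> R)).
  apply: measurable_bounded_integrable => //.
    have [mQ Qoo] := cbox_measure (fun j => y ord0 j - e) (fun j => y ord0 j + e).
    apply: le_lt_trans Qoo; apply: le_measure; rewrite ?inE// => x /(ball_rVP _ _ e0) xB j.
    by have /andP[/ltW -> /ltW ->] := xB j.
  by exists `|C|; split=> // z Cz x _; exact: ltW.
have main (s : R) : `|s| = 1 -> {ae lebd, forall x, ball y (e / 2) x -> 0 <= C + s * u x}.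
  move=> s1.
  have suB : lebd.-integrable (ball y e) (EFin \o (fun x => s * u x)).
    exact: (integrableZl mB s uB).
  apply: (tensor_ge0_ae (h := fun x => C + s * u x) e0).
    exact: (integrableD mB CB suB).
  move=> lo hi b Hb; have bb j : bump (lo j) (hi j) (b j) by have [] := Hb j.
  have QB := bump_cbox_sub_ball e0 Hb.
  have utB : lebd.-integrable (ball y e) (EFin \o (fun x => u x * tensor b x)).
    exact: integrable_mul_tensor mB uB (fun j => (bb j).1).
  have CtB : lebd.-integrable (ball y e) (EFin \o (fun x => C * tensor b x)).
    exact: integrable_mul_tensor mB CB (fun j => (bb j).1).
  rewrite (_ : \int[lebd]_(x in ball y e) _ =
      \int[lebd]_(x in ball y e) (C * tensor b x + s * (u x * tensor b x))); last first.
    by apply: eq_Rintegral => x _; rewrite mulrDl mulrA.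
  rewrite RintegralD//; last exact: (integrableZl mB s utB).
  rewrite !RintegralZl//; last first.
    apply: integrableS (tensor_integrable (fun j => smooth_within_integrable (bb j).1)).1 => //.
  rewrite (Rintegral_tensor bb QB).
  rewrite (@Rintegral_support (ball y e) Omega)//; last first.
    by move=> x _ nB; rewrite (tensor_out bb QB nB) mulr0.
  rewrite -[s * _]opprK subr_ge0; apply: le_trans (HC _ _ _ Hb).
  by apply: le_trans (ler_norm _) _; rewrite normrN normrM s1 mul1r.
have H1 := main 1 (normr1 _); have H2 : `|-1 : R| = 1 by rewrite normrN normr1.
apply: filterS2 H1 (main _ H2) => x h1 h2 xB.
move: (h1 xB) (h2 xB); rewrite ler_norml mul1r mulN1r => h3 h4; apply/andP; split; lra.
Qed.

(** In a small cube the difference of the two has integral zero against all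
    products of bumps, which gives both signs. *)
Lemma weak_gradient_unique Omega u (G G' : 'rV[R]_d -> 'rV[R]_d) i : open Omega ->
  is_weak_gradient Omega u G -> is_weak_gradient Omega u G' ->
  {ae lebd, forall x, Omega x -> G x ord0 i = G' x ord0 i}.
Proof.
move=> oO uG uG'; apply: ae_local => y Oy; have [e e0 HO] := open_closed_cube oO Oy.
exists (e / 2); first by rewrite divr_gt0.
have mO : measurable Omega by exact: open_measurable_mx.
have mB := measurable_ball_rV y e0.
pose K := cbox (fun j => y ord0 j - e) (fun j => y ord0 j + e).
have BK : ball y e `<=` K.
  by move=> x /(ball_rVP _ _ e0) xB j; have /andP[/ltW -> /ltW ->] := xB j.
have KO : K `<=` Omega by exact: HO.
have mK : measurable K by exact: (cbox_measure _ _).1.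
have iB g : locally_integrable_on Omega g -> lebd.-integrable (ball y e) (EFin \o g).
  by move=> lg; apply: integrableS (lg _ (@compact_cbox R d _ _) KO).
have main (F F' : 'rV[R]_d -> 'rV[R]_d) : is_weak_gradient Omega u F -> is_weak_gradient Omega u F' ->
   {ae lebd, forall x, ball y (e / 2) x -> 0 <= F x ord0 i - F' x ord0 i}.
  move=> uF uF'; have [lF HF] := uF i; have [lF' HF'] := uF' i.
  apply: (tensor_ge0_ae (h := fun x => F x ord0 i - F' x ord0 i) e0).
    exact: (integrableB mB (iB _ lF) (iB _ lF')).
  move=> lo hi b Hb; have bb j : bump (lo j) (hi j) (b j) by have [] := Hb j.
  have QB := bump_cbox_sub_ball e0 Hb.
  have test : test_function Omega (tensor b).
    by apply: (tensor_test (fun j => (bb j).1)) => x /QB /BK /KO.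
  have itb g : locally_integrable_on Omega g ->
      lebd.-integrable (ball y e) (EFin \o (fun x => g x * tensor b x)).
    by move=> lg; exact: integrable_mul_tensor mB (iB _ lg) (fun j => (bb j).1).
  have suppE g : \int[lebd]_(x in ball y e) (g x * tensor b x) =
      \int[lebd]_(x in Omega) (g x * tensor b x).
    apply: Rintegral_support; first by move=> x /BK /KO.
    by move=> x _ nB; rewrite (tensor_out bb QB nB) mulr0.
  rewrite (_ : \int[lebd]_(x in ball y e) _ =
      \int[lebd]_(x in ball y e) (F x ord0 i * tensor b x - F' x ord0 i * tensor b x)); last first.
    by apply: eq_Rintegral => x _; rewrite mulrBl.
  rewrite RintegralB//; [|exact: itb..].
  have /oppr_inj E := etrans (esym (HF _ test)) (HF' _ test).
  by rewrite !suppE E subrr.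
apply: filterS2 (main _ _ uG uG') (main _ _ uG' uG) => x h1 h2 xB.
by apply/eqP; rewrite eq_le -subr_ge0 h2// -subr_ge0 h1.
Qed.

End weak_gradients.

(** * Functions with bounded weak gradient are bounded *)

Section bounded_gradient.
Context {R : realType} {d : nat}.
Local Notation leb := (@lebesgue_measure R).
Local Notation lebd := (lebesgue_rV R d).

Lemma bounded_sub_cbox (A : set 'rV[R]_d) : bounded_set A ->
  exists M : R, A `<=` cbox (fun=> - M) (fun=> M).
Proof.
move=> [M [Mreal HM]]; exists (`|M| + 2) => x Ax.
have M1 : M < `|M| + 1 by rewrite (le_lt_trans (ler_norm M))// ltrDl.
have M20 : 0 < `|M| + 2 by rewrite ltr_wpDl.
have : ball (0 : 'rV[R]_d) (`|M| + 2) x.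
  rewrite mx_norm_ball /ball_ /= sub0r normrN.
  by apply: le_lt_trans (HM _ M1 x Ax) _; rewrite ltrD2l ltr1n.
move=> /(ball_rVP _ _ M20) xB j; have := xB j; rewrite !mxE sub0r add0r.
by move=> /andP[/ltW -> /ltW ->].
Qed.

Lemma bounded_measure_lty (A : set 'rV[R]_d) : open A -> bounded_set A -> (lebd A < +oo)%E.
Proof.
move=> oA /bounded_sub_cbox[M AM].
have [mQ Qoo] := @cbox_measure R d (fun=> - M) (fun=> M).
by apply: le_lt_trans Qoo; apply: le_measure; rewrite ?inE//; exact: open_measurable_mx.
Qed.

Variables (Omega : set 'rV[R]_d) (u : 'rV[R]_d -> R) (G : 'rV[R]_d -> 'rV[R]_d) (M : R).
Hypotheses (d0 : (0 < d)%N) (dom : bounded_smooth_domain Omega).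
Hypotheses (ui : lebd.-integrable Omega (EFin \o u)) (uG : is_weak_gradient Omega u G).
Hypotheses (GM : forall x i, Omega x -> `|G x ord0 i| <= M) (M0 : 0 <= M).

Let oO : open Omega. Proof. by case: dom. Qed.

Let bounded_near_closure x0 : closure Omega x0 -> exists C rho,
  [/\ 0 <= C, 0 < rho & {ae lebd, forall x, Omega x /\ ball x0 rho x -> `|u x| <= C}].
Proof.
have [_ _ _ _ bO] := dom; move=> clx0.
have mG i : measurable_fun Omega (fun x => G x ord0 i).
  by apply: (locally_integrable_measurable oO); have [] := uG i.
have [i [tlo [thi [rho [W [TO tlohi rho0 esc]]]]]] := escape_to_box d0 oO bO clx0.
have [CT HCT] := box_tensor_bound oO ui uG GM mG M0 tlohi TO.
have [beta bbeta mbeta] := exists_bump (tlohi i).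
pose C := CT + M * (2 * W).
exists `|C|, rho; split=> //.
apply: ae_local => y [Oy xy].
have [eta [L [H [eta0 near_y [Ly Lt yH tH HLW] HO]]]] := esc y Oy xy.
have [e1 e10 e1O] := open_closed_cube oO Oy.
pose e := Num.min eta e1.
have e0 : 0 < e by rewrite lt_min eta0.
have e_eta : e <= eta by rewrite ge_min lexx.
have e_e1 : e <= e1 by rewrite ge_min lexx orbT.
exists (e / 2); first by rewrite divr_gt0.
have BO : ball y e `<=` Omega.
  move=> x /(ball_rVP _ _ e0) xB; apply: e1O => j; have /andP[? ?] := xB j.
  by apply/andP; split; lra.
suff : {ae lebd, forall x, ball y (e / 2) x -> `|u x| <= C}.
  by apply: filterS => x Hx xB; apply: le_trans (Hx xB) (ler_norm C).
apply: (ae_norm_le_ball e0 oO BO ui) => lo hi b Hb.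
have bb j : bump (lo j) (hi j) (b j) by have [] := Hb j.
have [iL iH _] := Hb i.
have loL : L <= lo i by lra.
have hiH : hi i <= H by lra.
have LH : L <= H by have := tlohi i; lra.
have box (x : 'rV[R]_d) : (forall j, j != i -> lo j <= x ord0 j <= hi j) -> L <= x ord0 i <= H -> Omega x.
  move=> xlh xi; apply: HO => // j ji; have /andP[h1 h2] := xlh _ ji.
  by have [h3 h4 _] := Hb j; clear - h1 h2 h3 h4 e_eta; apply/andP; split; lra.
have R1 := replace_factor oO ui uG GM mG M0 bb bbeta mbeta loL hiH Lt tH LH box.
pose b' := upd b i (fun t => mass (b i) * beta t).
have bb' j : bump (tlo j) (thi j) (b' j) /\ mass (b' j) = mass (b j).
  rewrite /b' /upd; case: eqP => [->|/eqP ji].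
    have [B1 B2] := bumpZ (mass_ge0 (bb i)) bbeta.
    by split=> //; rewrite [LHS]B2 mbeta mulr1.
  split=> //; have [n1 n2 _] := Hb j; have [n3 n4] := near_y _ ji.
  split; last exact: (bb j).2.
  split=> [|x xt]; first exact: (bb j).1.1.
  apply: (bb j).1.2; apply: contra xt => /andP[n5 n6].
  by clear - n1 n2 n3 n4 n5 n6 e_eta; apply/andP; split; lra.
have := HCT b' (fun j => (bb' j).1).
rewrite (eq_bigr (fun j => mass (b j))); last by move=> j _; exact: (bb' j).2.
move=> R2; have pm0 : 0 <= \prod_(j < d) mass (b j).
  by apply: prodr_ge0 => j _; exact: mass_ge0 (bb j).
rewrite -[X in `|X|](subrK (\int[lebd]_(x in Omega) (u x * tensor b' x))).
apply: le_trans (ler_normD _ _) _; rewrite /C mulrDl addrC; apply: lerD => //.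
apply: le_trans R1 _; rewrite ler_wpM2r// ler_wpM2l//; lra.
Qed.

(** By compactness of the closure it is enough to bound [u] near each of its
    points; there [replace_factor] compares the mean of [u] over a small cube
    with its mean over a fixed box. The smoothness of the boundary enters
    through [escape_to_box]: a domain of infinite intrinsic diameter can carry
    unbounded functions of bounded gradient. *)
Lemma bounded_weak_gradient_bounded :
  exists C, {ae lebd, forall x, Omega x -> `|u x| <= C}.
Proof.
have [_ _ _ bd _] := dom.
have [M1 HM1] := bounded_sub_cbox bd.
have loc x0 : exists Cr : R * R, [/\ 0 <= Cr.1, 0 < Cr.2 &
    {ae lebd, forall x, Omega x /\ ball x0 Cr.2 x -> `|u x| <= Cr.1}].
  have [/bounded_near_closure[C [rho [C0 rho0 H]]]|ncl] := pselect (closure Omega x0).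
    by exists (C, rho).
  have /existsNP[B /not_implyP[/nbhs_ballP[e /= e0 eB] nB]] := ncl.
  exists (0, e); split=> //; apply: aeW => x [Ox xB]; exfalso; apply: nB.
  by exists x; split=> //; exact: eB.
have /choice[Cr HCr] := loc.
have := @compact_cbox R d (fun=> - M1) (fun=> M1); rewrite compact_cover.
move=> /(_ _ setT (fun x0 => (ball x0 (Cr x0).2 : set 'rV[R]_d)°)).
case=> [x0 _|x _|D _ cov]; first exact: open_interior.
  exists x => //; rewrite /interior; have [_ r0 _] := HCr x.
  exact: nbhsx_ballx.
pose s : seq 'rV[R]_d := finmap.enum_fset D.
exists (\sum_(x0 <- s) (Cr x0).1).
have : {ae lebd, forall x, forall x0, x0 \in s -> Omega x /\ ball x0 (Cr x0).2 x -> `|u x| <= (Cr x0).1}.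
  elim: s => [|x0 s IH]; first by apply: aeW => x x0; rewrite inE.
  have [_ _ H0] := HCr x0; apply: filterS2 H0 IH => x Hx0 Hs z.
  by rewrite inE => /predU1P[->//|]; exact: Hs.
apply: filterS => x Hx Ox; have [x0 /= x0D xB] := cov x (HM1 x Ox).
apply: (le_trans (Hx x0 x0D (conj Ox (interior_subset xB)))).
rewrite (big_rem x0)//= lerDl; apply: sumr_ge0 => z _.
by have [] := HCr z.
Qed.

End bounded_gradient.

(** * Compactness of almost gradients *)

Section fast_cauchy.
Context dp (T : measurableType dp) (R : realType) (m : {measure set T -> \bar R}).
Variables (D : set T) (f : nat -> T -> R) (c : R).
Hypotheses (mD : measurable D) (fi : forall k, m.-integrable D (EFin \o f k)).
Hypothesis fast : forall k,
  (\int[m]_(x in D) (`|f k.+1 x - f k x|)%:E <= (c / (2 ^ (k + 1))%:R)%:E)%E.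

(** The sum of the increments is integrable: it makes the telescoping series
    converge almost everywhere, and it dominates it. *)
Lemma fast_cauchy_cvg : exists F : T -> R,
  [/\ measurable_fun D F, m.-integrable D (EFin \o F),
      {ae m, forall x, D x -> f k x @[k --> \oo] --> F x} &
      \int[m]_(x in D) `|f k x - F x| @[k --> \oo] --> (0 : R)].
Proof.
have mf k : measurable_fun D (f k) by apply/measurable_EFinP; exact: measurable_int (fi k).
pose g k x := (`|f k.+1 x - f k x|)%:E.
have g0 k x : (0 <= g k x)%E by rewrite lee_fin.
have mg k : measurable_fun D (g k).
  by apply/measurable_EFinP; apply: measurableT_comp => //; exact: measurable_funB.
pose S x := (\sum_(0 <= k <oo) g k x)%E.
have S0 x : (0 <= S x)%E by exact: nneseries_ge0.
have mS : measurable_fun D S by apply: ge0_emeasurable_sum.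
have intS : (\int[m]_(x in D) S x < +oo)%E.
  rewrite integral_nneseries//.
  apply: (@le_lt_trans _ _ (\sum_(0 <= k <oo) (c / (2 ^ (k + 1))%:R)%:E)%E).
    by apply: lee_nneseries => [k _ _|k _]; [exact: integral_ge0|exact: fast].
  have cs : eseries (fun k => (c / (2 ^ (k + 1))%:R)%:E) @ \oo --> (c / 2 ^+ 0)%:E.
    exact: (@cvg_geometric_eseries_half R c 0).
  by have -> := cvg_lim (@ereal_hausdorff R) cs; rewrite ltry.
pose F x := fine (limn_esup (fun k => (f k x)%:E)).
have mF : measurable_fun D F.
  apply: measurableT_comp => //.
  by apply: measurable_fun_limn_esup => k; exact/measurable_EFinP.
have Si : m.-integrable D S.
  by apply/integrableP; split=> //; under eq_integral do rewrite gee0_abs//.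
have cvgF : {ae m, forall x, D x -> f k x @[k --> \oo] --> F x}.
  have := integrable_ae mD Si; apply: filterS => x H Dx.
  have cvg_tel : cvgn (series (telescope (f^~ x))).
    apply: normed_cvg; apply: (@nondecreasing_is_cvgn _ _) => [|].
      apply: nondecreasing_series => k _ _; exact: normr_ge0.
    exists (fine (S x)) => _ [n _ <-].
    rewrite -lee_fin fineK; last exact: H.
    by rewrite /series /= -sumEFin; exact: nneseries_lim_ge.
  have fE : f^~ x = cst (f 0 x) + series (telescope (f^~ x)).
    by apply/funext => n; rewrite {1}(eq_sum_telescope (f^~ x)).
  have cvgf : cvgn (f^~ x) by rewrite fE; apply: is_cvgD => //; exact: is_cvg_cst.
  rewrite /F is_cvg_limn_esupE; last by apply/cvg_ex; exists (limn (f^~ x))%:E; apply: cvg_EFin => //; exact: nearW.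
  rewrite EFin_lim//=.
exists F.
pose dom x := ((`|f 0 x|)%:E + S x)%E.
have domi : m.-integrable D dom.
  by apply: integrableD => //; exact: (integrable_abse (fi 0)).
have le_dom k x : (`|(f k x)%:E| <= dom x)%E.
  rewrite (eq_sum_telescope (f^~ x)) abse_EFin.
  apply: (@le_trans _ _ (`|f 0 x| + `|series (telescope (f^~ x)) k|)%:E).
    by rewrite lee_fin ler_normD.
  rewrite EFinD leeD2l//.
  apply: (@le_trans _ _ (\sum_(0 <= j < k) g j x)%E); last exact: nneseries_lim_ge.
  by rewrite /g sumEFin lee_fin /series /=; exact: ler_norm_sum.
have [|||||Fi cvg0 _] := @dominated_convergence _ _ _ m _ mD (fun k x => (f k x)%:E)
  (EFin \o F) dom.
- by move=> k; exact/measurable_EFinP.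
- exact/measurable_EFinP.
- by apply: filterS cvgF => x H Dx; apply: cvg_EFin; [exact: nearW|exact: H].
- exact: domi.
- by apply: aeW => x n Dx; exact: le_dom.
split=> //; exact: (fine_cvg cvg0).
Qed.

End fast_cauchy.

Section test_functions.
Context {R : realType} {d : nat}.
Implicit Types (Omega : set 'rV[R]_d) (psi : 'rV[R]_d -> R).

Lemma continuous_measurable_rV (f : 'rV[R]_d -> R) : continuous f ->
  measurable_fun setT (f : 'rV[R]_d -> measurableTypeR R).
Proof.
move=> cf; apply: (measurability _ (RGenOpens.measurableE R)) => // _ [_ [a [b ->]] <-].
rewrite setTI; apply: open_measurable_mx.
by apply: open_comp; [move=> ? _; exact: cf|exact: interval_open].
Qed.

Lemma test_continuous Omega psi : test_function Omega psi -> continuous psi.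
Proof. by move=> [sp _ _]; exact: (Ck_continuous (sp 0%N)). Qed.

Lemma test_derive_continuous Omega psi v : test_function Omega psi -> continuous ('D_v psi).
Proof. by move=> [sp _ _]; have /CkSP[_ _ /(_ v)] := sp 1%N; exact: Ck_continuous. Qed.

Lemma test_bounded Omega psi : test_function Omega psi -> exists M, forall x, `|psi x| <= M.
Proof.
move=> tpsi; have [_ cK _] := tpsi.
apply: (compact_support_bounded cK (test_continuous tpsi)) => x nKx.
by apply: contrapT => /eqP px; apply: nKx; exact: subset_closure.
Qed.

Lemma test_derive_bounded Omega psi v : test_function Omega psi ->
  exists K, forall x, `|'D_v psi x| <= K.
Proof.
move=> tpsi; have [_ cK _] := tpsi.
apply: (compact_support_bounded cK (test_derive_continuous (v := v) tpsi)) => x nKx.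
rewrite -[RHS](@derive_cst R 'rV[R]_d R 0 x v).
apply: near_eq_derive; near=> y; apply: contrapT => /eqP py.
have : ~ closure [set x | psi x != 0] y.
  near: y; apply: open_nbhs_nbhs; split=> //; apply: closed_openC; exact: closed_closure.
by apply; exact: subset_closure.
Unshelve. all: end_near. Qed.

End test_functions.

Section lower_upper_limits.
Context {R : realType}.
Implicit Types (a b : nat -> \bar R) (l : \bar R).

Lemma limn_einf_mono a b : (forall n, (a n <= b n)%E) -> (limn_einf a <= limn_einf b)%E.
Proof.
move=> ab; rewrite !limn_einf_lim.
apply: lee_lim; [exact: is_cvg_einfs|exact: is_cvg_einfs|apply: nearW => n].
apply: le_ereal_inf_tmp => _ [k /= nk <-]; apply: le_trans (ab k).
by apply: ereal_inf_lbound; exists k.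
Qed.

Lemma limn_einf_le_lim a b l :
  (forall n, (a n <= b n)%E) -> b n @[n --> \oo] --> l -> (limn_einf a <= l)%E.
Proof. by move=> ab /cvg_limn_einf_sup[<- _]; exact: limn_einf_mono. Qed.

Lemma le_limn_einf a l : (\forall n \near \oo, (l <= a n)%E) -> (l <= limn_einf a)%E.
Proof.
move=> [N _ la]; rewrite limn_einf_lim; apply: lime_ge; first exact: is_cvg_einfs.
exists N => // n /= Nn; apply: le_ereal_inf_tmp => _ [k /= nk <-].
by apply: la; exact: leq_trans nk.
Qed.

Lemma limn_esup_le a l : (\forall n \near \oo, (a n <= l)%E) -> (limn_esup a <= l)%E.
Proof.
move=> [N _ la]; rewrite limn_esup_lim; apply: lime_le; first exact: is_cvg_esups.
exists N => // n /= Nn; apply: ge_ereal_sup => _ [k /= nk <-].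
by apply: la; exact: leq_trans nk.
Qed.

Lemma frequently_le_limn_einf a l : (limn_einf a < l)%E ->
  forall N, exists2 n, (N <= n)%N & (a n <= l)%E.
Proof.
move=> al N; apply: contrapT => H; move: al; rewrite ltNge; apply/negP/negPn.
apply: le_limn_einf; exists N => // n /= Nn; rewrite leNgt; apply/negP => an.
by apply: H; exists n => //; exact: ltW.
Qed.

End lower_upper_limits.

Section gradient_compactness.
Context {R : realType} {d : nat}.
Local Notation lebd := (lebesgue_rV R d).

Definition sqnorm (v : 'rV[R]_d) : R := \sum_(i < d) v ord0 i ^+ 2.

Lemma sqnorm_ge0 v : 0 <= sqnorm v.
Proof. by apply: sumr_ge0 => i _; exact: sqr_ge0. Qed.

Definition midpoint (v w : 'rV[R]_d) : 'rV[R]_d := 2^-1 *: (v + w).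

Lemma parallelogram v w :
  sqnorm (v - w) = 2 * sqnorm v + 2 * sqnorm w - 4 * sqnorm (midpoint v w).
Proof.
rewrite /sqnorm !mulr_sumr -!big_split -sumrB /=; apply: eq_bigr => i _.
by rewrite !mxE; field.
Qed.

Lemma sqnorm_midpoint v w : sqnorm (midpoint v w) <= 2^-1 * (sqnorm v + sqnorm w).
Proof. by have := sqnorm_ge0 (v - w); rewrite parallelogram; lra. Qed.

Lemma coord_sq_le (v : 'rV[R]_d) i : v ord0 i ^+ 2 <= sqnorm v.
Proof. by rewrite /sqnorm (bigD1 i)//= lerDl; apply: sumr_ge0 => j _; exact: sqr_ge0. Qed.

Lemma coord_norm_le (v : 'rV[R]_d) i : `|v ord0 i| <= 1 + sqnorm v.
Proof.
have := coord_sq_le v i; have := sqr_ge0 (`|v ord0 i| - 1).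
rewrite -(@real_normK _ (v ord0 i)) ?num_real// sqrrB1 -mulr_natl.
by have := sqnorm_ge0 v; lra.
Qed.

Definition excess (v : 'rV[R]_d) : R := Num.max (sqnorm v - 1) 0.

Lemma excess_ge0 v : 0 <= excess v. Proof. by rewrite le_max lexx orbT. Qed.

Lemma excess_le_sqnorm v : excess v <= sqnorm v.
Proof. by rewrite ge_max sqnorm_ge0 andbT lerBlDr lerDl. Qed.

Lemma excess_midpoint v w : excess (midpoint v w) <= 2^-1 * (excess v + excess w).
Proof.
rewrite ge_max; apply/andP; split; last by rewrite mulr_ge0 ?addr_ge0 ?excess_ge0.
have := sqnorm_midpoint v w.
have : sqnorm v - 1 <= excess v by rewrite le_max lexx.
have : sqnorm w - 1 <= excess w by rewrite le_max lexx.
lra.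
Qed.

Variables (Omega : set 'rV[R]_d) (u : 'rV[R]_d -> R).
Hypotheses (oO : open Omega) (Ooo : (lebd Omega < +oo)%E).

Let mO : measurable Omega. Proof. exact: open_measurable_mx. Qed.

(** The relaxation of a weak gradient of norm at most 1 that a sequence
    converging to [u] in mean with bounded energies provides. For each [eps]
    the almost gradients form a convex set. *)
Definition almost_gradient (eps : R) (G : 'rV[R]_d -> 'rV[R]_d) :=
  [/\ forall i, measurable_fun setT (fun x => G x ord0 i),
      lebd.-integrable Omega (EFin \o (fun x => sqnorm (G x))),
      \int[lebd]_(x in Omega) excess (G x) <= eps &
      forall i psi K, test_function Omega psi ->
        (forall x, `|'D_(delta_mx ord0 i) psi x| <= K) ->
        `|\int[lebd]_(x in Omega) (u x * 'D_(delta_mx ord0 i) psi x) +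
          \int[lebd]_(x in Omega) (G x ord0 i * psi x)| <= eps * K].

Definition energy2 (G : 'rV[R]_d -> 'rV[R]_d) : R :=
  \int[lebd]_(x in Omega) sqnorm (G x).

Lemma measurable_sqnorm (G : 'rV[R]_d -> 'rV[R]_d) :
  (forall i, measurable_fun setT (fun x => G x ord0 i)) ->
  measurable_fun setT (fun x => sqnorm (G x)).
Proof.
by move=> mG; apply: measurable_sum => i; apply: measurable_funX; exact: mG.
Qed.

Lemma measurable_excess (G : 'rV[R]_d -> 'rV[R]_d) :
  (forall i, measurable_fun setT (fun x => G x ord0 i)) ->
  measurable_fun setT (fun x => excess (G x)).
Proof.
move=> mG; apply: measurable_maxr => //.
by apply: measurable_funB => //; exact: measurable_sqnorm.
Qed.

Let cst_integrable c : lebd.-integrable Omega (EFin \o (cst c : 'rV[R]_d -> R)).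
Proof.
apply: measurable_bounded_integrable => //.
by exists `|c|; split=> // z Cz x _; exact: ltW.
Qed.

Lemma le_integrable_fin (f g : 'rV[R]_d -> R) : measurable_fun Omega f ->
  (forall x, `|f x| <= g x) -> lebd.-integrable Omega (EFin \o g) ->
  lebd.-integrable Omega (EFin \o f).
Proof.
move=> mf fg; apply: le_integrable => //; first exact/measurable_EFinP.
by move=> x _; rewrite /= lee_fin (le_trans (fg x))// ler_norm.
Qed.

Lemma almost_gradient_integrable eps G : almost_gradient eps G ->
  lebd.-integrable Omega (EFin \o (fun x => excess (G x))) /\
  forall i, lebd.-integrable Omega (EFin \o (fun x => G x ord0 i)).
Proof.
move=> [mG sqi _ _]; split=> [|i].
  apply: (le_integrable_fin _ _ sqi).
    by apply: measurable_funTS; exact: measurable_excess.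
  by move=> x; rewrite ger0_norm ?excess_ge0 ?excess_le_sqnorm.
apply: (@le_integrable_fin _ (fun x => 1 + sqnorm (G x))).
- exact: measurable_funTS (mG i).
- by move=> x; exact: coord_norm_le.
- exact: (integrableD mO (cst_integrable 1) sqi).
Qed.

Lemma energy2_le eps G : almost_gradient eps G ->
  energy2 G <= fine (lebd Omega) + eps.
Proof.
move=> aG; have [mG sqi ex _] := aG; have [exi _] := almost_gradient_integrable aG.
have -> : fine (lebd Omega) = \int[lebd]_(x in Omega) (cst 1) x by rewrite Rintegral_cst// mul1r.
apply: le_trans (lerD (lexx _) ex); rewrite -(RintegralD mO (cst_integrable 1) exi).
apply: le_Rintegral => //; first exact: (integrableD mO (cst_integrable 1) exi).
by move=> x _; rewrite -lerBlDl le_max lexx.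
Qed.

Lemma almost_gradient_le e e' G : e <= e' -> almost_gradient e G -> almost_gradient e' G.
Proof.
move=> ee' [mG sqi ex H]; split=> //; first exact: le_trans ex ee'.
move=> i psi K tpsi HK; apply: le_trans (H i psi K tpsi HK) _.
by rewrite ler_wpM2r// (le_trans _ (HK 0)).
Qed.

Lemma test_integrable_mul (g psi : 'rV[R]_d -> R) : test_function Omega psi ->
  lebd.-integrable Omega (EFin \o g) ->
  lebd.-integrable Omega (EFin \o (fun x => g x * psi x)).
Proof.
move=> tpsi gi; have [M HM] := test_bounded tpsi.
apply: (@integrable_mul_bounded _ _ _ _ _ _ _ M) => //.
by apply: measurable_funTS; apply: continuous_measurable_rV; exact: test_continuous tpsi.
Qed.

Lemma energy2_midpoint e G H : almost_gradient e G -> almost_gradient e H ->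
  almost_gradient e (fun x => midpoint (G x) (H x)) /\
  \int[lebd]_(x in Omega) sqnorm (G x - H x) =
  2 * energy2 G + 2 * energy2 H - 4 * energy2 (fun x => midpoint (G x) (H x)).
Proof.
move=> aG aH.
have [mG sG eG wG] := aG; have [exG iG] := almost_gradient_integrable aG.
have [mH sH eH wH] := aH; have [exH iH] := almost_gradient_integrable aH.
have mM i : measurable_fun setT (fun x => midpoint (G x) (H x) ord0 i).
  rewrite (_ : (fun x => _) = (fun x => 2^-1 * (G x ord0 i + H x ord0 i))).
    by apply: measurable_funM => //; exact: measurable_funD.
  by apply/funext => x; rewrite !mxE.
have half (f g : 'rV[R]_d -> R) : lebd.-integrable Omega (EFin \o f) ->
    lebd.-integrable Omega (EFin \o g) ->
    lebd.-integrable Omega (EFin \o (fun x => 2^-1 * (f x + g x))) /\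
    \int[lebd]_(x in Omega) (2^-1 * (f x + g x)) =
    2^-1 * (\int[lebd]_(x in Omega) f x + \int[lebd]_(x in Omega) g x).
  move=> fi gi; have fgi := integrableD mO fi gi; split; first exact: (integrableZl mO _ fgi).
  by rewrite RintegralZl// RintegralD.
have sM : lebd.-integrable Omega (EFin \o (fun x => sqnorm (midpoint (G x) (H x)))).
  have [Si _] := half _ _ sG sH; apply: (le_integrable_fin _ _ Si).
    by apply: measurable_funTS; exact: measurable_sqnorm.
  by move=> x; rewrite ger0_norm ?sqnorm_ge0 ?sqnorm_midpoint.
split; last first.
  have s2G : lebd.-integrable Omega (EFin \o (fun x => 2 * sqnorm (G x))) by exact: (integrableZl mO 2 sG).
  have s2H : lebd.-integrable Omega (EFin \o (fun x => 2 * sqnorm (H x))) by exact: (integrableZl mO 2 sH).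
  have s4M : lebd.-integrable Omega (EFin \o (fun x => 4 * sqnorm (midpoint (G x) (H x)))).
    exact: (integrableZl mO 4 sM).
  rewrite /energy2 -!RintegralZl// -RintegralD// -RintegralB//; last exact: (integrableD mO s2G s2H).
  by apply: eq_Rintegral => x _; rewrite parallelogram.
have [Ei EE] := half _ _ exG exH.
split=> // [|i psi K tpsi HK].
  apply: (@le_trans _ _ (\int[lebd]_(x in Omega) (2^-1 * (excess (G x) + excess (H x))))).
    apply: le_Rintegral => //; last by move=> x _; exact: excess_midpoint.
    apply: (le_integrable_fin _ _ Ei).
      by apply: measurable_funTS; exact: measurable_excess.
    by move=> x; rewrite ger0_norm ?excess_ge0 ?excess_midpoint.
  by rewrite EE; clear - eG eH; lra.
have -> : \int[lebd]_(x in Omega) (midpoint (G x) (H x) ord0 i * psi x) =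
    2^-1 * (\int[lebd]_(x in Omega) (G x ord0 i * psi x) + \int[lebd]_(x in Omega) (H x ord0 i * psi x)).
  have [_ <-] := half _ _ (test_integrable_mul tpsi (iG i)) (test_integrable_mul tpsi (iH i)).
  by apply: eq_Rintegral => x _; rewrite !mxE -mulrDl mulrA.
have := wG i psi K tpsi HK; have := wH i psi K tpsi HK.
rewrite !ler_norml => /andP[h1 h2] /andP[h3 h4]; clear - h1 h2 h3 h4; apply/andP; split; lra.
Qed.

Let V := fine (lebd Omega).
Let V0 : 0 <= V. Proof. exact: fine_ge0. Qed.

Hypothesis exists_almost : forall eps, 0 < eps -> exists G, almost_gradient eps G.

(** The limit, as [eps] vanishes, of the least energy of the almost gradients. *)
Lemma least_energy : exists D : R,
  (forall delta, 0 < delta -> exists2 eps, 0 < eps &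
     forall G, almost_gradient eps G -> D - delta <= energy2 G) /\
  (forall delta eps, 0 < delta -> 0 < eps ->
     exists2 G, almost_gradient eps G & energy2 G <= D + delta).
Proof.
pose S := [set t : R | exists2 eps, 0 < eps & forall G, almost_gradient eps G -> t <= energy2 G].
have ubS : ubound S (V + 1).
  move=> t [eps eps0 Ht]; have [|G aG] := exists_almost (eps := Num.min eps 1).
    by rewrite lt_min eps0 ltr01.
  apply: le_trans (Ht G _) (le_trans (energy2_le aG) _).
    by apply: almost_gradient_le aG; rewrite ge_min lexx.
  by rewrite lerD2l ge_min lexx orbT.
have supS : has_sup S.
  split; last by exists (V + 1).
  exists 0; exists 1 => // G _; apply: Rintegral_ge0 => x _; exact: sqnorm_ge0.
exists (sup S); split=> [delta delta0|delta eps delta0 eps0].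
  have [t [eps eps0 Ht] lt_t] := sup_adherent delta0 supS.
  by exists eps => // G aG; apply: le_trans (ltW lt_t) (Ht G aG).
apply: contrapT => H; have : S (sup S + delta).
  exists eps => // G aG; rewrite leNgt; apply/negP => lt_E.
  by apply: H; exists G => //; exact: ltW.
by move=> /(ub_le_sup supS.2); rewrite gerDl leNgt delta0.
Qed.

(** Young's inequality: it turns a bound on the square integral into one on the
    mean. *)
Lemma norm_le_sqr_weight (t a : R) : 0 < a -> `|t| <= 2^-1 * (a * t ^+ 2 + a^-1).
Proof.
move=> a0; have := sqr_ge0 (a * `|t| - 1).
rewrite sqrrB1 exprMn real_normK ?num_real// -[(a * _) *+ 2]mulr_natl => H.
have : 0 <= a^-1 * (a ^+ 2 * t ^+ 2 - 2 * (a * `|t|) + 1) by rewrite mulr_ge0// invr_ge0 ltW.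
have -> : a^-1 * (a ^+ 2 * t ^+ 2 - 2 * (a * `|t|) + 1) = a * t ^+ 2 - 2 * `|t| + a^-1.
  by field; rewrite gt_eqF.
lra.
Qed.

Lemma coord_dist_le (G H : 'rV[R]_d -> 'rV[R]_d) e e' i k :
  almost_gradient e G -> almost_gradient e' H ->
  \int[lebd]_(x in Omega) sqnorm (G x - H x) <= 8 / 16 ^+ k ->
  (\int[lebd]_(x in Omega) (`|G x ord0 i - H x ord0 i|)%:E
     <= ((8 + V) / (2 ^ (k + 1))%:R)%:E)%E.
Proof.
move=> aG aH HE.
have [_ iG] := almost_gradient_integrable aG; have [_ iH] := almost_gradient_integrable aH.
have iD := integrableB mO (iG i) (iH i).
have iN : lebd.-integrable Omega (EFin \o (fun x => `|G x ord0 i - H x ord0 i|)).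
  exact: (integrable_norm iD).
rewrite -Rintegral_EFin// lee_fin.
have k0 : (0 : R) < 4 ^+ k by rewrite exprn_gt0.
have sD : lebd.-integrable Omega (EFin \o (fun x => sqnorm (G x - H x))).
  have [mG sG _ _] := aG; have [mH sH _ _] := aH.
  have s2G : lebd.-integrable Omega (EFin \o (fun x => 2 * sqnorm (G x))) by exact: (integrableZl mO 2 sG).
  have s2H : lebd.-integrable Omega (EFin \o (fun x => 2 * sqnorm (H x))) by exact: (integrableZl mO 2 sH).
  apply: (@le_integrable_fin _ (fun x => 2 * sqnorm (G x) + 2 * sqnorm (H x))).
  - apply: measurable_funTS; apply: measurable_sqnorm => j.
    rewrite (_ : (fun x => _) = (fun x => G x ord0 j - H x ord0 j)).
      exact: measurable_funB.
    by apply/funext => x; rewrite !mxE.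
  - move=> x; rewrite ger0_norm ?sqnorm_ge0// parallelogram.
    by have := sqnorm_ge0 (midpoint (G x) (H x)); lra.
  - exact: (integrableD mO s2G s2H).
have sDk : lebd.-integrable Omega (EFin \o (fun x => 4 ^+ k * sqnorm (G x - H x))).
  exact: (integrableZl mO _ sD).
have ck := cst_integrable (4 ^+ k)^-1.
have sDc := integrableD mO sDk ck.
(* Young's inequality with weight 4^k *)
apply: (@le_trans _ _ (\int[lebd]_(x in Omega) (2^-1 * (4 ^+ k * sqnorm (G x - H x) + (4 ^+ k)^-1)))).
  apply: le_Rintegral => //; first exact: (integrableZl mO _ sDc).
  move=> x _; apply: le_trans (norm_le_sqr_weight _ k0) _.
  rewrite ler_pM2l// lerD2r ler_pM2l//.
  by have := coord_sq_le (G x - H x) i; rewrite !mxE.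
rewrite RintegralZl// (RintegralD mO sDk ck) RintegralZl// Rintegral_cst// -/V.
apply: (@le_trans _ _ (2^-1 * (4 ^+ k * (8 / 16 ^+ k) + (4 ^+ k)^-1 * V))).
  by rewrite ler_pM2l// lerD2r ler_pM2l.
have -> : (16 : R) ^+ k = 4 ^+ k * 4 ^+ k by rewrite -exprMn -natrM.
have -> : 2^-1 * (4 ^+ k * (8 / (4 ^+ k * 4 ^+ k)) + (4 ^+ k)^-1 * V) = (8 + V) / (2 * 4 ^+ k).
  by field; rewrite gt_eqF.
rewrite natrX addn1 exprS ler_wpM2l ?addr_ge0// lef_pV2 ?posrE ?mulr_gt0 ?exprn_gt0//.
by rewrite ler_pM2l// lerXn2r ?nnegrE// ler_nat.
Qed.

(** Almost gradients of nearly least energy are close to each other, by the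
    parallelogram identity; so they have a limit. *)
Lemma almost_gradients_converge : exists (eps : nat -> R) G (F : 'I_d -> 'rV[R]_d -> R),
  [/\ eps k @[k --> \oo] --> (0 : R), forall k, almost_gradient (eps k) (G k) &
      forall i, [/\ measurable_fun Omega (F i), lebd.-integrable Omega (EFin \o F i),
      {ae lebd, forall x, Omega x -> G k x ord0 i @[k --> \oo] --> F i x} &
      \int[lebd]_(x in Omega) `|G k x ord0 i - F i x| @[k --> \oo] --> (0 : R)]].
Proof.
have [D [Dlow Dupp]] := least_energy.
have k16 k : (0 : R) < (16 ^+ k)^-1 by rewrite invr_gt0 exprn_gt0.
have /choice[eG HeG] : forall k, exists eG : R * ('rV[R]_d -> 'rV[R]_d),
    [/\ 0 < eG.1 <= k.+1%:R^-1, almost_gradient eG.1 eG.2,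
     energy2 eG.2 <= D + (16 ^+ k)^-1 &
     forall G, almost_gradient eG.1 G -> D - (16 ^+ k)^-1 <= energy2 G].
  move=> k; have [e e0 He] := Dlow _ (k16 k).
  pose e' := Num.min e k.+1%:R^-1.
  have e'0 : 0 < e' by rewrite lt_min e0 invr_gt0/=.
  have [G aG EG] := Dupp _ e' (k16 k) e'0.
  exists (e', G); split=> //=; first by rewrite e'0 ge_min lexx orbT.
  by move=> H aH; apply: He; apply: almost_gradient_le aH; rewrite ge_min lexx.
pose eps k := (eG k).1; pose G k := (eG k).2.
have aG k : almost_gradient (eps k) (G k) by have [] := HeG k.
have close k : \int[lebd]_(x in Omega) sqnorm (G k.+1 x - G k x) <= 8 / 16 ^+ k.
  have [_ _ E1 L1] := HeG k; have [_ _ E2 L2] := HeG k.+1.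
  pose e := Num.max (eps k) (eps k.+1).
  have aG1 : almost_gradient e (G k) by apply: almost_gradient_le (aG k); rewrite le_max lexx.
  have aG2 : almost_gradient e (G k.+1).
    by apply: almost_gradient_le (aG k.+1); rewrite le_max lexx orbT.
  have [aM ->] := energy2_midpoint aG2 aG1.
  have mono : (16 ^+ k.+1)^-1 <= (16 ^+ k)^-1 :> R.
    by rewrite lef_pV2 ?posrE ?exprn_gt0// ler_eXn2l// ltr1n.
  have EM : D - (16 ^+ k)^-1 <= energy2 (fun x => midpoint (G k.+1 x) (G k x)).
    have [le_e|/ltW le_e] := leP (eps k) (eps k.+1).
      move: aM; rewrite /e (max_r le_e) => aM.
      by apply: le_trans (L2 _ aM); rewrite lerD2l lerN2.
    by move: aM; rewrite /e (max_l le_e) => aM; exact: L1.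
  rewrite -/(G k) -/(G k.+1) in E1 E2 *; lra.
have lim i := @fast_cauchy_cvg _ _ _ lebd Omega (fun k x => G k x ord0 i) (8 + V) mO
  (fun k => (almost_gradient_integrable (aG k)).2 i)
  (fun k => coord_dist_le i (aG k.+1) (aG k) (close k)).
have /choice[F HF] := lim.
exists eps, G, F; split=> //.
apply: (@squeeze_cvgr _ _ _ _ (cst 0) (fun k => k.+1%:R^-1)).
- by apply: nearW => k; have [/andP[/ltW e0 e1] _ _ _] := HeG k; rewrite /= e0 e1.
- exact: cvg_cst.
- exact: cvg_harmonic.
Qed.

(** The conditions on almost gradients pass to the limit: the mean convergence
    takes care of the integration by parts, Fatou's lemma of the excess. The
    limit is set to 0 on the null set where it leaves the unit ball. *)
Lemma almost_gradient_limit : exists G,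
  [/\ is_weak_gradient Omega u G,
      forall i, measurable_fun setT (fun x => G x ord0 i) &
      forall x, sqnorm (G x) <= 1].
Proof.
have [eps [G [F [eps0 aG HF]]]] := almost_gradients_converge.
have mF i : measurable_fun Omega (F i) by have [] := HF i.
pose sF x := \sum_(i < d) F i x ^+ 2.
have msF : measurable_fun Omega sF.
  by apply: measurable_sum => i; apply: measurable_funX.
have sF1 : {ae lebd, forall x, Omega x -> sF x <= 1}.
  pose exl x := limn_einf (fun k => (excess (G k x))%:E).
  have mex k : measurable_fun Omega (fun x => (excess (G k x))%:E).
    by apply/measurable_EFinP/measurable_funTS; apply: measurable_excess; have [] := aG k.
  have mexl : measurable_fun Omega exl.
    rewrite /exl /limn_einf; apply: measurableT_comp => //.
    by apply: measurable_fun_limn_esup => k; apply: measurableT_comp.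
  have exl0 x : (0 <= exl x)%E by apply: le_limn_einf; apply: nearW => k; rewrite lee_fin excess_ge0.
  have intexl : (\int[lebd]_(x in Omega) exl x <= 0)%E.
    apply: (@le_trans _ _ (limn_einf (fun k => \int[lebd]_(x in Omega) (excess (G k x))%:E)%E)).
      by apply: fatou => // k x _; rewrite lee_fin excess_ge0.
    apply: (limn_einf_le_lim (b := fun k => (eps k)%:E)); last first.
      by apply: cvg_EFin => //; exact: nearW.
    move=> k; have [exi _] := almost_gradient_integrable (aG k).
    by rewrite -Rintegral_EFin// lee_fin; have [] := aG k.
  have absexl : (\int[lebd]_(x in Omega) `|exl x| = 0)%E.
    apply/eqP; rewrite eq_le integral_ge0// andbT.
    by under eq_integral do rewrite gee0_abs//.
  have exlae := (ae_eq_integral_abs lebd mO mexl).1 absexl.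
  have cvgG : {ae lebd, forall x, forall i, Omega x -> G k x ord0 i @[k --> \oo] --> F i x}.
    by apply: filter_forall => i; have [] := HF i.
  apply: filterS2 exlae cvgG => x Hx HG Ox.
  have cvg_sq : sqnorm (G k x) - 1 @[k --> \oo] --> sF x - 1.
    apply: cvgB; last exact: cvg_cst.
    rewrite /sqnorm /sF; elim: (index_enum _) => [|i s IH].
      by under eq_fun do rewrite big_nil; rewrite big_nil; exact: cvg_cst.
    under eq_fun do rewrite big_cons; rewrite big_cons; apply: cvgD => //.
    exact: (cvg_comp _ _ (HG i Ox) (@exprn_continuous R 2 _)).
  have cvg_sqE : (sqnorm (G k x) - 1)%:E @[k --> \oo] --> (sF x - 1)%:E.
    by apply: cvg_EFin => //; exact: nearW.
  have [einf_sq _] := cvg_limn_einf_sup cvg_sqE.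
  rewrite -subr_le0 -lee_fin -einf_sq -[leRHS](Hx Ox).
  by apply: limn_einf_mono => k; rewrite lee_fin le_max lexx.
pose A := Omega `&` [set x | sF x <= 1].
have mA : measurable A by apply: measurable_fun_le.
pose GG x : 'rV[R]_d := \row_i ((F i \_ A) x).
have GGE x i : GG x ord0 i = (F i \_ A) x by rewrite mxE.
have mGG i : measurable_fun setT (fun x => GG x ord0 i).
  rewrite (_ : (fun x => _) = F i \_ A); last by apply/funext => x; rewrite GGE.
  by apply/(measurable_restrictT _ mA); apply: measurable_funS (mF i) => // x [].
have sGG x : sqnorm (GG x) <= 1.
  rewrite /sqnorm; under eq_bigr do rewrite GGE.
  have [xA|xA] := boolP (x \in A).
    under eq_bigr do rewrite patchE xA; by move: xA; rewrite inE => -[].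
  by rewrite big1// => i _; rewrite patchE (negPf xA) expr0n.
exists GG; split=> // i; split.
  move=> K cK KO.
  have mK : measurable K.
    rewrite -(setCK K); apply: measurableC; apply: open_measurable_mx.
    by apply: closed_openC; apply: compact_closed.
  apply: measurable_bounded_integrable => //.
  - by apply: le_lt_trans Ooo; apply: le_measure; rewrite ?inE.
  - exact: measurable_funTS.
  - exists 1; split=> // z z1 x _; apply: le_trans (ltW z1).
    by rewrite -(@expr_le1 _ 2)// real_normK ?num_real// (le_trans (coord_sq_le _ _)).
move=> psi tpsi.
have [K HK] := test_derive_bounded (delta_mx ord0 i) tpsi.
have [M HM] := test_bounded tpsi.
have [_ iF _ cvg0] := HF i.
have E0 : \int[lebd]_(x in Omega) (u x * 'D_(delta_mx ord0 i) psi x) +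
    \int[lebd]_(x in Omega) (F i x * psi x) = 0.
  apply/eqP; rewrite -normr_eq0 eq_le normr_ge0 andbT.
  have cvgB : eps k * K + \int[lebd]_(x in Omega) `|G k x ord0 i - F i x| * M @[k --> \oo] --> (0 : R).
    rewrite -[X in _ --> X](addr0 0) -[X in _ --> X + _](mul0r K) -[X in _ --> _ + X](mul0r M).
    by apply: cvgD; apply: cvgM => //; exact: cvg_cst.
  have <- := cvg_lim (@Rhausdorff R) cvgB.
  apply: limr_ge; first by apply/cvg_ex; exists 0.
  apply: nearW => k; have [_ iG] := almost_gradient_integrable (aG k).
  have [_ _ _ /(_ i psi K tpsi HK) wG] := aG k.
  have iGp := test_integrable_mul tpsi (iG i); have iFp := test_integrable_mul tpsi iF.
  have iGF := integrableB mO (iG i) iF.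
  have iN : lebd.-integrable Omega (EFin \o (fun x => `|G k x ord0 i - F i x|)).
    exact: (integrable_norm iGF).
  have dist : `|\int[lebd]_(x in Omega) (G k x ord0 i * psi x) -
      \int[lebd]_(x in Omega) (F i x * psi x)| <=
      \int[lebd]_(x in Omega) `|G k x ord0 i - F i x| * M.
    rewrite -RintegralB// -RintegralZr//.
    apply: Rintegral_norm_le => //; first exact: (integrableB mO iGp iFp).
      exact: (integrableZr mO M iN).
    by move=> x _; rewrite -mulrBl normrM ler_wpM2l.
  move: wG dist; rewrite !ler_norml => /andP[h1 h2] /andP[h3 h4].
  by clear - h1 h2 h3 h4; apply/andP; split; lra.
rewrite -[LHS](addrK (\int[lebd]_(x in Omega) (F i x * psi x))) E0 sub0r; congr (- _).
rewrite /Rintegral; congr fine; apply: ae_eq_integral => //.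
- by apply/measurable_EFinP; have /measurable_int/measurable_EFinP := test_integrable_mul tpsi iF.
- apply/measurable_EFinP; apply: measurable_funM; first exact: measurable_funTS.
  apply: measurable_funTS; apply: continuous_measurable_rV; exact: test_continuous tpsi.
- apply: filterS sF1 => x Hx Ox; rewrite GGE patchE mem_set//.
  by split=> //; exact: Hx.
Qed.

End gradient_compactness.

(** * Power growth *)

Section power_growth.
Context {R : realType}.
Local Notation leb := (@lebesgue_measure R).
Variables (f : R -> R) (p : R).
Hypotheses (cf : {within [set s : R | 0 <= s], continuous f})
  (df : forall s, 0 < s -> derivable f s 1) (fpos : forall s, 0 < s -> 0 < f s)
  (p1 : 1 < p) (growth : forall s, 0 < s -> p - 1 <= s * derive1 f s / f s).

Let Phi (s : R) : R := \int[leb]_(t in `[0, s]) f t.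

Let growth' (s : R) : 0 < s -> (p - 1) * f s <= s * derive1 f s.
Proof. by move=> s0; have := growth s0; rewrite ler_pdivlMr ?fpos. Qed.

Let derf (s : R) : 0 < s -> is_derive s (1 : R) f (derive1 f s).
Proof. by move=> s0; apply: DeriveDef; [exact: df|rewrite derive1E]. Qed.

Let cf_at (s : R) : 0 < s -> {for s, continuous f}.
Proof. by move=> s0; apply: differentiable_continuous; apply/derivable1_diffP; exact: df. Qed.

Let cf_within (a b : R) : 0 <= a -> {within `[a, b], continuous f}.
Proof.
move=> a0; apply: continuous_subspaceW cf => t /=; rewrite in_itv /= => /andP[ta _].
exact: le_trans ta.
Qed.

Let f_integrable (a b : R) : 0 <= a -> leb.-integrable `[a, b] (EFin \o f).
Proof.
move=> a0; apply: continuous_compact_integrable; first exact: segment_compact.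
exact: cf_within.
Qed.

(** [f(s) / s^(p-1)] is nondecreasing: this is the growth condition on the
    logarithmic derivative, integrated. *)
Lemma power_growth (s t : R) : 0 < s -> s <= t -> f s * t `^ (p - 1) <= f t * s `^ (p - 1).
Proof.
move=> s0; rewrite le_eqVlt => /predU1P[->//|st].
have t0 : 0 < t by exact: lt_trans st.
have dg (x : R) : 0 < x -> is_derive x (1 : R) (fun y => f y * y `^ (- (p - 1)))
    (x `^ (- (p - 1) - 1) * (x * derive1 f x - (p - 1) * f x)).
  move=> x0; have dp := is_derive1_powR (- (p - 1)) x0.
  have := @is_deriveM R R _ _ x 1 _ _ (derf x0) dp; move/is_derive_eq; apply.
  have -> : x `^ (- (p - 1)) = x `^ (- (p - 1) - 1) * x.
    have := @powRD _ x (- (p - 1) - 1) 1; rewrite subrK powRr1 ?(ltW x0)//; apply.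
    by rewrite (gt_eqF x0) implybT.
  by rewrite /GRing.scale /=; ring.
have [||c] := @MVT R (fun y => f y * y `^ (- (p - 1)))
  (fun x => x `^ (- (p - 1) - 1) * (x * derive1 f x - (p - 1) * f x)) s t st.
- by move=> x; rewrite in_itv /= => /andP[sx _]; apply: dg; exact: lt_trans sx.
- apply: derivable_within_continuous => x; rewrite in_itv /= => /andP[sx _].
  by have [] := dg x (lt_le_trans s0 sx).
rewrite in_itv /= => /andP[sc _] E.
have c0 : 0 < c by exact: lt_trans sc.
have : f s * s `^ (- (p - 1)) <= f t * t `^ (- (p - 1)).
  rewrite -subr_ge0 E mulr_ge0 ?subr_ge0 ?(ltW st)//.
  by rewrite mulr_ge0 ?powR_ge0// subr_ge0 growth'.
rewrite !powRN -ler_pdivlMr ?invr_gt0 ?powR_gt0// invrK mulrAC.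
by rewrite ler_pdivlMr ?powR_gt0//.
Qed.

Lemma power_growth_le1 (s : R) : 0 < s -> s <= 1 -> f s <= f 1.
Proof.
move=> s0 s1; have := power_growth s0 s1; rewrite powR1 mulr1 => /le_trans; apply.
rewrite -[leRHS]mulr1 ler_wpM2l ?(ltW (fpos ltr01))//.
apply: (@le_trans _ _ (1 `^ (p - 1))); last by rewrite powR1.
by rewrite ge0_ler_powR ?nnegrE ?subr_ge0 ?(ltW p1) ?(ltW s0).
Qed.

Lemma Phi_derive (s : R) : 0 < s -> is_derive s (1 : R) Phi (f s).
Proof.
move=> s0; have ss1 : s < s + 1 by rewrite ltrDl.
have [dF FE] := continuous_FTC1_closed ss1 (f_integrable (s + 1) (lexx 0)) s0 (cf_at s0).
by apply: DeriveDef; [exact: dF|rewrite -derive1E].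
Qed.

Lemma Phi_ge0 (s : R) : 0 <= Phi s.
Proof.
rewrite /Phi -Rintegral_itv_obnd_cbnd.
  by apply: Rintegral_ge0 => t; rewrite /= in_itv /= => /andP[t0 _]; exact/ltW/fpos.
apply: integrableS (f_integrable s (lexx 0)) => //.
by apply: subset_itvr; rewrite bnd_simp.
Qed.

(** Integrating [(s f(s))' >= p f(s)]. *)
Lemma Phi_le (s : R) : 0 < s -> p * Phi s <= s * f s.
Proof.
move=> s0; pose H t := t * f t - p * Phi t.
have dH (t : R) : 0 < t -> is_derive t (1 : R) H (f t + t * derive1 f t - p * f t).
  move=> t0.
  have d1 := @is_deriveM R R id f t 1 _ _ (is_derive_id _ _) (derf t0).
  have d2 := @is_deriveZ R R R Phi p t 1 _ (Phi_derive t0).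
  have := @is_deriveB R R R _ _ t 1 _ _ d1 d2; move/is_derive_eq; apply.
  by rewrite /GRing.scale /=; ring.
have cH : {within `[0, s], continuous H}.
  have cid : {within `[0, s], continuous (id : R -> R)}.
    by apply: continuous_subspaceT => y; exact: cvg_id.
  have cP := parameterized_integral_continuous (ltW s0) (f_integrable s (lexx 0)).
  move=> x; apply: cvgB.
    by apply: cvgM; [exact: cid|exact: (@cf_within 0 s (lexx 0) x)].
  by apply: cvgM; [exact: cvg_cst|exact: cP].
have [|//|c] := @MVT R H (fun t => f t + t * derive1 f t - p * f t) 0 s s0.
  by move=> x; rewrite in_itv /= => /andP[x0 _]; exact: dH.
have -> : H 0 = 0 by rewrite /H /Phi set_itv1 Rintegral_set1 mulr0 mul0r subrr.
rewrite in_itv /= !subr0 => /andP[c0 _] E.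
rewrite -subr_ge0 -/(H s) E mulr_ge0 ?(ltW s0)//.
by have := growth' c0; lra.
Qed.

Lemma Phi_le1 (s : R) : 0 <= s -> s <= 1 -> Phi s <= s * f 1 /\ Phi s <= f 1 / p.
Proof.
rewrite le_eqVlt => /predU1P[<-|s0] s1.
  rewrite /Phi set_itv1 Rintegral_set1 mul0r; split=> //.
  by rewrite divr_ge0 ?(ltW (fpos _))// ltW// (lt_trans ltr01).
have p0 : 0 < p by exact: lt_trans p1.
have f1 := fpos ltr01.
have H : p * Phi s <= s * f 1.
  by apply: le_trans (Phi_le s0) _; rewrite ler_pM2l// power_growth_le1.
split; last first.
  by rewrite ler_pdivlMr// mulrC (le_trans H)// -[leRHS]mul1r ler_pM2r.
by apply: le_trans H; rewrite -[leLHS]mul1r ler_wpM2r ?Phi_ge0// ltW.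
Qed.

(** On the part above [1 + delta] the primitive dominates the square by a factor
    that is exponentially large in [p]; it is enough to integrate [f] over the
    upper half of [1, s]. *)
Lemma excess_le_Phi (delta s : R) : 2 <= p -> 0 < delta -> 0 <= s ->
  Num.max (s ^+ 2 - 1) 0 <=
  2 * delta + delta ^+ 2 + 4 * (1 + delta / 2) `^ (2 - p) * (Phi s / f 1).
Proof.
move=> p2 delta0 s0; have f1 := fpos ltr01.
have rest : 0 <= 4 * (1 + delta / 2) `^ (2 - p) * (Phi s / f 1).
  by rewrite !mulr_ge0 ?powR_ge0 ?invr_ge0 ?Phi_ge0 ?(ltW f1).
have d2 : 0 <= delta ^+ 2 by exact: sqr_ge0.
rewrite ge_max; apply/andP; split; last by rewrite addr_ge0// addr_ge0// mulr_ge0// ltW.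
have [sd|ds] := leP s (1 + delta).
  have : s ^+ 2 <= (1 + delta) ^+ 2 by rewrite lerXn2r ?nnegrE ?addr_ge0// ltW.
  rewrite sqrrD expr1n mul1r -mulr_natl => H; lra.
pose s' := (1 + s) / 2.
have s's : s' < s by rewrite /s'; lra.
have s'1 : 1 <= s' by rewrite /s'; lra.
have s'0 : 0 < s' by lra.
have s'd : 1 + delta / 2 <= s' by rewrite /s'; lra.
have [||c] := @MVT R Phi f s' s s's.
- by move=> x; rewrite in_itv /= => /andP[sx _]; apply: Phi_derive; exact: lt_trans sx.
- apply: derivable_within_continuous => x; rewrite in_itv /= => /andP[sx _].
  by have [] := Phi_derive (lt_le_trans s'0 sx).
rewrite in_itv /= => /andP[s'c cs] E.
have c0 : 0 < c by exact: lt_trans s'c.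
have c1 : 1 <= c by lra.
have fc : f 1 * (s' * (1 + delta / 2) `^ (p - 2)) <= f c.
  have := power_growth ltr01 c1; rewrite powR1 mulr1; apply: le_trans.
  rewrite ler_pM2l//.
  apply: (@le_trans _ _ (s' `^ (p - 1))); last first.
    by rewrite ge0_ler_powR ?nnegrE ?subr_ge0 ?(ltW p1) ?(ltW s'0) ?(ltW c0)// ltW.
  have -> : p - 1 = 1 + (p - 2) by ring.
  rewrite (@powRD _ s' 1); last by rewrite (gt_eqF s'0) implybT.
  rewrite powRr1 ?(ltW s'0)// ler_pM2l// ge0_ler_powR ?nnegrE ?subr_ge0 ?(ltW s'0)//.
  by rewrite addr_ge0// divr_ge0// ltW.
pose th := (1 + delta / 2) `^ (p - 2).
have th0 : 0 < th by rewrite powR_gt0// addr_gt0// divr_gt0.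
have thN : (1 + delta / 2) `^ (2 - p) = th^-1 by rewrite -powRN opprB.
have PE : f 1 * (s' * th) * (s - s') <= Phi s.
  apply: (@le_trans _ _ (f c * (s - s'))); first by rewrite ler_wpM2r// subr_ge0 ltW.
  by rewrite -E lerBlDr lerDl Phi_ge0.
rewrite thN.
have : 4 * (s' * (s - s')) <= 4 * th^-1 * (Phi s / f 1).
  rewrite -mulrA ler_pM2l// mulrA ler_pdivlMr// ler_pdivlMl//.
  by apply: le_trans PE; rewrite le_eqVlt; apply/orP; left; apply/eqP; ring.
have -> : 4 * (s' * (s - s')) = s ^+ 2 - 1 by rewrite /s'; field.
have : 0 <= 2 * delta by rewrite mulr_ge0// ltW.
by move=> h1 h2; lra.
Qed.

End power_growth.

(** * Integration over the domain *)

Section integral_monotone.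
Context dp (T : measurableType dp) (R : realType) (m : {measure set T -> \bar R}).
Local Open Scope ereal_scope.
Import HBNNSimple.

(** Immediate from the definition of the integral as a supremum over the simple
    functions below the integrand. *)
Lemma ge0_integral_mono (D : set T) (f g : T -> \bar R) :
  (forall x, D x -> 0 <= f x) -> (forall x, D x -> f x <= g x) ->
  \int[m]_(x in D) f x <= \int[m]_(x in D) g x.
Proof.
move=> f0 fg; have g0 x : D x -> 0 <= g x by move=> Dx; exact: le_trans (f0 x Dx) (fg x Dx).
rewrite !ge0_integralE//; apply: ge_ereal_sup => _ [h hf <-].
apply: ereal_sup_ubound; exists h => // x; apply: le_trans (hf x) _.
by rewrite !patchE; case: ifPn => //; rewrite inE => /fg.
Qed.

Lemma ae_le_cst_integral (D : set T) (f : T -> \bar R) (c : R) : measurable D ->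
  (0 <= c)%R -> (forall x, D x -> 0 <= f x) ->
  {ae m, forall x, D x -> f x <= c%:E} -> \int[m]_(x in D) f x <= c%:E * m D.
Proof.
move=> mD c0 f0 [N [mN N0 subN]].
pose g x := ((cst +oo : T -> \bar R) \_ N) x + c%:E.
apply: (@le_trans _ _ (\int[m]_(x in D) g x)).
  apply: ge0_integral_mono => // x Dx; rewrite /g patchE; case: ifPn => [_|xN]; first by rewrite addye// leey.
  rewrite add0e.
  apply: contrapT => nle; move: xN; rewrite notin_setE; apply; apply: subN => /=.
  by move/(_ Dx).
rewrite -integral_cst// le_eqVlt; apply/orP; left; apply/eqP.
apply: ae_eq_integral => //.
  apply: emeasurable_funD => //; apply: measurable_funTS.
  exact: (measurable_restrictT _ mN).1.
exists N; split=> // x /= /not_implyP[_ gx]; apply: contrapT => xN; apply: gx.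
by rewrite /g patchE memNset//= add0e.
Qed.

End integral_monotone.

Section restricted_measure.
Context {R : realType} {d : nat} (Omega : set 'rV[R]_d) (oO : open Omega).
Local Notation lebd := (lebesgue_rV R d).
Local Notation mO := (lebesgue_on oO).

Lemma measurable_domain : measurable Omega. Proof. exact: open_measurable_mx. Qed.
Hint Resolve measurable_domain : core.

Lemma lebesgue_onT : mO setT = lebd Omega.
Proof. by rewrite /lebesgue_on /= /mrestr setTI. Qed.

Lemma ae_lebesgue_on (P : 'rV[R]_d -> Prop) :
  {ae mO, forall x, P x} <-> {ae lebd, forall x, Omega x -> P x}.
Proof.
split=> -[N [mN N0 subN]].
  exists (N `&` Omega); split; [exact: measurableI|exact: N0|].
  by move=> x /= /not_implyP[Ox nP]; split=> //; exact: subN.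
exists (N `|` ~` Omega); split; first by apply: measurableU => //; exact: measurableC.
  rewrite /= /mrestr setIUl setICl setU0; apply/eqP; rewrite -measure_le0 -N0.
  by apply: le_measure; rewrite ?inE//; exact: measurableI.
move=> x /= nP; have [Ox|] := pselect (Omega x); last by right.
by left; apply: subN => /= /(_ Ox).
Qed.

Lemma integral_lebesgue_on (f : 'rV[R]_d -> \bar R) : measurable_fun setT f ->
  (forall x, 0 <= f x)%E ->
  (\int[mO]_x f x = \int[lebd]_(x in Omega) f x)%E.
Proof.
move=> mf f0.
have N0 : mO (~` Omega) = 0%E by rewrite /= /mrestr setICl measure0.
rewrite (ge0_negligible_integral (measurableC measurable_domain) measurableT)//.
rewrite setTD setCK; apply: eq_measure_integral => A mA AO.
by rewrite /= /mrestr setIidl.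
Qed.

Lemma integrable_lebesgue_on (f : 'rV[R]_d -> R) : f \in Lfun mO 1%E ->
  measurable_fun setT f /\ lebd.-integrable Omega (EFin \o f).
Proof.
move=> /Lfun1_integrable /integrableP[mf intf].
have mf' : measurable_fun setT f by apply/measurable_EFinP.
split=> //; apply/integrableP; split; first exact: measurable_funTS.
rewrite -integral_lebesgue_on//; exact: measurableT_comp.
Qed.

Lemma L1_distE (f g : L1 mO) :
  L1_dist f g = \int[lebd]_(x in Omega) `|f x - g x|.
Proof.
have [mf _] := integrable_lebesgue_on (L1_Lfun f).
have [mg _] := integrable_lebesgue_on (L1_Lfun g).
rewrite /L1_dist Lnorm1 integral_lebesgue_on//.
by apply: measurableT_comp => //; apply/measurable_EFinP; exact: measurable_funB.
Qed.

Lemma cvg_L1 (v : nat -> L1 mO) (w : L1 mO) : v n @[n --> \oo] --> w ->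
  forall e, 0 < e -> \forall n \near \oo, \int[lebd]_(x in Omega) `|v n x - w x| < e.
Proof.
move=> vw e e0; have /cvg_ballP/(_ e e0) := vw.
by apply: filterS => n; rewrite ballEmdist /= metric_sym -L1_distE.
Qed.

End restricted_measure.

(** * Energies of a single functional *)

Section essential_bounds.
Context {R : realType} {d : nat} (Omega : set 'rV[R]_d) (oO : open Omega).
Local Notation lebd := (lebesgue_rV R d).
Local Notation mO := (lebesgue_on oO).

Lemma ess_bound (f : 'rV[R]_d -> R) (c : R) : 0 <= c ->
  ('N[mO]_+oo [EFin \o f] <= c%:E)%E <-> {ae lebd, forall x, Omega x -> `|f x| <= c}.
Proof.
move=> c0; rewrite -(ae_lebesgue_on oO (fun x => `|f x| <= c)) unlock.
case: ifPn => [_|]; first by split=> [/ess_supP|H]; [|apply/ess_supP]; exact.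
rewrite -leNgt measure_le0 => /eqP T0; split=> // _.
by exists setT; split.
Qed.

Lemma Lfun_oo_bound (f : 'rV[R]_d -> R) : f \in Lfun mO +oo%E ->
  exists2 c, 0 <= c & {ae lebd, forall x, Omega x -> `|f x| <= c}.
Proof.
rewrite inE => /andP[_]; rewrite inE /= /finite_norm.
have := Lnorm_ge0 mO +oo%E (EFin \o f).
case E : ('N[mO]_+oo[EFin \o f])%E => [c| |]//=; rewrite lee_fin => c0 _.
by exists c => //; apply/(ess_bound _ c0); rewrite E.
Qed.

Lemma bounded_Lfun_oo (f : 'rV[R]_d -> R) (c : R) : measurable_fun setT f ->
  {ae lebd, forall x, Omega x -> `|f x| <= c} -> f \in Lfun mO +oo%E.
Proof.
move=> mf fc; rewrite inE; apply/andP; split; rewrite inE//= /finite_norm.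
have fc' : {ae lebd, forall x, Omega x -> `|f x| <= `|c|}.
  by apply: filterS fc => x H Ox; apply: le_trans (H Ox) (ler_norm _).
by apply: le_lt_trans (ltry `|c|); apply/(ess_bound _ (normr_ge0 c)).
Qed.

End essential_bounds.

Lemma within_continuous_comp (U V W : topologicalType) (A : set U) (B : set V)
    (g : U -> V) (F : V -> W) : continuous g -> (forall x, A x -> B (g x)) ->
  {within B, continuous F} -> {within A, continuous (F \o g)}.
Proof.
move=> cg AB /subspace_continuousP cF; apply/subspace_continuousP => x Ax.
apply: cvg_comp (cF _ (AB _ Ax)) => P wP.
have H : \forall y \near x, B (g y) -> P (g y) by exact: (cg x _ wP).
by change (\forall y \near x, A y -> P (g y)); apply: filterS H => y HP Ay; exact: HP (AB _ Ay).
Qed.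

Section orlicz_energy.
Context {R : realType} {d : nat} (Omega : set 'rV[R]_d) (oO : open Omega).
Local Notation lebd := (lebesgue_rV R d).
Local Notation mO := (lebesgue_on oO).
Variables (phi : 'rV[R]_d -> R -> R) (p : R).
Hypotheses (bO : bounded_set Omega)
  (cphi : {within closure Omega `*` [set s : R | 0 <= s],
     continuous (fun z : 'rV[R]_d * R => phi z.1 z.2)})
  (dphi : Ck 1 (Omega `*` [set s : R | 0 < s]) (fun z : 'rV[R]_d * R => phi z.1 z.2))
  (phi0 : forall x s, Omega x -> 0 < s -> 0 < phi x s)
  (p1 : 1 < p)
  (growth : forall x s, Omega x -> 0 < s -> p - 1 <= s * derive1 (phi x) s / phi x s).

Let Phi := primitive_in_s phi.
Let V := fine (lebd Omega).

Let mOm : measurable Omega. Proof. exact: open_measurable_mx. Qed.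
Let Ooo : (lebd Omega < +oo)%E. Proof. exact: bounded_measure_lty. Qed.
Let VE : lebd Omega = V%:E. Proof. by rewrite /V fineK// ge0_fin_numE. Qed.
Let V0 : 0 <= V. Proof. exact: fine_ge0. Qed.

Let slice_continuous x : Omega x -> {within [set s : R | 0 <= s], continuous (phi x)}.
Proof.
move=> Ox; apply: (within_continuous_comp (g := fun s : R => (x, s)) _ _ cphi).
  by move=> s; apply: (cvg_pair (cvg_cst x) cvg_id).
by move=> s s0; split=> //; exact: subset_closure.
Qed.

Let slice_derivable x (s : R) : Omega x -> 0 < s -> derivable (phi x) s 1.
Proof.
move=> Ox s0; have [_ [dd _]] := dphi; have := dd (x, s) (0, 1) (conj Ox s0).
rewrite /derivable; set F := (fun h => _); set G := (fun h => _).
suff -> : F = G by [].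
by apply/funext => h; rewrite /F /G /= scaler0 add0r.
Qed.

Let phi1_bounded : exists2 K, 0 <= K & forall x, Omega x -> phi x 1 <= K.
Proof.
have [M OM] := bounded_sub_cbox bO.
have cQ := @compact_cbox R d (fun=> - M) (fun=> M).
have cO : compact (closure Omega).
  apply: subclosed_compact (cQ) _; first exact: closed_closure.
  have /closure_id -> := compact_closed (@norm_hausdorff _ _) cQ.
  exact: closure_subset.
have : bounded_set ((fun x => phi x 1) @` closure Omega).
  apply: compact_bounded; apply: continuous_compact cO.
  apply: (within_continuous_comp (g := fun x : 'rV[R]_d => (x, 1 : R)) _ _ cphi).
    by move=> x; apply: (@cvg_pair _ _ _ (nbhs x) (nbhs x) (nbhs (1 : R))); [exact: cvg_id|exact: cvg_cst].
  by move=> x clx; split=> //=; exact: ler01.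
move=> [K [_ HK]]; exists (`|K| + 1); first by rewrite addr_ge0.
move=> x Ox; apply: le_trans (ler_norm _) (HK _ _ _ _).
  by rewrite (le_lt_trans (ler_norm K))// ltrDl.
by exists x => //; exact: subset_closure.
Qed.

Let Phi_ge0' x s : Omega x -> 0 <= Phi x s.
Proof.
by move=> Ox; apply: (Phi_ge0 (slice_continuous Ox)) => t t0; exact: phi0.
Qed.

Let Phi_le1' x s : Omega x -> 0 <= s -> s <= 1 -> Phi x s <= s * phi x 1 /\ Phi x s <= phi x 1 / p.
Proof.
move=> Ox; apply: (Phi_le1 (slice_continuous Ox) _ _ p1) => t t0.
- exact: slice_derivable.
- exact: phi0.
- exact: growth.
Qed.

Let density x (s : R) := Phi x s / phi x 1.

Let density_ge0 x s : Omega x -> 0 <= density x s.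
Proof. by move=> Ox; rewrite divr_ge0 ?Phi_ge0' ?ltW ?phi0. Qed.

Lemma energy_ge0 (w : L1 mO) : (0 <= energy oO phi w)%E.
Proof.
rewrite /energy; case: ifPn => // _; apply: integral_ge0 => x Ox.
by rewrite lee_fin; exact: density_ge0.
Qed.

Let LPhi_bounded (w : 'rV[R]_d -> R) : w \in Lfun mO +oo%E -> LPhi oO Phi w.
Proof.
move=> woo; have [c c0 wc] := Lfun_oo_bound woo; have [K K0 HK] := phi1_bounded.
split.
  apply: (@Lfun_subset _ _ _ mO 1%E +oo%E (lexx _) (leey _) _ (leey _) w woo).
  by rewrite lebesgue_onT VE.
have bnd (t : R) : `|t| * c <= 1 ->
    (0 <= modular Omega Phi (fun x => t * w x)%R <= (`|t| * c * K * V)%:E)%E.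
  move=> tc; apply/andP; split.
    by apply: integral_ge0 => x Ox; rewrite lee_fin Phi_ge0'.
  rewrite EFinM -VE; apply: ae_le_cst_integral => //.
  - by rewrite !mulr_ge0.
  - by move=> x Ox; rewrite lee_fin Phi_ge0'.
  - apply: filterS wc => x wx Ox; rewrite lee_fin normrM.
    have tw : `|t| * `|w x| <= `|t| * c by rewrite ler_wpM2l ?wx.
    have [H _] := Phi_le1' Ox (mulr_ge0 (normr_ge0 t) (normr_ge0 (w x))) (le_trans tw tc).
    by apply: le_trans H _; rewrite ler_pM ?mulr_ge0 ?HK ?(ltW (phi0 _ _)).
apply: (@squeeze_cvge _ _ _ _ (cst 0%E) _ (fun t => (`|t| * c * K * V)%:E)).
- near=> t; apply: bnd.
  have : `|t| <= (c + 1)^-1 by near: t; apply: dnbhs0_le; rewrite invr_gt0 ltr_wpDl.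
  rewrite -[_ <= _^-1](ler_pM2r (ltr_wpDl c0 ltr01)) mulVf ?gt_eqF ?ltr_wpDl//.
  by apply: le_trans; rewrite ler_wpM2l// lerDl.
- exact: cvg_cst.
- apply: cvg_EFin; first exact: nearW.
  have N0 : `|t| @[t --> (0 : R)^'] --> `|0 : R|.
    by move=> P /(@norm_continuous R R 0); exact: nbhs_dnbhs.
  have -> : fine \o (fun t : R => (`|t| * c * K * V)%:E) = (fun t => `|t| * (c * K * V)).
    by apply/funext => t /=; rewrite !mulrA.
  have : `|t| * (c * K * V) @[t --> (0 : R)^'] --> `|0 : R| * (c * K * V) by exact: cvgMr_tmp N0.
  by rewrite normr0 mul0r.
Unshelve. all: end_near. Qed.

(** Where the gradient has norm at most 1, the density is at most [1 / p] by
    [Phi_le1]. *)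
Lemma energy_le (w : L1 mO) : W1oo oO w ->
  ('N[mO]_+oo [EFin \o (fun x => euclidean_norm (weak_gradient Omega w x))] <= 1)%E ->
  (energy oO phi w <= (V / p)%:E)%E.
Proof.
move=> [woo [G wG Goo]] /(ess_bound oO _ ler01) bnd.
have WPhi : W1Phi oO Phi w.
  by split; [exact: LPhi_bounded|exists G => // i; exact: LPhi_bounded (Goo i)].
rewrite /energy asboolT//.
have -> : (V / p)%:E = ((p^-1)%:E * lebd Omega)%E by rewrite VE -EFinM mulrC.
apply: ae_le_cst_integral => //.
- by rewrite invr_ge0 ltW// (lt_trans ltr01).
- by move=> x Ox; rewrite lee_fin; exact: density_ge0.
- apply: filterS bnd => x /[swap] Ox /(_ Ox); rewrite ger0_norm ?sqrtr_ge0// => en.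
  have [_ H] := Phi_le1' Ox (sqrtr_ge0 _) en.
  by rewrite lee_fin ler_pdivrMr ?phi0// mulrC.
Qed.

(** Since [v] is close to [u] in mean, its gradient nearly is one of [u]; the
    excess of this gradient over the unit ball is paid for by the energy, up to
    a factor that vanishes as [p] grows. *)
Lemma almost_gradient_of_energy (u v : L1 mO) (e C delta : R) :
  2 <= p -> 0 < delta -> (energy oO phi v <= C%:E)%E ->
  \int[lebd]_(x in Omega) `|v x - u x| <= e ->
  (2 * delta + delta ^+ 2) * V + 4 * (1 + delta / 2) `^ (2 - p) * C <= e ->
  exists G, almost_gradient Omega u e G.
Proof.
move=> p2 delta0; rewrite /energy; case: asboolP => [W enC uv smallness|]; last by [].
pose g := weak_gradient Omega v.
have vg : is_weak_gradient Omega v g.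
  by case: W => _ [G0 vG0 _]; apply: xgetPex; exists G0.
have mg i : measurable_fun Omega (fun x => g x ord0 i).
  exact: locally_integrable_measurable oO (vg i).1.
pose G x : 'rV[R]_d := \row_i ((fun y => g y ord0 i) \_ Omega) x.
have GO x : Omega x -> G x = g x.
  by move=> Ox; apply/rowP => i; rewrite mxE patchE mem_set.
have mG i : measurable_fun setT (fun x => G x ord0 i).
  rewrite (_ : (fun x => _) = (fun y => g y ord0 i) \_ Omega).
    exact: (measurable_restrictT _ mOm).1.
  by apply/funext => x; rewrite mxE.
pose c := 2 * delta + delta ^+ 2; pose k := 4 * (1 + delta / 2) `^ (2 - p).
have k0 : 0 < k by rewrite mulr_gt0// powR_gt0// addr_gt0// divr_gt0.
(* the least function that [exh] allows; unlike the density itself, it is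
   measurable by construction *)
pose h x := Num.max (excess (G x) - c) 0 / k.
have h0 x : 0 <= h x by rewrite divr_ge0 ?(ltW k0)// le_max lexx orbT.
have mh : measurable_fun setT h.
  apply: measurable_funM => //; apply: measurable_maxr => //.
  by apply: measurable_funB => //; exact: measurable_excess.
have hC : (\int[lebd]_(x in Omega) (h x)%:E <= C%:E)%E.
  apply: le_trans enC; apply: ge0_integral_mono => x Ox; rewrite lee_fin//.
  rewrite ler_pdivrMr// mulrC ge_max; apply/andP; split; last first.
    by rewrite mulr_ge0 ?(ltW k0)//; exact: density_ge0.
  rewrite lerBlDl GO//.
  have := excess_le_Phi (slice_continuous Ox) (fun s => slice_derivable Ox)
    (fun s => phi0 Ox) p1 (fun s => growth Ox) p2 delta0 (sqrtr_ge0 (sqnorm (g x))).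
  by rewrite sqr_sqrtr ?sqnorm_ge0.
have exh x : excess (G x) <= c + k * h x.
  by rewrite /h [k * _]mulrC divfK ?gt_eqF// -lerBlDl le_max lexx.
have hi : lebd.-integrable Omega (EFin \o h).
  apply/integrableP; split; first by apply/measurable_EFinP; exact: measurable_funTS.
  apply: le_lt_trans (ltry C); apply: le_trans hC.
  by rewrite le_eqVlt; apply/orP; left; apply/eqP; apply: eq_integral => x _ /=; rewrite ger0_norm.
have ci (t : R) : lebd.-integrable Omega (EFin \o (fun=> t)).
  apply: measurable_bounded_integrable => //.
  by exists `|t|; split=> // z Cz x _; exact: ltW.
have khi : lebd.-integrable Omega (EFin \o (fun x => k * h x)) by exact: (integrableZl mOm k hi).
have bi : lebd.-integrable Omega (EFin \o (fun x => c + k * h x)) by exact: (integrableD mOm (ci c) khi).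
have exi : lebd.-integrable Omega (EFin \o (fun x => excess (G x))).
  apply: (le_integrable_fin oO _ _ bi).
    by apply: measurable_funTS; exact: measurable_excess.
  by move=> x; rewrite ger0_norm ?excess_ge0.
exists G; split=> //.
- apply: (le_integrable_fin oO (g := fun x => 1 + (c + k * h x))).
  + by apply: measurable_funTS; exact: measurable_sqnorm.
  + move=> x; rewrite ger0_norm ?sqnorm_ge0// -lerBlDl; apply: le_trans (exh x).
    by rewrite le_max lexx.
  + exact: (integrableD mOm (ci 1) bi).
- apply: le_trans smallness; apply: (le_trans (le_Rintegral mOm exi bi (fun x _ => exh x))).
  rewrite RintegralD// Rintegral_cst// RintegralZl// lerD2l ler_pM2l//.
  by rewrite -lee_fin /Rintegral fineK//; exact: integrable_fin_num.
- move=> i psi K tpsi HK.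
  have [mu ui] := integrable_lebesgue_on (L1_Lfun u).
  have [mv vi] := integrable_lebesgue_on (L1_Lfun v).
  have mD : measurable_fun Omega ('D_(delta_mx ord0 i) psi).
    by apply: measurable_funTS; apply: continuous_measurable_rV; exact: test_derive_continuous tpsi.
  have Di (f : 'rV[R]_d -> R) : lebd.-integrable Omega (EFin \o f) ->
      lebd.-integrable Omega (EFin \o (fun x => f x * 'D_(delta_mx ord0 i) psi x)).
    by move=> fi; apply: (@integrable_mul_bounded _ _ _ _ _ _ _ K).
  have -> : \int[lebd]_(x in Omega) (G x ord0 i * psi x) =
            - \int[lebd]_(x in Omega) (v x * 'D_(delta_mx ord0 i) psi x).
    rewrite (vg i).2// opprK; apply: eq_Rintegral => x; rewrite inE => Ox.
    by rewrite GO.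
  have K0 : 0 <= K by exact: le_trans (HK 0).
  have vui : lebd.-integrable Omega (EFin \o (fun x => `|v x - u x|)).
    exact: (integrable_norm (integrableB mOm vi ui)).
  rewrite -RintegralB ?Di//; apply: (@le_trans _ _ (\int[lebd]_(x in Omega) (K * `|v x - u x|))).
    apply: Rintegral_norm_le => //.
    * exact: (integrableB mOm (Di _ ui) (Di _ vi)).
    * exact: (integrableZl mOm K vui).
    * by move=> x _; rewrite -mulrBl normrM mulrC distrC ler_wpM2r.
  by rewrite RintegralZl// mulrC ler_wpM2r.
Qed.

End orlicz_energy.

(** * The Gamma-limit *)

Lemma powR_2B_small (R : realType) (b eps : R) : 1 < b -> 0 < eps ->
  exists P, forall p, P <= p -> b `^ (2 - p) <= eps.
Proof.
move=> b1 eps0; have b0 : 0 < b by exact: lt_trans b1.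
have lnb : 0 < ln b by exact: ln_gt0.
exists (2 + eps^-1 / ln b) => p Pp.
have -> : b `^ (2 - p) = (b `^ (p - 2))^-1 by rewrite -powRN opprB.
rewrite -[leRHS]invrK lef_pV2 ?posrE ?invr_gt0 ?powR_gt0//.
rewrite /powR gt_eqF//; apply: le_trans (expR_ge1Dx _); apply: ler_wpDl => //.
by rewrite -ler_pdivrMr// lerBrDl.
Qed.

Section gamma_limit.
Context {R : realType} {d : nat} (Omega : set 'rV[R]_d) (oO : open Omega).
Local Notation lebd := (lebesgue_rV R d).
Local Notation mO := (lebesgue_on oO).
Variables (phi : nat -> 'rV[R]_d -> R -> R) (p : nat -> R).
Hypotheses (d0 : (0 < d)%N) (dom : bounded_smooth_domain Omega)
  (cphi : forall n, (1 <= n)%N ->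
     {within closure Omega `*` [set s : R | 0 <= s],
        continuous (fun z : 'rV[R]_d * R => phi n z.1 z.2)})
  (dphi : forall n, (1 <= n)%N ->
     Ck 1 (Omega `*` [set s : R | 0 < s]) (fun z : 'rV[R]_d * R => phi n z.1 z.2))
  (phi0 : forall n x s, (1 <= n)%N -> Omega x -> 0 < s -> 0 < phi n x s)
  (p1 : forall n, (1 <= n)%N -> 1 < p n)
  (growth : forall n x s, (1 <= n)%N -> Omega x -> 0 < s ->
     p n - 1 <= s * derive1 (phi n x) s / phi n x s)
  (poo : p n @[n --> \oo] --> +oo).

Let V := fine (lebd Omega).
Let bO : bounded_set Omega. Proof. by case: dom. Qed.
Let Ooo : (lebd Omega < +oo)%E. Proof. exact: bounded_measure_lty. Qed.
Let V0 : 0 <= V. Proof. exact: fine_ge0. Qed.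

Let p_large (A : R) : \forall n \near \oo, A <= p n.
Proof. by have /cvgryPge/(_ A) := poo. Qed.

Lemma exists_almost_gradient (v : nat -> L1 mO) (u : L1 mO) (C : R) :
  0 < C -> v n @[n --> \oo] --> u ->
  (forall N, exists2 n, (N <= n)%N & (energy oO (phi n) (v n) <= C%:E)%E) ->
  forall eps, 0 < eps -> exists G, almost_gradient Omega u eps G.
Proof.
move=> C0 vu freq eps eps0.
(* so that (2 delta + delta^2) V <= 3 delta V <= eps / 2 *)
pose delta := Num.min 1 (eps / (6 * (V + 1))).
have V1 : 0 < V + 1 by rewrite ltr_wpDl.
have delta0 : 0 < delta by rewrite lt_min ltr01 divr_gt0// mulr_gt0.
have delta1 : delta <= 1 by rewrite ge_min lexx.
have deltaV : delta * (V + 1) <= eps / 6.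
  rewrite -ler_pdivlMr// ge_min; apply/orP; right.
  by rewrite invfM mulrA.
have [P HP] := @powR_2B_small R (1 + delta / 2) (eps / (8 * C))
  (ltac:(by rewrite ltrDl divr_gt0)) (ltac:(by rewrite divr_gt0// mulr_gt0)).
have : \forall n \near \oo, [/\ (1 <= n)%N, 2 <= p n, P <= p n &
    \int[lebd]_(x in Omega) `|v n x - u x| < eps].
  near=> n; split; near: n.
  - exact: nbhs_infty_ge.
  - exact: p_large.
  - exact: p_large.
  - exact: cvg_L1.
move=> [N _ HN]; have [n Nn En] := freq N; have [n1 p2 Pp vun] := HN n Nn.
apply: (almost_gradient_of_energy bO (cphi n1) (dphi n1) _ (p1 n1) _ p2 delta0 En (ltW vun)).
- by move=> x s; exact: phi0.
- by move=> x s; exact: growth.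
rewrite -/V; have th : 4 * (1 + delta / 2) `^ (2 - p n) * C <= eps / 2.
  have := HP _ Pp; rewrite ler_pdivlMr ?mulr_gt0//; lra.
have d2 : delta ^+ 2 <= delta by rewrite expr2 -[leRHS]mulr1 ler_pM2l.
have : (2 * delta + delta ^+ 2) * V <= 3 * delta * V by rewrite ler_wpM2r//; lra.
lra.
Unshelve. all: end_near. Qed.

Lemma energy_liminf (v : nat -> L1 mO) (u : L1 mO) : v n @[n --> \oo] --> u ->
  (energy_oo oO u <= limn_einf (fun n => energy oO (phi n) (v n)))%E.
Proof.
move=> vu; set J := fun n => _.
have J0 : (0 <= limn_einf J)%E.
  apply: le_limn_einf; exists 1%N => // n n1.
  apply: (energy_ge0 (cphi n1)); first by move=> x s; exact: phi0.
have [Joo|] := ltP (limn_einf J) +oo%E; last by apply: le_trans; exact: leey.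
have [C C0 JC] : exists2 C : R, 0 < C & (limn_einf J < C%:E)%E.
  case: (limn_einf J) J0 Joo => [r| |]//; rewrite lee_fin => r0 _.
  by exists (r + 1); rewrite ?ltr_wpDl// lte_fin ltrDl.
have [mu ui] := integrable_lebesgue_on (L1_Lfun u).
have [G [uG mG G1]] := almost_gradient_limit oO Ooo
  (exists_almost_gradient C0 vu (frequently_le_limn_einf JC)).
have GM x i : Omega x -> `|G x ord0 i| <= 1.
  move=> _; rewrite -(@expr_le1 _ 2)// real_normK ?num_real//.
  exact: le_trans (coord_sq_le _ _) (G1 x).
have [M uM] := bounded_weak_gradient_bounded d0 dom ui uG GM ler01.
rewrite /energy_oo asboolT//; split.
  split; first exact: bounded_Lfun_oo mu uM.
  exists G => // i; apply: bounded_Lfun_oo (mG i) _.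
  by apply: aeW => x Ox; exact: GM.
apply/(ess_bound oO _ ler01).
have gG : is_weak_gradient Omega u (weak_gradient Omega u).
  by apply: xgetPex; exists G.
have : {ae lebd, forall x, forall i, Omega x -> weak_gradient Omega u x ord0 i = G x ord0 i}.
  by apply: filter_forall => i; exact: weak_gradient_unique.
apply: filterS => x E Ox; rewrite (_ : weak_gradient Omega u x = G x).
  by rewrite ger0_norm ?sqrtr_ge0// -[leRHS]sqrtr1 ler_wsqrtr ?G1.
by apply/rowP => i; exact: E.
Qed.

Lemma energy_limsup (u : L1 mO) :
  (limn_esup (fun n => energy oO (phi n) u) <= energy_oo oO u)%E.
Proof.
rewrite /energy_oo; case: asboolP => [[W N1]|_]; last exact: leey.
apply/lee_addgt0Pr => e e0; rewrite add0e; apply: limn_esup_le; near=> n.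
have n1 : (1 <= n)%N by near: n; exact: nbhs_infty_ge.
apply: (le_trans (energy_le bO (cphi n1) (dphi n1) _ (p1 n1) _ W N1)).
- by move=> x s; exact: phi0.
- by move=> x s; exact: growth.
rewrite lee_fin ler_pdivrMr ?(lt_trans ltr01 (p1 n1))// mulrC -ler_pdivrMr//.
by near: n; exact: p_large.
Unshelve. all: end_near. Qed.

End gamma_limit.

Theorem theorem4 (R : realType) (d : nat) (Omega : set 'rV[R]_d)
    (oOmega : open Omega) (phi : nat -> 'rV[R]_d -> R -> R)
    (pm pp : nat -> R) (mu : R) :
  (0 < d)%N ->
  bounded_smooth_domain Omega ->
  (forall n : nat, (1 <= n)%N ->
     {within closure Omega `*` [set s : R | 0 <= s],
        continuous (fun z : 'rV[R]_d * R => phi n z.1 z.2)}) ->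
  (forall n : nat, (1 <= n)%N ->
     Ck 1 (Omega `*` [set s : R | 0 < s])
       (fun z : 'rV[R]_d * R => phi n z.1 z.2)) ->
  (forall (n : nat) (x : 'rV[R]_d) (s : R), (1 <= n)%N -> Omega x -> 0 < s -> 0 < phi n x s) ->
  (forall n : nat, (1 <= n)%N -> [/\ 0 < pm n, 0 < pp n & 0 < pm n - 1]) ->
  (forall (n : nat) (x : 'rV[R]_d) (s : R), (1 <= n)%N -> Omega x -> 0 < s ->
     pm n - 1 <= s * derive1 (phi n x) s / phi n x s <= pp n - 1) ->
  pm n @[n --> \oo] --> +oo ->
  1 < mu ->
  (forall n : nat, (1 <= n)%N -> pp n <= mu * pm n) ->
  Gamma_converges (fun n => energy oOmega (phi n)) (energy_oo oOmega).
Proof.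
move=> d0 dom cphi dphi phi0 pmpp growth pmoo _ _ u.
have pm1 n : (1 <= n)%N -> 1 < pm n by move=> /pmpp[_ _]; rewrite subr_gt0.
have growth' n x s : (1 <= n)%N -> Omega x -> 0 < s ->
    pm n - 1 <= s * derive1 (phi n x) s / phi n x s.
  by move=> n1 Ox s0; have /andP[] := growth n x s n1 Ox s0.
split=> [v vu|]; first exact: (energy_liminf d0 dom cphi dphi phi0 pm1 growth' pmoo vu).
exists (fun=> u); split; first exact: cvg_cst.
exact: (energy_limsup dom cphi dphi phi0 pm1 growth' pmoo).
Qed.
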